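(* Let $f$ be the solution (given in the context) of the $\mathrm{MVN}(\mathbf 0,\Sigma)$ Stein equation with test function $h(g(\cdot))$. Suppose $\Sigma\in\mathbb R^{d\times d}$ is non-negative definite and that $h\in C_b^n(\mathbb{R})$ and $g\in C_P^n(\mathbb{R}^d)$, where $n\geq 1$ and $P\in\mathcal{F}$. Then, for all $\mathbf{w}\in\mathbb{R}^d$, $$\bigg|\frac{\partial^nf(\mathbf{w})}{\prod_{j=1}^n\partial w_{i_j}}\bigg|\leq\frac{h_n}{n}\Big[\alpha+\beta_2\big(\mathbb{E}P_1(\Sigma^{1/2}\mathbf{Z})+P_1(\mathbf{w})\big) +\gamma_2P_2(\delta_2\mathbf{w})\mathbb{E}P_2(\delta_2\Sigma^{1/2}\mathbf{Z})\Big].$$ Suppose now that $\Sigma$ is positive definite and that $h\in C_b^{n-1}(\mathbb{R})$ and $g\in C_P^{n-1}(\mathbb{R}^d)$, where $n\geq 2$ and $P\in\mathcal{F}_*$. Then, for all $\mathbf{w}\in\mathbb{R}^d$, \begin{align*} \bigg|\frac{\partial^{n}f(\mathbf{w})}{\prod_{j=1}^{n}\partial w_{i_j}}\bigg|&\leq h_{n-1}\min_{1\leq l\leq d} \Big[\alpha\mathbb{E}|(\Sigma^{-1/2}\mathbf{Z})_l|+\beta_2\big(\mathbb{E}|(\Sigma^{-1/2}\mathbf{Z})_lP_1(\Sigma^{1/2}\mathbf{Z})|\\ &\quad+\mathbb{E}|(\Sigma^{-1/2}\mathbf{Z})_l|P_1(\mathbf{w})\big)+\gamma_2\mathbb{E}|(\Sigma^{-1/2}\mathbf{Z})_lP_2(\delta_2\Sigma^{1/2}\mathbf{Z})|P_2(\delta_2\mathbf{w})\Big].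 \end{align*}
   Context: $\mathbf Z\sim N(\mathbf 0,I_d)$; $(\cdot)_l$ denotes the $l$-th component; $i_1,\ldots,i_n\in\{1,\ldots,d\}$. The Stein equation is $\nabla^T\Sigma\nabla f(\mathbf{w})-\mathbf{w}^T\nabla f(\mathbf{w})=h(g(\mathbf{w}))-\mathbb{E}h(g(\Sigma^{1/2}\mathbf{Z}))$, and the solution considered is $$f(\mathbf{w})=-\int_{0}^{\infty}\big[\mathbb{E}h(g(\mathrm{e}^{-s}\mathbf{w}+\sqrt{1-\mathrm{e}^{-2s}}\,\Sigma^{1/2}\mathbf{Z}))-\mathbb{E}h(g(\Sigma^{1/2}\mathbf{Z}))\big]\,\mathrm{d}s.$$ $\|u\|$ is the supremum norm. $h\in C_b^n(\mathbb{R})$ means that $h^{(n-1)}$ exists and is absolutely continuous, with derivatives up to $n$-th order bounded. For a given non-negative function $P$ on $\mathbb R^d$, $g\in C_P^n(\mathbb{R}^d)$ means that all $n$-th order partial derivatives of $g:\mathbb R^d\to\mathbb R$ exist and $\big|\frac{\partial^k g(\mathbf w)}{\prod_{j=1}^k\partial w_{i_j}}\big|^{n/k}\le P(\mathbf w)$ for all $\mathbf w\in\mathbb R^d$ and $k=1,\ldots,n$. $h_n:=\sum_{k=1}^n{n\brace k}\|h^{(k)}\|$ with ${n\brace k}$ the Stirling numbers of the second kind. Classes $\mathcal F$ and $\mathcal F_*$: suppose $P(\mathbf{w})=\alpha+P_1(\mathbf{w})+P_2(\mathbf{w})$, where $\alpha$ is a non-negative constant, and consider the conditions (i) $P_1,P_2$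 are non-negative, non-decreasing functions, in the sense that $P_i(\mathbf{w})\leq P_i(a\mathbf{w})$, $i=1,2$, for any $\mathbf{w}\in\mathbb{R}^d$ and $a>1$; (ii) there exist non-negative constants $\beta_k,\gamma_k,\delta_k$ such that, for any $\mathbf{w}_1,\ldots,\mathbf{w}_k\in\mathbb{R}^d$, $P_1(\mathbf{w}_1+\cdots+\mathbf{w}_k)\leq\beta_k\sum_{j=1}^kP_1(\mathbf{w}_j)$ and $P_2(\mathbf{w}_1+\cdots+\mathbf{w}_k)\leq\gamma_k\prod_{j=1}^kP_2(\delta_k\mathbf{w}_j)$; (iii) the expectations $\mathbb{E}P_1(\Sigma^{1/2}\mathbf{Z})$ and $\mathbb{E}P_2(\Sigma^{1/2}\mathbf{Z})$ exist; (iii)' the expectations $\mathbb{E}|(\mathbf{Z})_iP_1(\Sigma^{1/2}\mathbf{Z})|$ and $\mathbb{E}|(\mathbf{Z})_iP_2(\Sigma^{1/2}\mathbf{Z})|$ exist for all $i=1,\ldots,d$. $P\in\mathcal{F}$ means that (i)-(iii) hold; $P\in\mathcal{F}_*$ means that (i)-(iii)' hold.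
   Formalization: The second minimum is over l in {i_1,…,i_n}, not all 1≤l≤d (false as printed); existence of the n-th derivative is claimed only when the right side is finite and, in the first part, Σ is positive definite or h^(n-1) is differentiable everywhere; else the bound holds where it exists. *)

(* Defs.v *)
From HB Require Import structures.
From mathcomp Require Import all_boot all_order all_algebra.
From mathcomp Require Import all_classical all_reals all_analysis.

Set Implicit Arguments.
Unset Strict Implicit.
Unset Printing Implicit Defensive.

Import Order.TTheory GRing.Theory Num.Theory.
Import numFieldNormedType.Exports.

Local Open Scope classical_set_scope.
Local Open Scope ring_scope.

Section Matrices.
Context {R : realType} {d : nat}.
Implicit Types A S : 'M[R]_d.

Definition nonneg_definite A : Prop :=
  A^T = A /\ forall x : 'cV[R]_d, 0 <= (x^T *m A *m x) 0 0.

Definition pos_definite A : Prop :=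
  A^T = A /\ forall x : 'cV[R]_d, x != 0 -> 0 < (x^T *m A *m x) 0 0.

(* S = A^{1/2}: the unique nonnegative definite square root. *)
Definition is_sqrtmx S A : Prop := nonneg_definite S /\ S *m S = A.

End Matrices.

Section Derivatives.
Context {R : realType} {d : nat}.
Implicit Types (F : 'cV[R]_d -> R) (s : seq 'I_d) (w : 'cV[R]_d).

(* pderiv [:: i_1; ...; i_k] F is d^k F / (dw_{i_1} ... dw_{i_k}), the
   innermost derivative being the one with respect to w_{i_k}.
   Where a derivative does not exist the value is arbitrary, so pderiv is
   only meaningful together with has_pderiv. *)
Fixpoint pderiv s F : 'cV[R]_d -> R :=
  if s is i :: s' then fun w => 'D_(delta_mx i 0) (pderiv s' F) w else F.

(* The derivative pderiv s F exists at w, the inner ones existing everywhere. *)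
Fixpoint has_pderiv s F w : Prop :=
  if s is i :: s' then
    (forall x, has_pderiv s' F x) /\
    derivable (pderiv s' F) w (delta_mx i 0)
  else True.

(* g \in C_P^n(R^d) *)
Definition C_P (n : nat) (P : 'cV[R]_d -> R) (g : 'cV[R]_d -> R) : Prop :=
  (forall s w, (size s <= n)%N -> has_pderiv s g w) /\
  (forall s w, (0 < size s <= n)%N ->
     `|pderiv s g w| `^ (n%:R / (size s)%:R) <= P w).

End Derivatives.

Section TestFunctions.
Context {R : realType}.
Implicit Types h F : R -> R.

Definition abs_continuous_on (a b : R) F : Prop :=
  forall e : R, 0 < e -> exists2 r : R, 0 < r &
    forall (m : nat) (u v : 'I_m -> R),
      (forall j, a <= u j /\ u j <= v j /\ v j <= b) ->
      (forall j k, j != k -> v j <= u k \/ v k <= u j) ->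
      \sum_(j < m) (v j - u j) < r ->
      \sum_(j < m) `|F (v j) - F (u j)| < e.

(* The points where h^(k) exists, given that h^(k-1) exists everywhere. *)
Definition deriv_dom h (k : nat) : set R := [set x | derivable (derive1n k.-1 h) x 1].

(* h \in C_b^n(R), for n >= 1. An absolutely continuous function is in general
   differentiable only almost everywhere, so h^(n) is only required to exist
   almost everywhere, and to be bounded where it exists. The function h itself
   need not be bounded. Absolute continuity is meant on compact intervals; as
   h^(n) is bounded this is the same as absolute continuity on R. *)
Definition C_b (n : nat) h : Prop :=
  [/\ forall k x, (0 < k < n)%N -> deriv_dom h k x,
      forall a b, abs_continuous_on a b (derive1n n.-1 h),
      {ae (@lebesgue_measure R), forall x, deriv_dom h n x} &
      exists M : R, forall k x,
        (0 < k <= n)%N -> deriv_dom h k x -> `|derive1n k h x| <= M].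

(* || h^(k) ||, the supremum being over the points where h^(k) exists. *)
Definition deriv_norm h (k : nat) : R :=
  sup [set `|derive1n k h x| | x in deriv_dom h k].

(* Stirling numbers of the second kind *)
Fixpoint stirling2 (n k : nat) : nat :=
  match n, k with
  | 0, 0 => 1
  | 0, _.+1 => 0
  | _.+1, 0 => 0
  | n'.+1, k'.+1 => k'.+1 * stirling2 n' k'.+1 + stirling2 n' k'
  end%N.

(* h_n *)
Definition h_const (n : nat) h : R :=
  \sum_(1 <= k < n.+1) (stirling2 n k)%:R * deriv_norm h k.

End TestFunctions.

Section Probability.
Context {R : realType} {disp : measure_display} {Omega : measurableType disp}.
Variables (Pr : probability Omega R) (d : nat).

(* Z ~ N(0, I_d): independent standard normal components *)
Definition std_normal_vector (Z : 'I_d -> {RV Pr >-> R}) : Prop :=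
  (forall i (A : set R), measurable A ->
     Pr (Z i @^-1` A) = normal_prob 0 1 A) /\
  (forall A : 'I_d -> set R, (forall i, measurable (A i)) ->
     Pr (\bigcap_i (Z i @^-1` A i)) = (\prod_(i < d) Pr (Z i @^-1` A i))%E).

Definition vecZ (Z : 'I_d -> {RV Pr >-> R}) (om : Omega) : 'cV[R]_d :=
  \col_i Z i om.

(* The class F for P = alpha + P1 + P2, with X = Sigma^{1/2} Z; the constants
   of (ii) enter the conclusion, so they are parameters. For k = 0 the first
   inequality of (ii) would read P1(0) <= 0. *)
Definition class_F (X : Omega -> 'cV[R]_d) (alpha : R)
    (P1 P2 : 'cV[R]_d -> R) (beta gamma delta : nat -> R) : Prop :=
  [/\ 0 <= alpha,
      (forall w, 0 <= P1 w /\ 0 <= P2 w) /\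
      (forall w (a : R), 1 < a -> P1 w <= P1 (a *: w) /\ P2 w <= P2 (a *: w)),
      forall k, (0 < k)%N ->
        [/\ 0 <= beta k, 0 <= gamma k, 0 <= delta k,
            forall w : 'I_k -> 'cV[R]_d,
              P1 (\sum_(j < k) w j) <= beta k * \sum_(j < k) P1 (w j) &
            forall w : 'I_k -> 'cV[R]_d,
              P2 (\sum_(j < k) w j) <=
                gamma k * \prod_(j < k) P2 (delta k *: w j)] &
      Pr.-integrable setT (EFin \o (P1 \o X)) /\
      Pr.-integrable setT (EFin \o (P2 \o X))].

(* (iii)', to be added to class_F for the class F_* *)
Definition class_Fstar (Z : 'I_d -> {RV Pr >-> R}) (X : Omega -> 'cV[R]_d)
    (alpha : R) (P1 P2 : 'cV[R]_d -> R) (beta gamma delta : nat -> R) : Prop :=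
  class_F X alpha P1 P2 beta gamma delta /\
  forall i,
    Pr.-integrable setT (fun om => (`|Z i om * P1 (X om)|)%:E) /\
    Pr.-integrable setT (fun om => (`|Z i om * P2 (X om)|)%:E).

(* The solution f of the Stein equation, with X = Sigma^{1/2} Z *)
Definition stein_solution (X : Omega -> 'cV[R]_d) (h : R -> R)
    (g : 'cV[R]_d -> R) (w : 'cV[R]_d) : R :=
  - \int[@lebesgue_measure R]_(s in `]0, +oo[)
      (fine ('E_Pr[fun om => h (g (expR (- s) *: w +
                     Num.sqrt (1 - expR (- (2 * s))) *: X om)%R)])%E
       - fine ('E_Pr[fun om => h (g (X om))])%E).

(* The brackets of the two bounds. They are extended reals because the classes
   F and F_* do not force the expectations involving P2(delta_2 X) to be
   finite. In bound2, y is the l-th component of Sigma^{-1/2} Z; Gaussian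
   integration by parts of a derivative along w_l produces exactly this
   component, so l has to be one of the differentiation indices. *)
Definition bound1 (X : Omega -> 'cV[R]_d) (alpha : R)
    (P1 P2 : 'cV[R]_d -> R) (beta2 gamma2 delta2 : R) (w : 'cV[R]_d) : \bar R :=
  (alpha%:E
   + beta2%:E * ('E_Pr[fun om => P1 (X om)] + (P1 w)%:E)
   + gamma2%:E * (P2 (delta2 *: w)%R)%:E
     * 'E_Pr[fun om => P2 (delta2 *: X om)%R])%E.

Definition bound2 (y : Omega -> R) (X : Omega -> 'cV[R]_d) (alpha : R)
    (P1 P2 : 'cV[R]_d -> R) (beta2 gamma2 delta2 : R) (w : 'cV[R]_d) : \bar R :=
  (alpha%:E * 'E_Pr[fun om => `|y om|%R]
   + beta2%:E * ('E_Pr[fun om => `|y om * P1 (X om)|%R]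
                 + 'E_Pr[fun om => `|y om|%R] * (P1 w)%:E)
   + gamma2%:E * 'E_Pr[fun om => `|y om * P2 (delta2 *: X om)%R|%R]
     * (P2 (delta2 *: w)%R)%:E)%E.

End Probability.

(* Main.v *)
(* With [a = e^-s], [c = sqrt (1 - a^2)] and [X = Sigma^(1/2) Z], differentiation under
   the integral sign writes a derivative of [f] of order [k < n] as the integral over [s]
   of [- a^k E[D^k (h o g) (a w + c X)]].  As [h^(n-1)] is only Lipschitz, the last
   derivative is estimated through difference quotients: by the Faa di Bruno formula and
   the growth condition on [g], their upper limit is at most [h_n a^n P (a w + c X)].
   Conditions (i) and (ii) bound the expectation of [P (a w + c X)] by the bracket, and
   the integral of [a^n] is [1 / n].  If [Sigma] is positive definite, one derivative is
   traded for the weight [(a / c) (Sigma^(-1/2) Z)_l] by translating [Z]; a derivative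
   being lost, the remaining factor is at most [a^2 / c], whose integral is [1].

   The bounds are trivial where they are infinite.  Where one is finite at a single
   point, it makes a majorant of [P] on translates of [X] integrable, which is what
   dominated convergence needs everywhere. *)

Require Import Defs.
From HB Require Import structures.
From mathcomp Require Import all_boot all_order all_algebra.
From mathcomp Require Import all_classical all_reals all_analysis.
From mathcomp Require Import measurable_realfun ring lra.

Set Implicit Arguments.
Unset Strict Implicit.
Unset Printing Implicit Defensive.

Import Order.TTheory GRing.Theory Num.Theory.
Import numFieldNormedType.Exports.

Local Open Scope classical_set_scope.
Local Open Scope ring_scope.

(** * Dini derivatives and absolute continuity *)

(** [P1] and [P2] are arbitrary apart from (i)-(iii): they need not be continuous, and
    [P2 (delta 2 *: X)] need not even be measurable. So [P] along the Mehler path is never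
    integrated itself: estimates are made for Borel functions lying below it, and dominated
    convergence works with suprema of such functions. What a finite bracket supplies is a finite
    integral of [P2 (delta 2 *: X)], possibly against a linear weight.

    The order of differentiation matters, since top derivatives of [h \o g] need not exist and
    derivatives of [f] are not known to commute. If the index carrying the weight is not the
    outermost one, the integration by parts is done when that index is reached, and the outermost
    derivative is estimated by quotients. If it is the outermost one, the inner derivatives would
    all fall on [h \o g], one more than are known to exist; a second integration by parts then gives
    a weight symmetric in two axes, and the index is exchanged with its neighbour.

    The factor [h_n] may be 0 while the bracket is infinite. Then [h] is constant and [f] vanishes,
    in agreement with [0 * +oo = 0]. *)

Section IntervalInduction.
Context {R : realType}.
Implicit Types (u : R -> R) (a b L : R).

(* Cousin's lemma, phrased as an induction principle on intervals. *)
Lemma interval_induction (Q : R -> R -> Prop) a b : a <= b ->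
  (forall x y z, a <= x -> x <= y -> y <= z -> z <= b ->
     Q x y -> Q y z -> Q x z) ->
  (forall p, a <= p <= b -> exists2 r, 0 < r & forall x y,
     a <= x -> x <= p -> p <= y -> y <= b -> p - r < x -> y < p + r -> Q x y) ->
  Q a b.
Proof.
move=> ab Qtrans Qloc.
pose E := [set x | a <= x <= b /\ Q a x].
have Ea : E a.
  split; first by rewrite lexx ab.
  have [|r r0 H] := Qloc a; first by rewrite lexx ab.
  by apply: H => //; lra.
have Eb : ubound E b by move=> x [/andP[]].
have Es : has_sup E by split; [exists a | exists b].
have supb : sup E <= b by apply: ge_sup => //; exists a.
have asup : a <= sup E by apply: ub_le_sup Ea; exists b.
have [|r r0 H] := Qloc (sup E); first by rewrite asup supb.
have [x [/andP[ax xb] Qax] xs] := sup_adherent r0 Es.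
have xsup : x <= sup E by apply: ub_le_sup; [exists b | split; rewrite ?ax].
(* Unless [b] stops it, [s] lies strictly beyond [sup E]; as [s] belongs to the set, it must be
   [b]. *)
pose s := Num.min b (sup E + r / 2).
have sb : s <= b by rewrite /s ge_min lexx.
have ssup : sup E <= s by rewrite /s le_min supb /=; lra.
have Qs : Q a s.
  apply: (Qtrans _ x) => //; first exact: le_trans xsup ssup.
  apply: H => //; rewrite /s gt_min; apply/orP; right; lra.
have : s <= sup E.
  by apply: ub_le_sup; [exists b | split; rewrite ?sb ?(le_trans asup ssup)].
move=> ssup'; suff <- : s = b by [].
rewrite /s; case: leP => // h; exfalso; move: ssup'; rewrite /s min_r ?(ltW h)//.
lra.
Qed.

(* [L] bounds the upper Dini derivative of [u] at [x]. *)
Definition plip u (x L : R) := forall e, 0 < e ->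
  \forall y \near x, `|u y - u x| <= (L + e) * `|y - x|.

Lemma plip_le u x L L' : L <= L' -> plip u x L -> plip u x L'.
Proof.
move=> LL' H e e0; apply: filterS (H e e0) => y /le_trans; apply.
by rewrite ler_wpM2r// lerD2r.
Qed.

(** With the slack fixed in advance, the bound is additive over adjacent intervals, and the Dini
    bound gives it on every short interval containing [p]. Only these two facts enter, so [u] need
    not be differentiable anywhere. *)
Lemma plip_mvt u a b L : a <= b ->
  (forall p, a <= p <= b -> plip u p L) -> `|u b - u a| <= L * (b - a).
Proof.
move=> ab H; apply/ler_addgt0Pr => e e0.
(* The summand 1 keeps the divisor positive when [a = b]. *)
have e1 : 0 < e / (b - a + 1) by rewrite divr_gt0//; lra.
suff /le_trans : `|u b - u a| <= (L + e / (b - a + 1)) * (b - a).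
  apply; rewrite mulrDl lerD2l mulrAC ler_pdivrMr; last lra.
  by rewrite ler_wpM2l ?(ltW e0)//; lra.
apply: (interval_induction (Q := fun x y => `|u y - u x| <= (L + e / (b - a + 1)) * (y - x))) => //.
  move=> x y z ax xy yz zb h1 h2.
  have -> : u z - u x = (u z - u y) + (u y - u x) by ring.
  by rewrite (le_trans (ler_normD _ _))//; lra.
move=> p apb; have [r /= r0 hr] := H p apb _ e1; exists r => //.
move=> x y ax xp py yb prx ypr.
have hx : `|u x - u p| <= (L + e / (b - a + 1)) * (p - x).
  rewrite -[p - x]ger0_norm ?subr_ge0// (distrC p); apply: hr; rewrite /ball/=.
  by rewrite ger0_norm; lra.
have hy : `|u y - u p| <= (L + e / (b - a + 1)) * (y - p).
  rewrite -[y - p]ger0_norm ?subr_ge0//; apply: hr; rewrite /ball/=.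
  by rewrite distrC ger0_norm; lra.
have -> : u y - u x = (u y - u p) - (u x - u p) by ring.
by rewrite (le_trans (ler_normB _ _))//; lra.
Qed.

Lemma derivable_plip u (x L : R) : derivable u x 1 -> `|derive1 u x| <= L ->
  plip u x L.
Proof.
move=> du uL; apply: plip_le uL _ => e e0.
have [r /= r0 hr] : \forall h \near (0 : R)^', `|h^-1 *: (u (h + x) - u x) - derive1 u x| < e.
  have /cvgrPdist_lt /(_ e e0) : h^-1 *: (u (h + x) - u x) @[h --> 0^'] --> derive1 u x.
    rewrite derive1E; move: du; rewrite /derivable/derive.
    by under eq_fun do rewrite /= [_%:A]mulr1.
  by apply: filterS => h; rewrite distrC.
exists r => //= y /= yx; have [->|yneq] := eqVneq y x; first by rewrite !subrr normr0 mulr0.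
have yx0 : y - x != 0 by rewrite subr_eq0.
have := hr (y - x); rewrite /ball/= sub0r normrN distrC => /(_ yx yx0).
rewrite subrK => h.
have -> : u y - u x = (y - x) * ((y - x)^-1 * (u y - u x)) by rewrite mulVKf.
rewrite normrM [leLHS]mulrC (distrC x) ler_wpM2r//.
rewrite (_ : _ * _ = ((y - x)^-1 *: (u y - u x) - derive1 u x) + derive1 u x); last by rewrite subrK.
by rewrite (le_trans (ler_normD _ _))// addrC lerD2l ltW.
Qed.

End IntervalInduction.

Section AbsContinuousLipschitz.
Context {R : realType}.
Implicit Types (u : R -> R) (a b L : R).
Local Notation mu := (@lebesgue_measure R).

(* Away from the null set, intervals obey the Lipschitz bound; near it, they
   lie in an open set of small measure, where absolute continuity applies. *)
Lemma abs_continuous_lipschitz u a b L (N : set R) : a <= b -> 0 <= L ->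
  abs_continuous_on a b u -> mu.-negligible N ->
  (forall x, ~ N x -> plip u x L) -> `|u b - u a| <= L * (b - a).
Proof.
move=> ab L0 ac [N' [mN' N'0 NN']] uL.
apply/ler_addgt0Pr => e' e'0.
have b1 : 0 < b - a + 1 by lra.
pose e := e' / (b - a + 1).
have e0 : 0 < e by rewrite divr_gt0.
suff h : `|u b - u a| <= (L + e) * (b - a) + e.
  apply: (le_trans h); rewrite mulrDl -addrA lerD2l.
  by rewrite -[X in _ + X]mulr1 -mulrDr divfK// gt_eqF.
have [r r0 hr] := ac e e0.
have N'oo : (mu N' < +oo)%E by rewrite N'0 ltry.
have [|U [oU NU mUN]] := lebesgue_regularity_outer mN' _ r0; first exact: N'oo.
have mU : measurable U by exact: open_measurable.
have muU : (mu U < r%:E)%E.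
  apply: le_lt_trans mUN; rewrite -[leRHS]adde0 -[in leRHS]N'0.
  rewrite -[in leLHS](setDKU NU) (le_trans (measureU2 _ _ _))//.
  exact: measurableD.
(* The list [l] holds the pieces near the null set, where no Lipschitz bound is available. Half-open
   traces of [U] are used because they are disjoint for adjacent intervals, so that their measures
   add. *)
pose Q x y := exists l : seq (R * R),
  [/\ all (fun p => [&& x <= p.1, p.1 <= p.2 & p.2 <= y]) l,
      pairwise (fun p q => p.2 <= q.1) l,
      ((\sum_(p <- l) (p.2 - p.1))%:E <= mu (U `&` `[x, y[))%E &
      `|u y - u x| <= (L + e) * (y - x) + \sum_(p <- l) `|u p.2 - u p.1|].
have [l [lab lp lmu lu]] : Q a b.
  apply: interval_induction => //.
    move=> x y z ax xy yz zb [l1 [a1 p1 m1 u1]] [l2 [a2 p2 m2 u2]].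
    exists (l1 ++ l2); split.
    - rewrite all_cat; apply/andP; split; [move: a1|move: a2]; apply: sub_all => p;
        by move=> /and3P[? ? ?]; apply/and3P; split; lra.
    - rewrite pairwise_cat p1 p2 !andbT; apply/allrelP => p q /(allP a1)/= /and3P[_ _ h].
      by move=> /(allP a2)/= /and3P[h' _ _]; lra.
    - rewrite big_cat/= EFinD (le_trans (leeD m1 m2))// -measureU//.
      + by rewrite -setIUr -itv_bndbnd_setU//= bnd_simp.
      + exact: measurableI.
      + exact: measurableI.
      + apply/seteqP; split => // t [[_ /=]]; rewrite in_itv/= => /andP[_ h].
        by move=> [_ /=]; rewrite in_itv/= => /andP[h' _]; lra.
    - rewrite big_cat/=.
      have -> : u z - u x = (u z - u y) + (u y - u x) by ring.
      by rewrite (le_trans (ler_normD _ _))//; lra.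
  move=> p /andP[ap pb]; have [Np|Np] := pselect (N' p).
    have [s /= s0 hs] : nbhs p U by apply: open_nbhs_nbhs; split => //; exact: NU.
    exists s => // x y ax xp py yb prx ypr; exists [:: (x, y)]; split => /=.
    - by rewrite !lexx (le_trans xp py).
    - by [].
    - rewrite big_seq1/= setIidr.
        by rewrite lebesgue_measure_itv/= lte_fin; case: ltP => // h; rewrite lee_fin; lra.
      move=> t /=; rewrite in_itv/= => /andP[xt ty]; apply: hs => /=.
      by rewrite ltr_distlC; apply/andP; split; lra.
    - rewrite big_seq1/= lerDr mulr_ge0//; lra.
  have [s /= s0 hs] := uL p (fun h => Np (NN' _ h)) e e0; exists s => //.
  move=> x y ax xp py yb prx ypr; exists [::]; split => //; rewrite big_nil//.
  rewrite addr0.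
  have hx : `|u x - u p| <= (L + e) * (p - x).
    rewrite -[p - x]ger0_norm ?subr_ge0// (distrC p); apply: hs; rewrite /ball/=.
    by rewrite ger0_norm; lra.
  have hy : `|u y - u p| <= (L + e) * (y - p).
    rewrite -[y - p]ger0_norm ?subr_ge0//; apply: hs; rewrite /ball/=.
    by rewrite distrC ger0_norm; lra.
  have -> : u y - u x = (u y - u p) - (u x - u p) by ring.
  by rewrite (le_trans (ler_normB _ _))//; lra.
apply: (le_trans lu); rewrite lerD2l ltW//.
have := hr (size l) (fun j => (nth (0, 0) l j).1) (fun j => (nth (0, 0) l j).2).
rewrite -(big_mkord xpredT (fun j => (nth (0, 0) l j).2 - (nth (0, 0) l j).1)).
rewrite -(big_mkord xpredT (fun j => `|u (nth (0, 0) l j).2 - u (nth (0, 0) l j).1|)).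
rewrite -(big_nth (0, 0) xpredT (fun p => p.2 - p.1)).
rewrite -(big_nth (0, 0) xpredT (fun p => `|u p.2 - u p.1|)).
apply.
- by move=> j; have /and3P[] := all_nthP (0, 0) lab j (ltn_ord j).
- move=> j k jk; move/(pairwiseP (0, 0)): lp => lp.
  have [jk'|kj|/ord_inj jk'] := ltngtP j k.
  + by left; apply: lp => //; rewrite inE ltn_ord.
  + by right; apply: lp => //; rewrite inE ltn_ord.
  + by rewrite jk' eqxx in jk.
- rewrite -lte_fin (le_lt_trans lmu)// (le_lt_trans _ muU)// le_measure ?inE//.
  exact: measurableI.
Qed.

End AbsContinuousLipschitz.

(** * Derivatives of a composition *)

Section SetPartitions.
Context {T : Type}.
Implicit Types (s B : seq T) (p : seq (seq T)).

Fixpoint join_block (i : T) p : seq (seq (seq T)) :=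
  if p is B :: p' then ((i :: B) :: p') :: map (cons B) (join_block i p')
  else [::].

(** The effect of one more derivative on a term of the Faa di Bruno formula: the singleton block
    arises when the derivative hits the outer function, a joined block when it hits one of the
    factors. *)
Definition add_elt (i : T) p := ([:: i] :: p) :: join_block i p.

(** The partitions are of the positions in [s], so that repeated indices are kept apart. *)
Fixpoint set_parts s : seq (seq (seq T)) :=
  if s is i :: s' then flatten (map (add_elt i) (set_parts s')) else [:: [::]].

End SetPartitions.

Section SetPartitionSums.
Context {T : eqType} {R : realType}.
Implicit Types (s B : seq T) (p : seq (seq T)).

Lemma sum_join_block_size (i : T) p (F : nat -> R) :
  \sum_(q <- join_block i p) F (size q) = (size p)%:R * F (size p).
Proof.
elim: p F => [|B p IH] F /=; first by rewrite big_nil mul0r.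
rewrite big_cons/= big_map (IH (F \o S))/=.
by rewrite -[in RHS]natr1 mulrDl mul1r addrC.
Qed.

Lemma mem_join_block_size (i : T) p q : q \in join_block i p -> size q = size p.
Proof.
elim: p q => //= B p IH q.
by rewrite inE => /orP[/eqP -> //|/mapP[q' /IH <- ->]].
Qed.

Lemma stirling2_small n k : (n < k)%N -> stirling2 n k = 0%N.
Proof.
elim: n k => [|n IH] [|k] //= nk.
by rewrite !IH ?muln0//; exact: ltnW.
Qed.

(** A new element opens a block or joins one of the [k] existing ones; these are the two terms of
    the recursion for [stirling2]. *)
Lemma sum_set_parts_size s (F : nat -> R) :
  \sum_(p <- set_parts s) F (size p) =
  \sum_(k < (size s).+1) (stirling2 (size s) k)%:R * F k.
Proof.
elim: s F => [|i s IH] F /=.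
  by rewrite big_seq1 big_ord_recl big_ord0 mul1r addr0.
rewrite big_flatten/= big_map.
transitivity (\sum_(p <- set_parts s) (F (size p).+1 + (size p)%:R * F (size p))).
  by apply: eq_bigr => p _; rewrite big_cons/= sum_join_block_size.
rewrite (IH (fun k => F k.+1 + k%:R * F k)).
rewrite [RHS]big_ord_recl/= mul0r add0r.
under eq_bigr do rewrite mulrDr; rewrite big_split/=.
under [RHS]eq_bigr => k _.
  rewrite /bump/= natrD mulrDl natrM; over.
rewrite [RHS]big_split/= addrC; congr (_ + _).
rewrite big_ord_recl/= mul0r mulr0 add0r [RHS]big_ord_recr/=.
rewrite stirling2_small// mulr0 mul0r addr0.
by apply: eq_bigr => k _; rewrite /bump/= mulrCA mulrA.
Qed.

Lemma h_constE n (h : R -> R) s : size s = n.+1 ->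
  \sum_(p <- set_parts s) deriv_norm h (size p) = h_const n.+1 h.
Proof.
move=> sn; rewrite sum_set_parts_size sn big_ord_recl/= mul0r add0r.
by rewrite /h_const big_add1/= big_mkord.
Qed.

Lemma set_parts_blocks s p : p \in set_parts s ->
  all (fun B => B != [::]) p /\ sumn (map size p) = size s.
Proof.
elim: s p => [|i s IH] p /=; first by rewrite inE => /eqP ->.
move=> /flattenP[_ /mapP[q /IH[q1 q2] ->]]; rewrite inE => /orP[/eqP -> /=|].
  by rewrite q2.
rewrite -q2 => {IH q2}; elim: q p q1 => //= B q IH p /andP[B0 q0].
rewrite inE => /orP[/eqP ->|/mapP[q' /(IH _ q0)[h1 h2] ->]] /=; first by rewrite q0.
by rewrite B0 h1 h2 addnS.
Qed.

End SetPartitionSums.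

Section Lines.
Context {R : realType} {d : nat}.
Implicit Types (F : 'cV[R]_d -> R) (x v : 'cV[R]_d).

Definition line F x v (t : R) := F (x + t *: v).

Lemma line0 F x v : line F x v 0 = F x.
Proof. by rewrite /line scale0r addr0. Qed.

Let line_quotient F x v (h : R) :
  h^-1 *: ((line F x v \o shift 0) (h *: (1 : R)) - line F x v 0) =
  h^-1 *: ((F \o shift x) (h *: v) - F x).
Proof. by rewrite line0 /line /= addr0 [_ *: 1]mulr1 (addrC x). Qed.

Lemma derivable_line F x v : derivable (line F x v) 0 (1 : R) = derivable F x v.
Proof.
exact: (congr1 (fun q : R -> R => cvg (q h @[h --> (0 : R)^']))
  (funext (line_quotient F x v))).
Qed.

Lemma derive_line F x v : 'D_1 (line F x v) (0 : R) = 'D_v F x.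
Proof.
exact: (congr1 (fun q : R -> R => lim (q h @[h --> (0 : R)^']))
  (funext (line_quotient F x v))).
Qed.

Lemma is_derive_line F x v D :
  is_derive (0 : R) (1 : R) (line F x v) D <-> is_derive x v F D.
Proof.
split=> -[h1 h2]; split.
- by rewrite -derivable_line.
- by rewrite -derive_line.
- by rewrite derivable_line.
- by rewrite derive_line.
Qed.

End Lines.

Section Plip.
Context {R : realType}.
Implicit Types (u v : R -> R) (x L : R).

(** This replaces the chain rule where the outer function, the last derivative of [h] that exists
    everywhere, is only Lipschitz. *)
Lemma lipschitz_comp_plip u v x L M : 0 <= M ->
  (forall y z, `|u y - u z| <= M * `|y - z|) ->
  plip v x L -> plip (u \o v) x (M * L).
Proof.
move=> M0 uM vL e e0.
have e1 : 0 < e / (M + 1) by rewrite divr_gt0//; lra.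
apply: filterS (vL _ e1) => y /= hy.
rewrite (le_trans (uM _ _))// (le_trans (ler_wpM2l M0 hy))// mulrA ler_wpM2r//.
rewrite mulrDr lerD2l mulrCA mulrA ler_pdivrMr ?ler_wpM2l; lra.
Qed.

Lemma plip_cts u x L : plip u x L -> {for x, continuous u}.
Proof.
move=> uL; apply/cvgrPdist_lt => e e0.
have [r /= r0 hr] := uL 1 ltr01.
exists (Num.min r (e / (`|L| + 2))) => /=.
  by rewrite lt_min r0 divr_gt0//; have := normr_ge0 L; lra.
move=> y /=; rewrite lt_min => /andP[yr ye].
have L2 : 0 < `|L| + 2 by have := normr_ge0 L; lra.
rewrite distrC (le_lt_trans (hr y yr))//.
have : `|x - y| * (`|L| + 2) < e by rewrite -ltr_pdivlMr.
apply: le_lt_trans; rewrite mulrC (distrC y) ler_wpM2l//.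
by have := ler_norm L; lra.
Qed.

Lemma plipM u v x L M : plip u x L -> plip v x M ->
  plip (fun y => u y * v y) x (L * `|v x| + `|u x| * M).
Proof.
move=> uL vM e e0.
(* [A] bounds the factor of [e1] in the error term; the last summand leaves room for [e1 <= 1]. *)
pose A := `|v x| + `|L| + `|u x| + 2.
have A0 : 0 < A.
  by have := normr_ge0 (v x); have := normr_ge0 L; have := normr_ge0 (u x); rewrite /A; lra.
pose e1 := Num.min 1 (e / A).
have e10 : 0 < e1 by rewrite /e1 lt_min ltr01 divr_gt0.
have e11 : e1 <= 1 by rewrite /e1 ge_min lexx.
have e1A : e1 * A <= e by rewrite -ler_pdivlMr// /e1 ge_min lexx orbT.
have [r1 /= r10 vx] : \forall y \near x, `|v x - v y| < e1.
  by have /cvgrPdist_lt/(_ _ e10) := plip_cts vM.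
have [r2 /= r20 hu] := uL _ e10.
have [r3 /= r30 hv] := vM _ e10.
exists (Num.min r1 (Num.min r2 r3)) => /=; first by rewrite !lt_min r10 r20.
move=> y /=; rewrite !lt_min => /and3P[/vx h1 /hu h2 /hv h3].
have -> : u y * v y - u x * v x = (u y - u x) * v y + u x * (v y - v x) by ring.
apply: (le_trans (ler_normD _ _)); rewrite !normrM.
have vy : `|v y| <= `|v x| + e1.
  have -> : v y = v x - (v x - v y) by ring.
  by rewrite (le_trans (ler_normB _ _))// lerD2l ltW.
have Le : 0 <= (L + e1) * `|y - x| by rewrite (le_trans _ h2).
apply: (@le_trans _ _ ((L + e1) * `|y - x| * (`|v x| + e1) + `|u x| * ((M + e1) * `|y - x|))).
  rewrite lerD// ?ler_wpM2l//.
  by rewrite ler_pM.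
have := normr_ge0 (y - x); set t := `|y - x| => t0.
have -> : (L + e1) * t * (`|v x| + e1) + `|u x| * ((M + e1) * t) =
  (L * `|v x| + `|u x| * M + e1 * (`|v x| + L + `|u x| + e1)) * t by ring.
rewrite ler_wpM2r// lerD2l (le_trans _ e1A)// ler_wpM2l ?(ltW e10)//.
by rewrite /A; have := ler_norm L; lra.
Qed.

Lemma plipD u v x L M : plip u x L -> plip v x M ->
  plip (fun y => u y + v y) x (L + M).
Proof.
move=> uL vM e e0; have e2 : 0 < e / 2 by lra.
move: (uL _ e2) (vM _ e2); apply: filterS2 => y hu hv.
have -> : u y + v y - (u x + v x) = (u y - u x) + (v y - v x) by ring.
rewrite (le_trans (ler_normD _ _))// (le_trans (lerD hu hv))// -mulrDl ler_wpM2r//.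
lra.
Qed.

Lemma plip_cst (c : R) x : plip (fun=> c) x 0.
Proof.
by move=> e e0; exists 1 => //= y _; rewrite subrr normr0 add0r mulr_ge0// ltW.
Qed.

Lemma plip_sum (I : eqType) (r : seq I) (u : I -> R -> R) x (L : I -> R) :
  (forall i, i \in r -> plip (u i) x (L i)) ->
  plip (fun y => \sum_(i <- r) u i y) x (\sum_(i <- r) L i).
Proof.
elim: r => [|i r IH] H.
  by under eq_fun do rewrite big_nil; rewrite big_nil; exact: plip_cst.
under eq_fun do rewrite big_cons; rewrite big_cons; apply: plipD.
  by apply: H; rewrite mem_head.
by apply: IH => k kr; apply: H; rewrite inE kr orbT.
Qed.

Lemma is_derive_plip u x L D : is_derive x 1 u D -> `|D| <= L -> plip u x L.
Proof. by move=> [du uD] DL; apply: derivable_plip => //; rewrite derive1E uD. Qed.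

End Plip.

Section FaaDiBruno.
Context {R : realType} {d : nat} (h : R -> R) (g : 'cV[R]_d -> R).
Implicit Types (p : seq (seq 'I_d)) (x : 'cV[R]_d).

Let dir (i : 'I_d) : 'cV[R]_d := delta_mx i 0.

Definition block_prod p x := \prod_(B <- p) pderiv B g x.

Definition faa_term p x := derive1n (size p) h (g x) * block_prod p x.

Lemma is_derive_block_prod p (i : 'I_d) x :
  (forall B, B \in p -> derivable (pderiv B g) x (dir i)) ->
  is_derive x (dir i) (block_prod p) (\sum_(q <- join_block i p) block_prod q x).
Proof.
elim: p => [|B p IH] H /=.
  rewrite big_nil; rewrite (_ : block_prod [::] = cst 1); last first.
    by apply/funext => y; rewrite /block_prod big_nil.
  exact: is_derive_cst.
have dB : is_derive x (dir i) (pderiv B g) (pderiv (i :: B) g x).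
  by apply/derivableP/H; rewrite mem_head.
have dp : is_derive x (dir i) (block_prod p) (\sum_(q <- join_block i p) block_prod q x).
  by apply: IH => B' B'p; apply: H; rewrite inE B'p orbT.
rewrite (_ : block_prod (B :: p) = pderiv B g * block_prod p); last first.
  by apply/funext => y; rewrite /block_prod big_cons.
apply: is_derive_eq.
rewrite big_cons big_map /block_prod big_cons addrC; congr (_ + _).
  by rewrite /= [LHS]mulrC.
rewrite [RHS]big_seq [LHS](_ : _ = pderiv B g x * \sum_(q <- join_block i p) block_prod q x)//.
rewrite mulr_sumr big_seq; apply: eq_bigr => q _.
by rewrite /block_prod big_cons.
Qed.

End FaaDiBruno.

Section FaaDiBrunoDerivative.
Context {R : realType} {d : nat} (h : R -> R) (g : 'cV[R]_d -> R).
(** [m] counts the derivatives of [h] that exist everywhere, [n] those of [g]. In general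
    [m = n.-1]; the case [m = n] occurs when the top derivative of [h] exists everywhere too. [N k]
    stands for the bound on the derivative of order [k]. *)
Variables (n m : nat) (N : nat -> R).
Hypothesis mn : (m <= n)%N.
Hypothesis Hg : forall s w, (size s <= n)%N -> has_pderiv s g w.
Hypothesis Hder : forall k y, (k < m)%N -> derivable (derive1n k h) y 1.
Implicit Types (s : seq 'I_d) (p : seq (seq 'I_d)) (x : 'cV[R]_d).

Let dir (i : 'I_d) : 'cV[R]_d := delta_mx i 0.

Let derivable_pderiv s (i : 'I_d) x : (size s < n)%N ->
  derivable (pderiv s g) x (dir i).
Proof. by move=> sn; have [] := @Hg (i :: s) x sn. Qed.

Let block_size s p B : p \in set_parts s -> B \in p -> (size B <= size s)%N.
Proof.
move=> /set_parts_blocks[_ <-] Bp; elim: p Bp => //= C p IH.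
rewrite inE => /orP[/eqP <-|/IH]; first exact: leq_addr.
by move=> /leq_trans; apply; exact: leq_addl.
Qed.

Lemma size_set_parts s p : p \in set_parts s -> (size p <= size s)%N.
Proof.
move=> /set_parts_blocks[+ <-]; elim: p => //= B p IH /andP[B0 /IH].
by move=> /(leq_add (_ : (1 <= size B)%N)); rewrite add1n; apply; case: B B0.
Qed.

Lemma is_derive_faa_term (i : 'I_d) s p x : (size s < m)%N -> p \in set_parts s ->
  is_derive x (dir i) (faa_term h g p) (\sum_(q <- add_elt i p) faa_term h g q x).
Proof.
move=> sm ps; have sn := leq_trans sm mn.
have db : is_derive x (dir i) (block_prod g p)
    (\sum_(q <- join_block i p) block_prod g q x).
  apply: is_derive_block_prod => B Bp; apply: derivable_pderiv.
  exact: leq_ltn_trans (block_size ps Bp) sn.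
have dh : is_derive x (dir i) (derive1n (size p) h \o g)
    (derive1n (size p).+1 h (g x) * pderiv [:: i] g x).
  apply/is_derive_line.
  have d1 : is_derive (line g x (dir i) 0) 1 (derive1n (size p) h)
      (derive1n (size p).+1 h (g x)).
    rewrite line0 derive1nS derive1E; apply/derivableP/Hder.
    exact: leq_ltn_trans (size_set_parts ps) sm.
  have d2 : is_derive (0 : R) 1 (line g x (dir i)) (pderiv [:: i] g x).
    apply/is_derive_line/derivableP; apply: (@derivable_pderiv [::]).
    exact: leq_ltn_trans sn.
  exact: is_derive1_comp.
rewrite (_ : faa_term h g p = (derive1n (size p) h \o g) * block_prod g p)//.
apply: is_derive_eq; rewrite big_cons addrC; congr (_ + _).
  rewrite /faa_term /block_prod big_cons/= mulrA.
  by rewrite [LHS]mulrC.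
rewrite [LHS](_ : _ = derive1n (size p) h (g x) * \sum_(q <- join_block i p) block_prod g q x)//.
rewrite mulr_sumr; rewrite !big_seq; apply: eq_bigr => q qp.
by rewrite /faa_term (mem_join_block_size qp).
Qed.

Lemma pderiv_comp s x : (size s <= m)%N ->
  has_pderiv s (h \o g) x /\
  pderiv s (h \o g) x = \sum_(p <- set_parts s) faa_term h g p x.
Proof.
elim: s x => [|i s IH] x sm /=.
  by split=> //; rewrite big_seq1 /faa_term /block_prod big_nil mulr1.
have E : pderiv s (h \o g) = fun x => \sum_(p <- set_parts s) faa_term h g p x.
  by apply/funext => y; have [] := IH y (ltnW sm).
have D : is_derive x (dir i) (pderiv s (h \o g))
    (\sum_(q <- flatten (map (add_elt i) (set_parts s))) faa_term h g q x).
  rewrite E big_flatten/= big_map.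
  have : forall p, p \in set_parts s -> is_derive x (dir i) (faa_term h g p)
      (\sum_(q <- add_elt i p) faa_term h g q x).
    by move=> p; exact: is_derive_faa_term.
  elim: (set_parts s) => [|p r IHr] H.
    under eq_fun do rewrite big_nil; rewrite big_nil; exact: is_derive_cst.
  under eq_fun do rewrite big_cons; rewrite big_cons.
  have d1 := H p (mem_head _ _).
  have d2 := IHr (fun q qr => H q (mem_behead (s := p :: r) qr)).
  exact: is_deriveD.
split; last by have [_ ->] := D.
split; last by have [] := D.
by move=> y; have [] := IH y (ltnW sm).
Qed.

Hypothesis N0 : forall k, 0 <= N k.
Hypothesis Hbd : forall k y, (0 < k < n)%N -> `|derive1n k h y| <= N k.
Hypothesis Hlip : forall k y z, (k < n)%N ->
  `|derive1n k h y - derive1n k h z| <= N k.+1 * `|y - z|.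

Definition faa_bound p x := N (size p) * \prod_(B <- p) `|pderiv B g x|.

(** The product rule with Dini bounds in place of derivatives. It reaches one order further, as the
    factor [derive1n (size p) h] only has to be Lipschitz. *)
Lemma plip_faa_term (i : 'I_d) s p x : (size s < n)%N -> p \in set_parts s ->
  plip (line (faa_term h g p) x (dir i)) 0 (\sum_(q <- add_elt i p) faa_bound q x).
Proof.
move=> sn ps.
have db : is_derive x (dir i) (block_prod g p)
    (\sum_(q <- join_block i p) block_prod g q x).
  apply: is_derive_block_prod => B Bp; apply: derivable_pderiv.
  exact: leq_ltn_trans (block_size ps Bp) sn.
pose L := \sum_(q <- join_block i p) \prod_(B <- q) `|pderiv B g x|.
have pb : plip (line (block_prod g p) x (dir i)) 0 L.
  apply: is_derive_plip; first by apply/is_derive_line; exact: db.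
  rewrite (le_trans (ler_norm_sum _ _ _))// ler_sum// => q _.
  by rewrite normr_prod.
have ph : plip (line (derive1n (size p) h \o g) x (dir i)) 0
    (N (size p).+1 * `|pderiv [:: i] g x|).
  have pn := leq_ltn_trans (size_set_parts ps) sn.
  rewrite (_ : line _ _ _ = derive1n (size p) h \o line g x (dir i))//.
  apply: lipschitz_comp_plip => //; first by move=> y z; exact: Hlip.
  apply: is_derive_plip (lexx _); apply/is_derive_line/derivableP.
  by apply: (@derivable_pderiv [::]); exact: leq_ltn_trans sn.
apply: plip_le (plipM ph pb); rewrite !line0 big_cons lerD//.
  by rewrite /faa_bound big_cons /= -mulrA /block_prod normr_prod.
have -> : \sum_(q <- join_block i p) faa_bound q x = N (size p) * L.
  rewrite mulr_sumr !big_seq; apply: eq_bigr => q qp.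
  by rewrite /faa_bound (mem_join_block_size qp).
have L0 : 0 <= L by apply: sumr_ge0 => q _; exact: prodr_ge0.
(* [h] itself need not be bounded. It is a factor only for the empty partition, where the product
   over the blocks is constant and contributes nothing. *)
case: (posnP (size p)) => [/size0nil p0|p0]; first by rewrite /L p0 /= big_nil !mulr0.
rewrite ler_wpM2r//; apply: Hbd; rewrite p0/=.
exact: leq_ltn_trans (size_set_parts ps) sn.
Qed.

Lemma plip_pderiv_comp (i : 'I_d) s x : (size s < n)%N -> (size s <= m)%N ->
  plip (line (pderiv s (h \o g)) x (dir i)) 0
    (\sum_(p <- set_parts (i :: s)) faa_bound p x).
Proof.
move=> sn sm.
have -> : line (pderiv s (h \o g)) x (dir i) = fun t =>
    \sum_(p <- set_parts s) line (faa_term h g p) x (dir i) t.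
  by apply/funext => t; rewrite /line (pderiv_comp _ sm).2.
rewrite /= big_flatten/= big_map; apply: plip_sum => p ps.
exact: plip_faa_term sn ps.
Qed.

(** By the growth condition a block [B] contributes at most [P] to the power [size B / n], and the
    block sizes of a partition add up to [size s]. *)
Lemma sum_faa_bound s x P : (0 < size s <= n)%N -> 0 <= P ->
  (forall B, (0 < size B <= n)%N ->
     `|pderiv B g x| `^ (n%:R / (size B)%:R) <= P) ->
  \sum_(p <- set_parts s) faa_bound p x <=
  (\sum_(p <- set_parts s) N (size p)) * P `^ ((size s)%:R / n%:R).
Proof.
move=> /andP[s0 sn] P0 H; rewrite mulr_suml !big_seq; apply: ler_sum => p ps.
have n0 : (0 < n)%N by exact: leq_trans sn.
have nR0 : n%:R != 0 :> R by rewrite pnatr_eq0 -lt0n.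
rewrite ler_wpM2l//; have [pne <-] := set_parts_blocks ps.
have hB B : B \in p -> `|pderiv B g x| <= P `^ ((size B)%:R / n%:R).
  move=> Bp; have B0 : (0 < size B)%N.
    by move/allP: pne => /(_ _ Bp); case: (B).
  have BR0 : (size B)%:R != 0 :> R by rewrite pnatr_eq0 -lt0n.
  have -> : `|pderiv B g x| =
      (`|pderiv B g x| `^ (n%:R / (size B)%:R)) `^ ((size B)%:R / n%:R).
    by rewrite -powRrM mulrA divfK// divff// powRr1.
  apply: ge0_ler_powR; rewrite ?nnegrE ?powR_ge0 ?divr_ge0//.
  apply: H; rewrite B0/=; exact: leq_trans (block_size ps Bp) sn.
elim: p hB pne {ps} => [|B p IH] hB /=; first by rewrite big_nil mul0r powRr0.
(* Exponents are added only for nonzero [P], because 0 to the power 0 is 1. If [P = 0], the nonempty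
   block [B] already makes the product vanish. *)
move=> /andP[B0 pne]; have [E|Pn0] := eqVneq P 0.
  apply: (@le_trans _ _ 0); last exact: powR_ge0.
  rewrite big_cons (_ : `|pderiv B g x| = 0) ?mul0r//; apply/eqP.
  rewrite -normr_le0 normr_id (le_trans (hB B (mem_head _ _)))// E powR0//.
  by rewrite mulf_neq0 ?invr_eq0// pnatr_eq0 size_eq0.
rewrite big_cons natrD mulrDl powRD ?Pn0 ?implybT// ler_pM ?prodr_ge0//.
  exact: hB (mem_head _ _).
by apply: IH => // C Cp; apply: hB; rewrite inE Cp orbT.
Qed.

End FaaDiBrunoDerivative.

(** * Bounds for the derivatives of the test function *)

Section TestFunctionBounds.
Context {R : realType} (h : R -> R) (n : nat).
Hypothesis hn : C_b n h.

Lemma deriv_norm_ge0 k : 0 <= deriv_norm h k.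
Proof.
rewrite /deriv_norm; set A := [set _ | _ in _].
(* The supremum of an empty or unbounded set is 0 by default. *)
have [sA|/sup_out -> //] := pselect (has_sup A).
have [[y Ay] _] := sA; have [z _ zy] := Ay.
rewrite (le_trans _ (ub_le_sup _ Ay))//; last by case: sA.
by rewrite -zy.
Qed.

Lemma h_const_ge0 k : 0 <= h_const k h.
Proof. by apply: sumr_ge0 => j _; rewrite mulr_ge0// deriv_norm_ge0. Qed.

Lemma le_deriv_norm k x : (0 < k <= n)%N -> deriv_dom h k x ->
  `|derive1n k h x| <= deriv_norm h k.
Proof.
move=> kn hx; have [_ _ _ [M HM]] := hn.
by apply: ub_le_sup; [exists M => _ [y hy <-]; exact: HM | exists x].
Qed.

Lemma C_b_derivable k x : (k.+1 < n)%N -> derivable (derive1n k h) x 1.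
Proof. by move=> kn; have [+ _ _ _] := hn => /(_ k.+1 x); exact. Qed.

Lemma C_b_bound k x : (0 < k < n)%N -> `|derive1n k h x| <= deriv_norm h k.
Proof.
move=> /andP[k0 kn]; apply: le_deriv_norm; first by rewrite k0 ltnW.
by case: k k0 kn => //= k _; exact: C_b_derivable.
Qed.

(** Below the top order the derivative exists everywhere and the mean value inequality suffices. At
    the top order it exists almost everywhere, and absolute continuity makes up for the exceptional
    set. *)
Lemma C_b_lipschitz k x y : (k < n)%N ->
  `|derive1n k h x - derive1n k h y| <= deriv_norm h k.+1 * `|x - y|.
Proof.
move=> kn; have dl z : deriv_dom h k.+1 z -> plip (derive1n k h) z (deriv_norm h k.+1).
  by move=> hz; apply: derivable_plip => //; rewrite -derive1nS le_deriv_norm.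
wlog yx : x y / y <= x.
  move=> H; have [|/ltW xy] := leP y x; first exact: H.
  by rewrite distrC (distrC x) H.
rewrite (ger0_norm (_ : 0 <= x - y)) ?subr_ge0//.
have [nk|/negbTE nk] := boolP (n == k.+1); last first.
  apply: plip_mvt => // p _; apply: dl; apply: C_b_derivable.
  by rewrite ltn_neqAle eq_sym nk.
have [_ ac ae _] := hn; move/eqP: nk ac ae => -> /= ac ae.
apply: (abs_continuous_lipschitz yx (deriv_norm_ge0 _) (ac y x) ae).
by move=> z /= /contrapT; exact: dl.
Qed.

(** The coefficient of [deriv_norm h 1] in [h_const n h] is a Stirling number equal to 1, and the
    other terms are non-negative. *)
Lemma C_b_const : (0 < n)%N -> h_const n h = 0 -> forall x y, h x = h y.
Proof.
move=> n0 h0 x y; apply/eqP; rewrite -subr_eq0 -normr_le0.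
have -> : 0 = deriv_norm h 1 * `|x - y|; last exact: (@C_b_lipschitz 0).
suff -> : deriv_norm h 1 = 0 by rewrite mul0r.
apply/eqP; rewrite eq_le deriv_norm_ge0 andbT -h0 /h_const big_ltn//.
have -> : stirling2 n 1 = 1%N.
  case: (n) n0 => // k _; elim: k => // k IH.
  by rewrite [LHS]/= -/(stirling2 k.+1 1) IH.
rewrite mul1r lerDl; apply: sumr_ge0 => k _.
by rewrite mulr_ge0// deriv_norm_ge0.
Qed.

End TestFunctionBounds.

(** * Borel functions of several variables *)

Section Norm1.
Context {R : realType} {d : nat}.
Implicit Types (u v : 'cV[R]_d).

(** This is the length of a path parallel to the axes, the only kind of path along which partial
    derivatives give direct control. *)
Definition norm1 u : R := \sum_(i < d) `|u i 0|.

Lemma norm1_ge0 u : 0 <= norm1 u.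
Proof. by apply: sumr_ge0. Qed.

Lemma norm1D u v : norm1 (u + v) <= norm1 u + norm1 v.
Proof.
by rewrite /norm1 -big_split/=; apply: ler_sum => i _; rewrite mxE ler_normD.
Qed.

Lemma norm1Z (a : R) u : norm1 (a *: u) = `|a| * norm1 u.
Proof. by rewrite mulr_sumr; apply: eq_bigr => i _; rewrite mxE normrM. Qed.

Lemma norm10 : norm1 0 = 0.
Proof. by apply: big1 => i _; rewrite mxE normr0. Qed.

Lemma norm1_delta (i : 'I_d) : norm1 (delta_mx i 0) = 1.
Proof.
rewrite /norm1 (bigD1 i)//= mxE !eqxx normr1 big1 ?addr0// => j ji.
by rewrite mxE (negbTE ji) normr0.
Qed.

Lemma norm1_coord u i : `|u i 0| <= norm1 u.
Proof. by rewrite /norm1 (bigD1 i)//= lerDl sumr_ge0. Qed.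

Lemma norm1_mulmx (A : 'M[R]_d) :
  exists2 K : R, 0 <= K & forall u, norm1 (A *m u) <= K * norm1 u.
Proof.
exists (\sum_(i < d) \sum_(j < d) `|A i j|) => [|u].
  by apply: sumr_ge0 => i _; exact: sumr_ge0.
rewrite mulr_suml; apply: ler_sum => i _; rewrite mxE.
rewrite (le_trans (ler_norm_sum _ _ _))// mulr_suml; apply: ler_sum => j _.
by rewrite normrM ler_wpM2l// norm1_coord.
Qed.

End Norm1.

Section AxisLipschitz.
Context {R : realType} {d : nat}.
Implicit Types (u v x y : 'cV[R]_d) (psi G : 'cV[R]_d -> R).

Let dir (i : 'I_d) : 'cV[R]_d := delta_mx i 0.

Definition axis_plip psi G := forall x i, plip (line psi x (dir i)) 0 (G x).

Lemma plip_line psi x v (t L : R) : plip (line psi (x + t *: v) v) 0 L ->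
  plip (line psi x v) t L.
Proof.
move=> H e e0; have [r /= r0 hr] := H e e0; exists r => //= y yt.
have := hr (y - t); rewrite /ball/= sub0r normrN (distrC y) => /(_ yt).
by rewrite subr0 line0 /line -addrA -scalerDl (addrC t) subrK (distrC y).
Qed.

Lemma axis_lipschitz psi G x i (a M : R) : axis_plip psi G ->
  (forall t, `|t| <= `|a| -> G (x + t *: dir i) <= M) ->
  `|psi (x + a *: dir i) - psi x| <= M * `|a|.
Proof.
move=> pG GM; have P t : `|t| <= `|a| -> plip (line psi x (dir i)) t M.
  by move=> ta; apply: plip_line; apply: plip_le (pG _ i); exact: GM.
rewrite -[psi x](line0 _ _ (dir i)) -[psi (_ + _)]/(line psi x (dir i) a).
have [a0|a0] := leP 0 a.
  have := @plip_mvt _ (line psi x (dir i)) 0 a M a0; rewrite subr0 (ger0_norm a0); apply.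
  by move=> p /andP[p0 pa]; apply: P; rewrite !ger0_norm.
have := @plip_mvt _ (line psi x (dir i)) a 0 M (ltW a0).
rewrite sub0r distrC (ltr0_norm a0); apply.
by move=> p /andP[pa p0]; apply: P; rewrite (ltr0_norm a0) ler0_norm// lerN2.
Qed.

Let prefix u (k : nat) : 'cV[R]_d := \col_i (if (i < k)%N then u i 0 else 0).

Let prefixS u k (kd : (k < d)%N) :
  prefix u k.+1 = prefix u k + u (Ordinal kd) 0 *: dir (Ordinal kd).
Proof.
apply/matrixP => i j; rewrite !mxE (ord1 j) eqxx andbT ltnS.
have [ik|ki|ik] := ltngtP i k.
- by rewrite -val_eqE/= (ltn_eqF ik) mulr0 addr0.
- by rewrite -val_eqE/= (gtn_eqF ki) mulr0 addr0.
- have -> : i = Ordinal kd by exact: val_inj.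
  by rewrite eqxx mulr1 add0r.
Qed.

(** Go from [x] to [x + u] changing one coordinate at a time: the steps have total length [norm1 u],
    and no intermediate point is further than that from [x]. *)
Lemma box_lipschitz psi G x u (M : R) : axis_plip psi G ->
  (forall q, norm1 (q - x) <= norm1 u -> G q <= M) ->
  `|psi (x + u) - psi x| <= M * norm1 u.
Proof.
move=> pG GM.
have H k : (k <= d)%N -> `|psi (x + prefix u k) - psi x| <= M * norm1 (prefix u k).
  elim: k => [|k IH] kd.
    rewrite (_ : prefix u 0 = 0); last by apply/matrixP => i j; rewrite !mxE.
    by rewrite addr0 subrr normr0 norm10 mulr0.
  have N1p : norm1 (prefix u k.+1) = norm1 (prefix u k) + `|u (Ordinal kd) 0|.
    rewrite /norm1 (bigD1 (Ordinal kd))//= mxE leqnn addrC; congr (_ + _).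
    rewrite [RHS](bigD1 (Ordinal kd))//= mxE ltnn normr0 add0r.
    apply: eq_bigr => i; rewrite -val_eqE/= => ik; rewrite !mxE ltnS.
    by rewrite leq_eqVlt (negbTE ik).
  have N1u : norm1 (prefix u k.+1) <= norm1 u.
    by apply: ler_sum => i _; rewrite mxE; case: ifP => //; rewrite normr0.
  have -> : psi (x + prefix u k.+1) - psi x =
    (psi (x + prefix u k.+1) - psi (x + prefix u k)) +
    (psi (x + prefix u k) - psi x) by rewrite addrA subrK.
  rewrite (le_trans (ler_normD _ _))// N1p mulrDr [leRHS]addrC lerD ?IH ?(ltnW kd)//.
  rewrite prefixS addrA; apply: (axis_lipschitz pG) => t tu; apply: GM.
  rewrite addrAC [x + _]addrC addrK (le_trans _ N1u)// N1p.
  by rewrite (le_trans (norm1D _ _))// lerD2l norm1Z norm1_delta mulr1.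
have := H d (leqnn d).
suff -> : prefix u d = u by [].
by apply/matrixP => i j; rewrite mxE ltn_ord (ord1 j).
Qed.

(** A single staircase from [x] to [y] could stray far from the segment. Short staircases give a
    Dini bound along the segment instead, so [G] matters only within distance 1 of it. *)
Lemma segment_lipschitz psi G x y (M : R) : axis_plip psi G ->
  (forall t q, 0 <= t <= 1 -> norm1 (q - (x + t *: (y - x))) <= 1 -> G q <= M) ->
  `|psi y - psi x| <= M * norm1 (y - x).
Proof.
move=> pG GM; set v := y - x.
have vy : x + 1 *: v = y by rewrite scale1r addrC subrK.
rewrite -[in leLHS](line0 psi x v) -{1}vy -[psi (_ + _)]/(line psi x v 1).
rewrite -[leRHS]mulr1 -[X in _ * X](subr0 1).
apply: plip_mvt => // t t01 e e0.
exists ((norm1 v + 1)^-1) => /=.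
  by rewrite invr_gt0; have := norm1_ge0 v; lra.
move=> s /= st; rewrite /line.
have -> : x + s *: v = x + t *: v + (s - t) *: v.
  by rewrite -addrA -scalerDl (addrC t) subrK.
have sv : norm1 ((s - t) *: v) <= 1.
  rewrite norm1Z distrC; have := norm1_ge0 v => v0.
  rewrite (@le_trans _ _ (`|t - s| * (norm1 v + 1)))//.
    by rewrite ler_wpM2l//; lra.
  by rewrite -ler_pdivlMr ?mul1r ?(ltW st)//; lra.
apply: (le_trans (box_lipschitz (M := M) pG _)).
  by move=> q qv; apply: (GM t) => //; exact: le_trans sv.
rewrite norm1Z mulrCA mulrC ler_wpM2r//; lra.
Qed.

Definition norm1_continuous psi := forall x e, 0 < e ->
  exists2 r, 0 < r & forall q, norm1 (q - x) < r -> `|psi q - psi x| < e.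

Definition locally_bounded G := forall r : R,
  exists2 M : R, 0 <= M & forall q, norm1 q <= r -> G q <= M.

Lemma axis_plip_continuous psi G : axis_plip psi G -> locally_bounded G ->
  norm1_continuous psi.
Proof.
move=> pG lG x e e0; have [M M0 HM] := lG (norm1 x + 1).
exists (Num.min 1 (e / (M + 1))) => [|q].
  by rewrite lt_min ltr01 divr_gt0//; lra.
rewrite lt_min => /andP[q1]; rewrite ltr_pdivlMr; last lra.
move=> qe; have {1}-> : q = x + (q - x) by rewrite addrC subrK.
apply: (le_lt_trans (box_lipschitz (M := M) pG _)).
  move=> q' q'q; apply: HM; rewrite -[q'](subrK x) addrC.
  by rewrite (le_trans (norm1D _ _))// lerD2l (le_trans q'q)// ltW.
by have := norm1_ge0 (q - x); lra.
Qed.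

Lemma norm1_continuous_cvg psi x (q : nat -> 'cV[R]_d) : norm1_continuous psi ->
  norm1 (q n - x) @[n --> \oo] --> 0 -> psi (q n) @[n --> \oo] --> psi x.
Proof.
move=> cpsi qx; apply/cvgrPdist_lt => e /(cpsi x)[r r0 hr].
have /cvgrPdist_lt/(_ r r0) := qx; apply: filterS => n /=.
by rewrite sub0r normrN distrC ger0_norm ?norm1_ge0//; exact: hr.
Qed.

End AxisLipschitz.

Section BorelFunctions.
Context {R : realType} {d : nat}.
Implicit Types (F G : 'cV[R]_d -> R).

(* Borel measurability of a function of several variables, without a
   sigma-algebra on the space of column vectors. *)
Definition borel F := forall (disp : measure_display) (T : measurableType disp)
  (V : T -> 'cV[R]_d), (forall i, measurable_fun setT (fun t => V t i 0)) ->
  measurable_fun setT (F \o V).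

(** Rounding the coordinates down to a grid leaves countably many values, each taken on a measurable
    event. As the mesh shrinks, continuity makes the composite a pointwise limit of measurable
    functions. *)
Lemma borel_continuous F : norm1_continuous F -> borel F.
Proof.
move=> cF disp T V mV.
pose V_ m t : 'cV[R]_d := \col_i ((Num.floor (m.+1%:R * V t i 0))%:~R / m.+1%:R).
apply: (@measurable_fun_cvg _ _ _ _ (fun m => F \o V_ m)).
- move=> m _ Y mY; rewrite setTI.
  pose K := [set k : 'cV[int]_d | Y (F (\col_i ((k i 0)%:~R / m.+1%:R)))].
  have -> : (F \o V_ m) @^-1` Y = \bigcup_(k in K) \bigcap_(i in [set: 'I_d])
     ((fun t => m.+1%:R * V t i 0) @^-1` `[(k i 0)%:~R, (k i 0 + 1)%:~R[).
    apply/seteqP; split => t /=.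
      move=> Yt; exists (\col_i Num.floor (m.+1%:R * V t i 0)).
        rewrite /K/=; rewrite (_ : (\col_i _) = V_ m t)//.
        by apply/matrixP => i j; rewrite !mxE.
      by move=> i _ /=; rewrite in_itv/= mxE floor_itv.
    move=> [k Kk Hk]; suff -> : V_ m t = \col_i ((k i 0)%:~R / m.+1%:R) by [].
    apply/matrixP => i j; rewrite !mxE; congr (_%:~R / _).
    by have := Hk i I; rewrite /= in_itv/= => ?; exact: floor_def.
  rewrite bigcup_mkcond; apply: countable_bigcupT_measurable => [|k].
    exact: countableP.
  case: ifPn => _ //; apply: fin_bigcap_measurable => // i _.
  rewrite -[X in measurable X]setTI; apply: measurable_funM => //.
- move=> t _; apply: norm1_continuous_cvg => //.
  apply/cvgrPdist_le => e e0; near=> m.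
  rewrite sub0r normrN ger0_norm ?norm1_ge0//.
  apply: (@le_trans _ _ (d%:R / m.+1%:R)).
    rewrite -[d in leRHS]card_ord -sum1_card natr_sum mulr_suml.
    apply: ler_sum => i _; rewrite !mxE mul1r.
    have /andP[h1 h2] := floor_itv (m.+1%:R * V t i 0).
    have m0 : 0 < m.+1%:R^-1 :> R by rewrite invr_gt0.
    have -> : (Num.floor (m.+1%:R * V t i 0))%:~R / m.+1%:R - V t i 0 =
      ((Num.floor (m.+1%:R * V t i 0))%:~R - m.+1%:R * V t i 0) / m.+1%:R.
      by field.
    rewrite normrM (gtr0_norm m0) ler_piMl ?(ltW m0)//.
    rewrite intrD in h2; rewrite ler_norml; apply/andP; split; lra.
  rewrite ler_pdivrMr// mulrC -ler_pdivrMr//.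
  rewrite (@le_trans _ _ m%:R) ?ler_nat//; near: m; exact: nbhs_infty_ger.
Unshelve. all: by end_near. Qed.

Lemma borel_comp1 (f : R -> R) F : measurable_fun setT f -> borel F ->
  borel (fun x => f (F x)).
Proof. by move=> mf bF disp T V mV; exact: (measurableT_comp mf (bF _ _ V mV)). Qed.

Lemma borel_cst (c : R) : borel (fun=> c).
Proof. by move=> disp T V mV; exact: measurable_cst. Qed.

Lemma borel_coord (i : 'I_d) : borel (fun x => x i 0).
Proof. by move=> disp T V mV; exact: mV. Qed.

Lemma borelD F G : borel F -> borel G -> borel (fun x => F x + G x).
Proof. by move=> bF bG disp T V mV; apply: measurable_funD; [exact: bF|exact: bG]. Qed.

Lemma borelB F G : borel F -> borel G -> borel (fun x => F x - G x).
Proof. by move=> bF bG disp T V mV; apply: measurable_funB; [exact: bF|exact: bG]. Qed.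

Lemma borelM F G : borel F -> borel G -> borel (fun x => F x * G x).
Proof. by move=> bF bG disp T V mV; apply: measurable_funM; [exact: bF|exact: bG]. Qed.

Lemma borel_norm F : borel F -> borel (fun x => `|F x|).
Proof. by move=> bF disp T V mV; apply: measurableT_comp => //; exact: bF. Qed.

Lemma borel_expR F : borel F -> borel (fun x => expR (F x)).
Proof. by move=> bF disp T V mV; apply: measurableT_comp => //; exact: bF. Qed.

Lemma borel_sum (I : Type) (r : seq I) (F : I -> 'cV[R]_d -> R) :
  (forall i, borel (F i)) -> borel (fun x => \sum_(i <- r) F i x).
Proof.
move=> bF disp T V mV; rewrite /comp /=.
by apply: measurable_sum => i; exact: bF.
Qed.

Lemma borel_mulmx (A : 'M[R]_d) (i : 'I_d) : borel (fun x => (A *m x) i 0).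
Proof.
move=> disp T V mV; rewrite /comp; under eq_fun do rewrite mxE.
by apply: measurable_sum => j; apply: measurable_funM.
Qed.

Lemma borel_subst F (W : 'cV[R]_d -> 'cV[R]_d) : borel F ->
  (forall i, borel (fun x => W x i 0)) -> borel (F \o W).
Proof.
move=> bF bW disp T V mV; apply: (bF _ _ (W \o V)) => i; exact: (bW i _ _ V mV).
Qed.

Lemma borel_affine F (A : 'M[R]_d) (c : R) w : borel F ->
  borel (fun x => F (w + c *: (A *m x))).
Proof.
move=> bF; apply: (borel_subst (W := fun x => w + c *: (A *m x)) bF) => i.
have -> : (fun x : 'cV[R]_d => (w + c *: (A *m x)) i 0) =
    (fun x => w i 0 + c * (A *m x) i 0).
  by apply/funext => x; rewrite !mxE.
by apply: borelD; [exact: borel_cst|apply: borelM; [exact: borel_cst|exact: borel_mulmx]].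
Qed.

Lemma borel_translate F w : borel F -> borel (fun x => F (x + w)).
Proof.
move=> bF; apply: (borel_subst (W := fun x => x + w) bF) => i.
have -> : (fun x : 'cV[R]_d => (x + w) i 0) = (fun x => x i 0 + w i 0).
  by apply/funext => x; rewrite !mxE.
by apply: borelD; [exact: borel_coord|exact: borel_cst].
Qed.

Lemma borel_cvg (F : nat -> 'cV[R]_d -> R) G : (forall n, borel (F n)) ->
  (forall x, F n x @[n --> \oo] --> G x) -> borel G.
Proof.
move=> bF FG disp T V mV.
apply: (@measurable_fun_cvg _ _ _ _ (fun n => F n \o V)) => [m|t _]; first exact: bF.
exact: FG.
Qed.

Lemma borel_sups (F : nat -> 'cV[R]_d -> R) n : (forall n, borel (F n)) ->
  (forall x, has_ubound (range (F ^~ x))) -> borel (fun x => sups (F ^~ x) n).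
Proof.
move=> bF ubF disp T V mV.
apply: (@measurable_fun_sups _ _ _ _ (fun n => F n \o V)) => [t _|m]; last exact: bF.
exact: ubF.
Qed.

End BorelFunctions.

(** * Translations of a Gaussian vector *)

Section StandardNormal.
Context {R : realType}.
Local Notation lam := (@lebesgue_measure R).
Local Notation gauss := (@normal_prob R 0 1).
Local Open Scope ereal_scope.

(** The Radon-Nikodym derivative agrees almost everywhere with [normal_pdf], because both integrate
    to [normal_prob] over every measurable set. *)
Lemma ge0_integral_normal_prob (f : R -> \bar R) : measurable_fun setT f ->
  (forall x, 0 <= f x) ->
  \int[gauss]_x f x = \int[lam]_x (f x * (normal_pdf 0 1 x)%:E).
Proof.
move=> mf f0; have dom := @normal_prob_dominates R 0 1.
rewrite -(Radon_Nikodym_SigmaFinite.change_of_variables dom)//.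
have mRN := measurable_int _ (Radon_Nikodym_SigmaFinite.f_integrable dom).
have mpdf : measurable_fun [set: R] (fun x => (normal_pdf 0 1 x)%:E).
  by apply/measurable_EFinP; exact: measurable_normal_pdf.
apply: ge0_ae_eq_integral => //.
- exact: emeasurable_funM.
- exact: emeasurable_funM.
- by move=> x _; rewrite mule_ge0// Radon_Nikodym_SigmaFinite.f_ge0.
- by move=> x _; rewrite mule_ge0// lee_fin normal_pdf_ge0.
apply: ae_eqe_mul2l; apply: integral_ae_eq => //.
  exact: Radon_Nikodym_SigmaFinite.f_integrable.
by move=> E _ mE; rewrite -Radon_Nikodym_SigmaFinite.f_integral.
Qed.

Lemma ge0_integral_translation (f : R -> \bar R) (t : R) :
  measurable_fun setT f -> (forall x, 0 <= f x) ->
  \int[lam]_x f (x + t)%R = \int[lam]_x f x.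
Proof.
move=> mf f0; have mt : measurable_fun [set: measurableTypeR R]
    ((fun x : R => x + t)%R : measurableTypeR R -> measurableTypeR R).
  exact: measurable_funD.
rewrite -[LHS](@ge0_integral_pushforward _ _ _ _ _ _ mt lam setT f)//.
apply: eq_measure_integral => A mA _.
pose mu' : {measure set (measurableTypeR R) -> \bar R} :=
  measure_function_pushforward__canonical__measure_function_Measure lam mt.
rewrite -[LHS]/(mu' A); apply/esym/lebesgue_measure_unique => // X [[a b] _ <-].
rewrite /= /pushforward/= (_ : _ @^-1` _ = `](a - t)%R, (b - t)%R]%classic).
  rewrite !lebesgue_measure_itv/= !lte_fin ltrD2r; case: ifPn => // _.
  by rewrite -!EFinD; congr (_%:E); ring.
by apply/seteqP; split => x /=; rewrite !in_itv/= ltrBlDr lerBrDr.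
Qed.

Lemma ge0_normal_shift (f : R -> R) (t : R) : measurable_fun setT f ->
  (forall x, (0 <= f x)%R) ->
  \int[gauss]_x (f (x + t)%R)%:E =
  \int[gauss]_x (f x * expR (t * x - t ^+ 2 / 2))%:E.
Proof.
move=> mf f0.
have mexp : measurable_fun [set: R] (fun x => expR (t * x - t ^+ 2 / 2)).
  by apply: measurableT_comp => //; apply: measurable_funB => //; exact: measurable_funM.
have mt : measurable_fun [set: R] (fun x : R => x + t)%R by exact: measurable_funD.
rewrite ge0_integral_normal_prob//; last 2 first.
- by apply/measurable_EFinP; exact: (measurableT_comp mf mt).
- by move=> x; rewrite lee_fin.
rewrite ge0_integral_normal_prob//; last 2 first.
- by apply/measurable_EFinP; exact: measurable_funM.
- by move=> x; rewrite lee_fin mulr_ge0// expR_ge0.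
(* Translating the variable on the right makes the two integrands equal, by completing the square in
   the exponent. *)
rewrite -[RHS](ge0_integral_translation t)//; last 2 first.
- apply: emeasurable_funM; first by apply/measurable_EFinP; exact: measurable_funM.
  by apply/measurable_EFinP; exact: measurable_normal_pdf.
- by move=> x; rewrite mule_ge0// lee_fin ?mulr_ge0// ?expR_ge0 ?normal_pdf_ge0.
apply: eq_integral => x _; rewrite -!EFinM -mulrA; congr (_ * _)%:E.
rewrite !(normal_pdfE _ (oner_neq0 R)) mulrCA; congr (_ * _)%R.
rewrite /normal_fun -expRD; congr expR.
by rewrite !subr0 expr1n mulr2n; field.
Qed.

End StandardNormal.

Section ShiftFormula.
Context {R : realType} {disp : measure_display} {Omega : measurableType disp}.
Variables (Pr : probability Omega R) (d : nat) (Z : 'I_d -> {RV Pr >-> R}).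
Hypothesis HZ : std_normal_vector Z.
Local Notation gauss := (@normal_prob R 0 1).
Implicit Types (F : 'cV[R]_d -> R) (z : 'cV[R]_d).

(** Boxes are closed under intersection and independence gives their probability, so they determine
    the law of the vector. The sigma-algebra they generate is there for the uniqueness theorem for
    measures. *)
Let boxes : set (set 'cV[R]_d) :=
  [set B | exists A : 'I_d -> set R, (forall i, measurable (A i)) /\
     B = [set z : 'cV[R]_d | forall i, A i (z i 0)]].

Let TT := g_sigma_algebraType boxes.

Let replace z k x : 'cV[R]_d := \col_i (if i == k then x else z i 0).

Lemma measurable_vecZ (i : 'I_d) : measurable_fun setT (fun om => vecZ Z om i 0).
Proof. by rewrite /vecZ; under eq_fun do rewrite mxE; exact: measurable_funP. Qed.

Let measurable_to_TT d' (T : measurableType d') (V : T -> TT) :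
  (forall i, measurable_fun setT (fun t => (V t : 'cV[R]_d) i 0)) ->
  measurable_fun setT V.
Proof.
move=> mV; have Q := @measurability _ _ T TT setT V boxes; apply: Q => //.
move=> _ [_ [A [mA ->]] <-]; rewrite setTI.
rewrite (_ : _ @^-1` _ = \bigcap_(i in [set: 'I_d]) ((fun t => (V t : 'cV[R]_d) i 0) @^-1` A i)).
  by apply: fin_bigcap_measurable => // i _; rewrite -[X in measurable X]setTI; exact: mV.
by apply/seteqP; split => t /= H i; [move=> _|]; exact: H.
Qed.

Let borel_measurable F : borel F -> measurable_fun [set: TT] F.
Proof.
move=> bF; apply: (bF _ TT id) => i _ Y mY; rewrite setTI.
apply: sub_sigma_algebra; exists (fun j => if j == i then Y else setT).
split; first by move=> j; case: ifP.
apply/seteqP; split => z /= H; first by move=> j; case: eqP => // ->.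
by have := H i; rewrite eqxx.
Qed.

Let measurable_replace k : measurable_fun [set: Omega * measurableTypeR R]
  (fun p => replace (vecZ Z p.1) k p.2 : TT).
Proof.
apply: measurable_to_TT => i; rewrite /replace /=.
under eq_fun do rewrite mxE; case: (i == k); first exact: measurable_snd.
exact: (measurableT_comp (measurable_vecZ i) measurable_fst).
Qed.

(** Drawing the coordinate [k] afresh does not change the law, since both measures agree on boxes.
    This reduces the shift of one coordinate to dimension one. *)
Lemma resample k F : borel F -> (forall z, 0 <= F z) ->
  (\int[Pr]_om (F (vecZ Z om))%:E =
   \int[Pr]_om \int[gauss]_x (F (replace (vecZ Z om) k x))%:E)%E.
Proof.
move=> bF F0; have mZ : measurable_fun [set: Omega] (vecZ Z : Omega -> TT).
  by apply: measurable_to_TT; exact: measurable_vecZ.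
have mF : measurable_fun [set: TT] (EFin \o F).
  by apply/measurable_EFinP; exact: borel_measurable.
rewrite -[LHS](@ge0_integral_pushforward _ _ _ _ _ _ mZ Pr setT (EFin \o F))//; last first.
  by move=> z _; rewrite lee_fin.
have mr := measurable_replace k.
transitivity (\int[(Pr \x gauss)%E]_p (F (replace (vecZ Z p.1) k p.2))%:E)%E; last first.
  rewrite fubini_tonelli1//=; last by move=> p; rewrite lee_fin.
  exact: (measurableT_comp mF mr).
rewrite -[RHS](@ge0_integral_pushforward _ _ _ _ _ _ mr (Pr \x gauss)%E setT (EFin \o F))//; last first.
  by move=> z _; rewrite lee_fin.
apply: eq_measure_integral => A mA _.
pose m1 : {measure set TT -> \bar R} :=
  measure_function_pushforward__canonical__measure_function_Measure Pr mZ.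
pose m2 : {measure set TT -> \bar R} :=
  measure_function_pushforward__canonical__measure_function_Measure (Pr \x gauss)%E mr.
rewrite -[LHS]/(m1 A) -[RHS]/(m2 A).
have U := @measure_unique _ R TT boxes (fun=> setT) erefl.
apply: (U _ _ _ m1 m2) => // {U}.
- move=> _ _ [A1 [mA1 ->]] [A2 [mA2 ->]]; exists (fun i => A1 i `&` A2 i); split.
    by move=> i; exact: measurableI.
  by apply/seteqP; split => z /=; [move=> [h1 h2] i; split|move=> h; split=> i; have [] := h i].
- by move=> _; exists (fun=> setT); split => //; apply/seteqP; split.
- by apply/seteqP; split => // z _; exists 0%N.
- move=> _ [B [mB ->]]; rewrite /m1 /m2 /= /pushforward.
  (* Dropping the condition on coordinate [k] leaves an event about the other coordinates, so the
     preimage is a product set. *)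
  pose B' i := if i == k then setT else B i.
  have mB' i : measurable (B' i) by rewrite /B'; case: ifP.
  have [Zd Zi] := HZ.
  rewrite (_ : _ @^-1` _ = \bigcap_i (Z i @^-1` B i)); last first.
    apply/seteqP; split => om /= h i; first by move=> _; have := h i; rewrite mxE.
    by rewrite mxE; exact: h.
  rewrite Zi// (_ : _ @^-1` _ = (\bigcap_i (Z i @^-1` B' i)) `*` B k); last first.
    apply/seteqP; split => -[om x] /=.
      move=> h; split; last by have := h k; rewrite mxE eqxx.
      by move=> i _ /=; have := h i; rewrite /B' !mxE; case: ifP.
    move=> [h Bx] i; rewrite mxE; case: eqP => [->//|/eqP ik].
    by have := h i I; rewrite /B' (negbTE ik)/= mxE.
  have mBB : measurable (\bigcap_i (Z i @^-1` B' i)).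
    apply: fin_bigcap_measurable => // i _; rewrite -[X in measurable X]setTI.
    exact: measurable_funP.
  rewrite [RHS](_ : _ = Pr (\bigcap_i (Z i @^-1` B' i)) * gauss (B k))%E; last first.
    by apply: product_measure1E => //; exact: mB.
  rewrite Zi// (bigD1 k)//= [in RHS](bigD1 k)//= /B' eqxx preimage_setT probability_setT.
  rewrite mul1e muleC Zd//; congr (_ * _)%E.
  by apply: eq_bigr => i /negbTE ->.
- move=> _; rewrite /m1 /= /pushforward preimage_setT; exact: fin_num_fun_lty.
Qed.

Lemma shift_coord k F t : borel F -> (forall z, 0 <= F z) ->
  (\int[Pr]_om (F (vecZ Z om + t *: delta_mx k 0))%:E =
   \int[Pr]_om (F (vecZ Z om) * expR (t * vecZ Z om k 0 - t ^+ 2 / 2))%:E)%E.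
Proof.
move=> bF F0.
have bG : borel (fun z : 'cV[R]_d => F z * expR (t * z k 0 - t ^+ 2 / 2)).
  apply: borelM => //; apply: borel_expR; apply: borelB; last exact: borel_cst.
  by apply: borelM; [exact: borel_cst|exact: borel_coord].
rewrite (resample k (F := fun z => F (z + t *: delta_mx k 0)))//; last first.
  exact: borel_translate.
rewrite (resample k bG); last by move=> z; rewrite mulr_ge0// expR_ge0.
apply: eq_integral => om _; set z := vecZ Z om.
have mFz : measurable_fun [set: R] (fun x => F (replace z k x)).
  apply: (bF _ _ (fun x : R => replace z k x)) => i; rewrite /replace.
  under eq_fun do rewrite mxE; case: (i == k); first exact: measurable_id.
  exact: measurable_cst.
rewrite -[LHS](_ : (\int[gauss]_x (F (replace z k (x + t)%R))%:E)%E = _); last first.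
  apply: eq_integral => x _; congr (F _)%:E; apply/matrixP => i j.
  by rewrite !mxE (ord1 j) eqxx andbT; case: eqP => _; rewrite ?mulr1// mulr0 addr0.
rewrite (ge0_normal_shift t mFz)//.
by apply: eq_integral => x _; rewrite mxE eqxx.
Qed.

End ShiftFormula.

Section VectorShift.
Context {R : realType} {disp : measure_display} {Omega : measurableType disp}.
Variables (Pr : probability Omega R) (d : nat) (Z : 'I_d -> {RV Pr >-> R}).
Hypothesis HZ : std_normal_vector Z.
Implicit Types (F : 'cV[R]_d -> R) (z b : 'cV[R]_d).

Definition dotv b z : R := \sum_(i < d) b i 0 * z i 0.

Lemma dotvC b z : dotv b z = dotv z b.
Proof. by apply: eq_bigr => i _; rewrite mulrC. Qed.

Lemma dotvD b z z' : dotv b (z + z') = dotv b z + dotv b z'.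
Proof. by rewrite /dotv -big_split; apply: eq_bigr => i _; rewrite mxE mulrDr. Qed.

Lemma dotvZ (a : R) b z : dotv b (a *: z) = a * dotv b z.
Proof. by rewrite /dotv mulr_sumr; apply: eq_bigr => i _; rewrite mxE mulrCA. Qed.

Lemma dotvZl (a : R) b z : dotv (a *: b) z = a * dotv b z.
Proof. by rewrite dotvC dotvZ dotvC. Qed.

Lemma dotv_norm1 b z : `|dotv b z| <= norm1 b * norm1 z.
Proof.
rewrite mulr_suml (le_trans (ler_norm_sum _ _ _))// ler_sum// => i _.
by rewrite normrM ler_wpM2l// norm1_coord.
Qed.

Lemma borel_dotv b : borel (dotv b).
Proof.
by apply: borel_sum => i; apply: borelM; [exact: borel_cst|exact: borel_coord].
Qed.

(* Density of [Z + b] with respect to [Z]. *)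
Definition shift_density b z : R := expR (dotv b z - dotv b b / 2).

(** The coordinates are shifted one after the other. They have to be distinct, so that the shift of
    one leaves the density collected from the others unchanged. *)
Lemma shift_vec b F : borel F -> (forall z, 0 <= F z) ->
  (\int[Pr]_om (F (vecZ Z om + b))%:E =
   \int[Pr]_om (F (vecZ Z om) * shift_density b (vecZ Z om))%:E)%E.
Proof.
have H (r : seq 'I_d) : uniq r -> forall F, borel F -> (forall z, 0 <= F z) ->
  (\int[Pr]_om (F (vecZ Z om + \sum_(i <- r) b i 0 *: delta_mx i 0))%:E =
   \int[Pr]_om (F (vecZ Z om) *
     expR (\sum_(i <- r) (b i 0 * vecZ Z om i 0 - (b i 0) ^+ 2 / 2)))%:E)%E.
  elim: r => [_ {}F bF F0|i r IH /= /andP[ir ur] {}F bF F0].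
    by apply: eq_integral => om _; rewrite !big_nil addr0 expR0 mulr1.
  pose F1 z := F (z + b i 0 *: delta_mx i 0).
  pose E z := expR (\sum_(j <- r) (b j 0 * z j 0 - (b j 0) ^+ 2 / 2)).
  transitivity (\int[Pr]_om
      (F1 (vecZ Z om + \sum_(i <- r) b i 0 *: delta_mx i 0))%:E)%E.
    apply: eq_integral => om _; rewrite big_cons /F1 -!addrA.
    by rewrite (addrC (b i 0 *: _)).
  have bF1 : borel F1 by exact: borel_translate.
  have F10 z : 0 <= F1 z by exact: F0.
  rewrite (IH ur F1 bF1 F10).
  have bE : borel (fun z => F z * E z).
    apply: borelM => //; apply: borel_expR; apply: borel_sum => j.
    apply: borelB; last exact: borel_cst.
    by apply: borelM; [exact: borel_cst|exact: borel_coord].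
  transitivity (\int[Pr]_om ((F (vecZ Z om) * E (vecZ Z om)) *
      expR (b i 0 * vecZ Z om i 0 - b i 0 ^+ 2 / 2))%:E)%E; last first.
    apply: eq_integral => om _; rewrite big_cons [in RHS]expRD.
    by congr (_%:E); rewrite -mulrA; congr (_ * _); exact: mulrC.
  rewrite -(shift_coord HZ i (b i 0) bE); last by move=> z; rewrite mulr_ge0// expR_ge0.
  apply: eq_integral => om _; congr (_ * expR _)%:E.
  rewrite !big_seq; apply: eq_bigr => j jr.
  suff -> : (vecZ Z om + b i 0 *: delta_mx i 0) j 0 = vecZ Z om j 0 by [].
  rewrite [LHS]mxE [X in _ + X]mxE [X in _ * X]mxE.
  by case: eqP => [ji|_]; [rewrite -ji jr in ir|rewrite /= mulr0 addr0].
move=> bF F0.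
transitivity (\int[Pr]_om (F (vecZ Z om + \sum_i b i 0 *: delta_mx i 0))%:E)%E.
  apply: eq_integral => om _; congr (F (_ + _))%:E; apply/matrixP => j k.
  rewrite summxE (bigD1 j)//= !mxE (ord1 k) !eqxx mulr1 big1 ?addr0// => l lj.
  by rewrite !mxE eq_sym (negbTE lj) mulr0.
rewrite (H _ (index_enum_uniq _))//; apply: eq_integral => om _; congr (_ * expR _)%:E.
by rewrite sumrB /dotv mulr_suml.
Qed.

End VectorShift.

(** * Integrals below an exponentially weighted majorant *)

Section DominatedExpectations.
Context {R : realType} {disp : measure_display} {Omega : measurableType disp}.
Variables (Pr : probability Omega R) (d : nat) (Z : 'I_d -> {RV Pr >-> R}).
Hypothesis HZ : std_normal_vector Z.
Variables (U : R -> 'cV[R]_d -> R) (kap : R).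
Hypothesis kap0 : 0 <= kap.
Hypothesis U1 : forall l z, 0 <= l -> 1 <= U l z.
Hypothesis Ule : forall l m z, 0 <= l <= m -> U l z <= U m z.
Hypothesis Ushift : forall l z b, 0 <= l -> U l (z + b) <= U (l + kap * norm1 b) z.
(* [U l (Z)] need not be measurable; only its Borel minorants are integrated. *)
Hypothesis KH : forall l, 0 <= l -> exists2 K : R, 0 <= K &
  forall F, borel F -> (forall z, 0 <= F z <= U l z) ->
    (\int[Pr]_om (F (vecZ Z om))%:E <= K%:E)%E.
Implicit Types (F G : 'cV[R]_d -> R) (z b : 'cV[R]_d) (l A : R).

Definition majorant l z := expR (l * norm1 z) * U l z.

Definition dominated l A F := forall z, `|F z| <= A * majorant l z.

Lemma majorant_ge1 l z : 0 <= l -> 1 <= majorant l z.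
Proof.
move=> l0; rewrite /majorant -[1]mulr1 ler_pM// ?U1//.
by rewrite -expR0 ler_expR mulr_ge0// norm1_ge0.
Qed.

Lemma majorant_ge0 l z : 0 <= l -> 0 <= majorant l z.
Proof. by move=> l0; rewrite (le_trans _ (majorant_ge1 z l0)). Qed.

(* A polynomial, or exponential, factor is absorbed by enlarging [l]. *)
Lemma dominatedM l m A B F G : 0 <= l -> 0 <= m -> 0 <= A -> 0 <= B ->
  (forall z, `|F z| <= B * expR (m * norm1 z)) -> dominated l A G ->
  dominated (l + m) (A * B) (fun z => F z * G z).
Proof.
move=> l0 m0 A0 B0 FB GA z; rewrite normrM.
rewrite (le_trans (ler_pM _ _ (FB z) (GA z)))//.
have -> : B * expR (m * norm1 z) * (A * majorant l z) =
    A * B * (expR (m * norm1 z) * majorant l z) by ring.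
rewrite ler_wpM2l ?mulr_ge0// /majorant mulrA -expRD -mulrDl addrC ler_wpM2l ?expR_ge0//.
by apply: Ule; lra.
Qed.

(** A sum of exponentials of single coordinates that dominates [expR (l * norm1 z)]; the factor [d]
    is there because [norm1 z] is at most [d] times the largest coordinate in absolute value. *)
Let weight l z := 1 + \sum_(i < d) (expR (d%:R * l * z i 0) + expR (- (d%:R * l) * z i 0)).

Let weight_ge l z : 0 <= l -> expR (l * norm1 z) <= weight l z.
Proof.
move=> l0; have [i0 _|d0] := pickP (fun _ : 'I_d => true); last first.
  rewrite (_ : norm1 z = 0) ?mulr0 ?expR0; last by apply: big1 => i; have := d0 i.
  by rewrite lerDl sumr_ge0// => i _; rewrite addr_ge0 ?expR_ge0.
pose i := [arg max_(i > i0) `|z i 0|]%O.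
have iP j : `|z j 0| <= `|z i 0| by rewrite /i; case: arg_maxP => // k _; exact.
apply: (@le_trans _ _ (expR (d%:R * l * `|z i 0|))).
  rewrite ler_expR mulrAC [leRHS]mulrC ler_wpM2l//.
  rewrite (_ : d%:R = \sum_(j < d) 1) ?mulr_suml; last first.
    by rewrite sumr_const card_ord.
  by apply: ler_sum => j _; rewrite mul1r.
rewrite /weight (bigD1 i)//= addrCA ler_wpDr ?addr_ge0//.
  by apply: sumr_ge0 => j _; rewrite addr_ge0 ?expR_ge0.
have [zi|zi] := leP 0 (z i 0); first by rewrite (ger0_norm zi) lerDl expR_ge0.
by rewrite (ltr0_norm zi) mulrN mulNr lerDr expR_ge0.
Qed.

Let weight_gt0 l z : 0 < weight l z.
Proof.
rewrite /weight ltr_pwDl//; apply: sumr_ge0 => i _.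
by rewrite addr_ge0 ?expR_ge0.
Qed.

Let borel_weight l : borel (weight l).
Proof.
apply: borelD; first exact: borel_cst.
apply: borel_sum => i; apply: borelD; apply: borel_expR;
  by apply: borelM; [exact: borel_cst|exact: borel_coord].
Qed.

(** Up to the constant [expR (t ^+ 2 / 2)] the exponential is the density of a translation of one
    coordinate, and a translation only enlarges the index of [U]. *)
Let exp_coord_bound l (t : R) i : 0 <= l -> exists2 K : R, 0 <= K &
  forall F, borel F -> (forall z, 0 <= F z <= U l z) ->
    (\int[Pr]_om (F (vecZ Z om) * expR (t * vecZ Z om i 0))%:E <= K%:E)%E.
Proof.
move=> l0; have l1 : 0 <= l + kap * `|t| by rewrite addr_ge0// mulr_ge0.
have [K K0 HK] := KH l1; exists (K * expR (t ^+ 2 / 2)); first by rewrite mulr_ge0// expR_ge0.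
move=> F bF FU; pose G z := F (z + t *: delta_mx i 0).
have bG : borel G by exact: borel_translate.
have GU z : 0 <= G z <= U (l + kap * `|t|) z.
  have /andP[h1 h2] := FU (z + t *: delta_mx i 0); rewrite /G h1/= (le_trans h2)//.
  by rewrite (le_trans (Ushift _ _ l0))// norm1Z norm1_delta mulr1.
have /(lee_wpmul2r (_ : (0 <= (expR (t ^+ 2 / 2))%:E)%E)) := HK G bG GU.
rewrite -EFinM => /(_ _)/(le_trans _); apply; last by rewrite lee_fin expR_ge0.
rewrite /G (shift_coord HZ)//; last by move=> z; have /andP[] := FU z.
have mF : measurable_fun setT (fun om => (F (vecZ Z om) *
    expR (t * vecZ Z om i 0 - t ^+ 2 / 2))%:E).
  apply/measurable_EFinP.
  have bH : borel (fun z : 'cV[R]_d => F z * expR (t * z i 0 - t ^+ 2 / 2)).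
    apply: borelM => //; apply: borel_expR; apply: borelB; last exact: borel_cst.
    by apply: borelM; [exact: borel_cst|exact: borel_coord].
  exact: (bH _ _ _ (measurable_vecZ Z)).
rewrite -ge0_integralZr ?lee_fin ?expR_ge0//; last first.
  by move=> om _; rewrite lee_fin mulr_ge0 ?expR_ge0//; have /andP[] := FU (vecZ Z om).
rewrite le_eqVlt; apply/orP; left; apply/eqP; apply: eq_integral => om _.
by rewrite -EFinM -mulrA -expRD subrK.
Qed.

Lemma majorant_bound l : 0 <= l -> exists2 K : R, 0 <= K &
  forall F, borel F -> (forall z, 0 <= F z <= majorant l z) ->
    (\int[Pr]_om (F (vecZ Z om))%:E <= K%:E)%E.
Proof.
move=> l0; have [K K0 HK] := KH l0.
have /choice[Kp HKp] : forall i, exists K : R, 0 <= K /\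
  forall F, borel F -> (forall z, 0 <= F z <= U l z) ->
    (\int[Pr]_om (F (vecZ Z om) * expR (d%:R * l * vecZ Z om i 0))%:E <= K%:E)%E.
  by move=> i; have [k ? ?] := exp_coord_bound (d%:R * l) i l0; exists k.
have /choice[Km HKm] : forall i, exists K : R, 0 <= K /\
  forall F, borel F -> (forall z, 0 <= F z <= U l z) ->
    (\int[Pr]_om (F (vecZ Z om) * expR (- (d%:R * l) * vecZ Z om i 0))%:E <= K%:E)%E.
  by move=> i; have [k ? ?] := exp_coord_bound (- (d%:R * l)) i l0; exists k.
exists (K + \sum_(i < d) (Kp i + Km i)).
  rewrite addr_ge0// sumr_ge0// => i _.
  by rewrite addr_ge0//; [have [] := HKp i|have [] := HKm i].
(* Dividing by the weight brings [F] below [U l]; expanding the weight again leaves integrals of the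
   kind just bounded. *)
move=> F bF FV; pose F0 z := F z / weight l z.
have bF0 : borel F0.
  have -> : F0 = fun z => F z * expR (- ln (weight l z)).
    by apply/funext => z; rewrite /F0 expRN lnK// posrE weight_gt0.
  apply: borelM => //; apply: borel_expR.
  apply: (borel_comp1 (f := fun x => - ln x)) (borel_weight l).
  by apply: measurableT_comp => //; exact: measurable_ln.
have F0U z : 0 <= F0 z <= U l z.
  have /andP[h1 h2] := FV z; rewrite /F0 divr_ge0//= ?(ltW (weight_gt0 _ _))//.
  rewrite ler_pdivrMr ?weight_gt0// (le_trans h2)// /majorant mulrC ler_wpM2l//.
    by rewrite (le_trans _ (U1 z l0)).
  exact: weight_ge.
have mcomp G : borel G -> measurable_fun setT (fun om => (G (vecZ Z om))%:E).
  by move=> bG; apply/measurable_EFinP; exact: (bG _ _ _ (measurable_vecZ Z)).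
have bexp (t : R) i : borel (fun z : 'cV[R]_d => F0 z * expR (t * z i 0)).
  apply: borelM => //; apply: borel_expR.
  by apply: borelM; [exact: borel_cst|exact: borel_coord].
have F00 z : 0 <= F0 z by have /andP[] := F0U z.
have E om : (F (vecZ Z om))%:E = ((F0 (vecZ Z om))%:E + \sum_(i < d)
  ((F0 (vecZ Z om) * expR (d%:R * l * vecZ Z om i 0))%:E +
   (F0 (vecZ Z om) * expR (- (d%:R * l) * vecZ Z om i 0))%:E))%E.
  under eq_bigr do rewrite -EFinD -mulrDr.
  rewrite sumEFin -mulr_sumr -EFinD -[X in (X + _)%:E]mulr1 -mulrDr.
  by rewrite /F0 -/(weight l (vecZ Z om)) divfK// gt_eqF// weight_gt0.
under eq_integral do rewrite E.
rewrite ge0_integralD//; last 4 first.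
- by move=> om _; rewrite lee_fin.
- exact: mcomp.
- by move=> om _; apply: sume_ge0 => i _; rewrite -EFinD lee_fin addr_ge0// mulr_ge0// expR_ge0.
- apply: emeasurable_sum => i; apply: emeasurable_funD; exact: (mcomp _ (bexp _ _)).
rewrite EFinD leeD//; first exact: HK.
rewrite ge0_integral_sum//; last 2 first.
- by move=> i; apply: emeasurable_funD; exact: (mcomp _ (bexp _ _)).
- by move=> i om _; rewrite -EFinD lee_fin addr_ge0// mulr_ge0// expR_ge0.
rewrite -sumEFin; apply: lee_sum => i _; rewrite ge0_integralD//; last 4 first.
- by move=> om _; rewrite lee_fin mulr_ge0// expR_ge0.
- exact: (mcomp _ (bexp _ _)).
- by move=> om _; rewrite lee_fin mulr_ge0// expR_ge0.
- exact: (mcomp _ (bexp _ _)).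
by rewrite EFinD leeD//; [have [_] := HKp i; exact|have [_] := HKm i; exact].
Qed.

End DominatedExpectations.

Section ExpectationOfDominated.
Context {R : realType} {disp : measure_display} {Omega : measurableType disp}.
Variables (Pr : probability Omega R) (d : nat) (Z : 'I_d -> {RV Pr >-> R}).
Variable U : R -> 'cV[R]_d -> R.
Hypothesis MB : forall l, 0 <= l -> exists2 K : R, 0 <= K &
  forall F, borel F -> (forall z, 0 <= F z <= majorant U l z) ->
    (\int[Pr]_om (F (vecZ Z om))%:E <= K%:E)%E.
Implicit Types (F G : 'cV[R]_d -> R) (z : 'cV[R]_d) (l A : R).

Definition EZ F : R := \int[Pr]_om F (vecZ Z om).

Lemma borel_vecZ F : borel F -> measurable_fun setT (fun om => F (vecZ Z om)).
Proof. by move=> bF; exact: (bF _ _ _ (measurable_vecZ Z)). Qed.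

Lemma dominated_bound l : 0 <= l -> exists2 K : R, 0 <= K &
  forall A F, 0 <= A -> borel F -> dominated U l A F ->
  Pr.-integrable setT (fun om => (F (vecZ Z om))%:E) /\
  EZ (fun z => `|F z|) <= A * K.
Proof.
move=> l0; have [K K0 HK] := MB l0; exists K => // A F A0 bF FA.
have h : (\int[Pr]_om `|F (vecZ Z om)|%:E <= (A * K)%:E)%E.
  have [A00|An0] := eqVneq A 0.
    rewrite integral0_eq ?A00 ?mul0r// => om _.
    by have := FA (vecZ Z om); rewrite A00 mul0r normr_le0 => /eqP ->; rewrite normr0.
  have {An0}A0 : 0 < A by rewrite lt_neqAle eq_sym An0.
  pose G z := A^-1 * `|F z|.
  have bG : borel G by apply: borelM; [exact: borel_cst|exact: borel_norm].
  have GV z : 0 <= G z <= majorant U l z.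
    by rewrite /G mulr_ge0 ?invr_ge0 ?(ltW A0)//= mulrC ler_pdivrMr// mulrC; exact: FA.
  have -> : (\int[Pr]_om `|F (vecZ Z om)|%:E = A%:E * \int[Pr]_om (G (vecZ Z om))%:E)%E.
    rewrite -ge0_integralZl//.
    - by apply: eq_integral => om _; rewrite -EFinM /G mulVKf// gt_eqF.
    - by apply/measurable_EFinP; exact: borel_vecZ.
    - by move=> om _; rewrite lee_fin; have /andP[] := GV (vecZ Z om).
    - by rewrite lee_fin ltW.
  by rewrite EFinM lee_wpmul2l ?lee_fin ?(ltW A0)//; exact: HK.
have iF : Pr.-integrable setT (fun om => (F (vecZ Z om))%:E).
  apply/integrableP; split; first by apply/measurable_EFinP; exact: borel_vecZ.
  by rewrite (le_lt_trans h)// ltry.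
split => //; rewrite -lee_fin /EZ /Rintegral fineK//.
apply: integrable_fin_num => //.
by have := integrable_abse iF.
Qed.

Lemma dominated_integrable l A F : 0 <= l -> 0 <= A -> borel F ->
  dominated U l A F -> Pr.-integrable setT (fun om => (F (vecZ Z om))%:E).
Proof.
by move=> l0 A0 bF FA; have [K _ /(_ A F A0 bF FA)[]] := dominated_bound l0.
Qed.

Lemma EZ_norm F : borel F -> Pr.-integrable setT (fun om => (F (vecZ Z om))%:E) ->
  `|EZ F| <= EZ (fun z => `|F z|).
Proof. by move=> bF iF; exact: le_normr_Rintegral. Qed.

Lemma EZ_EFin F : Pr.-integrable setT (fun om => (F (vecZ Z om))%:E) ->
  ((EZ F)%:E = \int[Pr]_om (F (vecZ Z om))%:E)%E.
Proof. by move=> iF; rewrite /EZ /Rintegral fineK//; exact: integrable_fin_num. Qed.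

(** The majorant need not be measurable, so the dominating function is the supremum of the absolute
    values of the sequence. *)
Lemma EZ_dominated_cvg l A (F_ : nat -> 'cV[R]_d -> R) F : 0 <= l -> 0 <= A ->
  (forall n, borel (F_ n)) -> (forall n, dominated U l A (F_ n)) ->
  (forall z, F_ n z @[n --> \oo] --> F z) ->
  EZ (F_ n) @[n --> \oo] --> EZ F.
Proof.
move=> l0 A0 bF FA cF; have bFl : borel F by exact: borel_cvg cF.
pose G z := sups (fun n => `|F_ n z|) 0.
have ubF z : has_ubound (range (fun n => `|F_ n z|)).
  by exists (A * majorant U l z) => _ [n _ <-]; exact: FA.
have FG n z : `|F_ n z| <= G z.
  by apply: ub_le_sup; [have [M HM] := ubF z; exists M => _ [k _ <-]; apply: HM; exists k|exists n].
have bG : borel G by apply: borel_sups => // n; exact: borel_norm.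
have dG : dominated U l A G.
  move=> z; rewrite ger0_norm ?(le_trans _ (FG 0%N z))//.
  apply: ge_sup; first by exists `|F_ 0%N z|, 0%N.
  by move=> _ [n _ <-]; exact: FA.
have iG := dominated_integrable l0 A0 bG dG.
have dF : dominated U l A F.
  move=> z; rewrite -(cvg_lim _ (cvg_norm (cF z)))//.
  apply: limr_le; first by apply/cvg_ex; eexists; exact: cvg_norm (cF z).
  by apply: nearW => n; exact: FA.
have iF := dominated_integrable l0 A0 bFl dF.
have mF_ n : measurable_fun setT (fun om => (F_ n (vecZ Z om))%:E).
  by apply/measurable_EFinP; exact: borel_vecZ.
have mF : measurable_fun setT (fun om => (F (vecZ Z om))%:E).
  by apply/measurable_EFinP; exact: borel_vecZ.
have cE : {ae Pr, forall om, setT om ->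
    (F_ n (vecZ Z om))%:E @[n --> \oo] --> (F (vecZ Z om))%:E}.
  by apply: aeW => om _; apply: cvg_EFin; [exact: nearW|exact: cF].
have dE : {ae Pr, forall om n, setT om ->
    (`|(F_ n (vecZ Z om))%:E| <= (G (vecZ Z om))%:E)%E}.
  by apply: aeW => om n _; rewrite lee_fin.
have [_ _] := dominated_convergence measurableT mF_ mF cE iG dE.
rewrite -EZ_EFin// => /fine_cvg; apply: cvg_trans; apply: near_eq_cvg.
by apply: nearW => n.
Qed.

(** A reverse Fatou lemma: [G] is the upper limit of the absolute values, obtained as the decreasing
    limit of their tail suprema. *)
Lemma EZ_limsup l A (F_ : nat -> 'cV[R]_d -> R) : 0 <= l -> 0 <= A ->
  (forall n, borel (F_ n)) -> (forall n, dominated U l A (F_ n)) ->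
  exists G, [/\ borel G, dominated U l A G, forall z, 0 <= G z,
    forall z M, (\forall n \near \oo, `|F_ n z| <= M) -> G z <= M &
    forall e, 0 < e -> \forall n \near \oo, `|EZ (F_ n)| <= EZ G + e].
Proof.
move=> l0 A0 bF FA.
have ubF z : has_ubound (range (fun n => `|F_ n z|)).
  by exists (A * majorant U l z) => _ [n _ <-]; exact: FA.
pose S n z := sups (fun n => `|F_ n z|) n.
have FS n z : `|F_ n z| <= S n z.
  apply: ub_le_sup; last by exists n => //=.
  by have [M HM] := ubF z; exists M => _ [k _ <-]; apply: HM; exists k.
have bS n : borel (S n) by apply: borel_sups => // k; exact: borel_norm.
have S0 n z : 0 <= S n z by rewrite (le_trans _ (FS n z)).
have dS n : dominated U l A (S n).
  move=> z; rewrite ger0_norm//.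
  apply: ge_sup; first by exists `|F_ n z|, n => /=.
  by move=> _ [k _ <-]; exact: FA.
pose G z := limn (S ^~ z).
have cS z : S n z @[n --> \oo] --> G z.
  apply: nonincreasing_is_cvgn; first exact: nonincreasing_sups.
  by exists 0 => _ [n _ <-].
have bG : borel G by exact: borel_cvg cS.
have SG M z : (\forall n \near \oo, S n z <= M) -> G z <= M.
  by move=> H; apply: limr_le => //; exact: (cvgP _ (cS z)).
exists G; split => //.
- move=> z; rewrite ger0_norm; last first.
    by apply: limr_ge; [exact: (cvgP _ (cS z))|exact: nearW].
  by apply: SG; apply: nearW => n; have := dS n z; rewrite ger0_norm.
- by move=> z; apply: limr_ge; [exact: (cvgP _ (cS z))|exact: nearW].
- move=> z M [N _ HN]; apply: SG; exists N => // n /= Nn.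
  apply: ge_sup; first by exists `|F_ n z|, n => /=.
  by move=> _ [k /= nk <-]; apply: HN => /=; exact: leq_trans nk.
- move=> e e0; have := EZ_dominated_cvg l0 A0 bS dS cS.
  move=> /cvgrPdist_le/(_ e e0); apply: filterS => n.
  rewrite ler_distlC => /andP[_]; apply: le_trans.
  rewrite (le_trans (EZ_norm _ _))//; first exact: dominated_integrable (FA n).
  apply: le_Rintegral => //.
  + exact: integrable_abse (dominated_integrable l0 A0 (bF n) (FA n)).
  + exact: dominated_integrable (dS n).
Qed.

End ExpectationOfDominated.

Section SignedShift.
Context {R : realType} {disp : measure_display} {Omega : measurableType disp}.
Variables (Pr : probability Omega R) (d : nat) (Z : 'I_d -> {RV Pr >-> R}).
Hypothesis HZ : std_normal_vector Z.

Lemma EZ_shift (b : 'cV[R]_d) (F : 'cV[R]_d -> R) : borel F ->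
  EZ Z (fun z => F (z + b)) = EZ Z (fun z => F z * shift_density b z).
Proof.
move=> bF; rewrite /EZ /Rintegral; congr fine.
have b0 z : 0 <= shift_density b z by exact: expR_ge0.
have bM : borel (fun z => Num.max (F z) 0) /\ borel (fun z => Num.max (- F z) 0).
  split; move=> dd T V mV; apply: measurable_maxr => //; first exact: bF.
  by apply: measurableT_comp => //; exact: bF.
rewrite integralE [RHS]integralE; congr (_ - _)%E.
  rewrite -[LHS](_ : (\int[Pr]_om (Num.max (F (vecZ Z om + b)) 0)%:E)%E = _); last first.
    by apply: eq_integral => om _; rewrite funeposE EFin_max.
  rewrite (shift_vec HZ b bM.1); last by move=> z; rewrite le_max lexx orbT.
  by apply: eq_integral => om _; rewrite funeposE -EFin_max maxr_pMl// mul0r.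
rewrite -[LHS](_ : (\int[Pr]_om (Num.max (- F (vecZ Z om + b)) 0)%:E)%E = _); last first.
  by apply: eq_integral => om _; rewrite funenegE EFin_max.
rewrite (shift_vec HZ b bM.2); last by move=> z; rewrite le_max lexx orbT.
by apply: eq_integral => om _; rewrite funenegE -EFinN -EFin_max maxr_pMl// mul0r mulNr.
Qed.

End SignedShift.

(** * Integrals of functions that need not be measurable *)

Section LowerIntegral.
Context {R : realType} {disp : measure_display} {T : measurableType disp}.
Variable mu : {measure set T -> \bar R}.
Local Open Scope ereal_scope.

(** The integral of a non-negative function is a supremum over the simple functions below it, hence
    monotone without any measurability. *)
Lemma le_lower_integral (f g : T -> \bar R) : (forall x, 0 <= f x) ->
  (forall x, f x <= g x) -> \int[mu]_x f x <= \int[mu]_x g x.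
Proof.
move=> f0 fg; have g0 x : 0 <= g x by exact: le_trans (fg x).
rewrite !ge0_integralTE//; apply: ereal_sup_le => _ [h hf <-].
by exists h => // x; exact: le_trans (fg x).
Qed.

(* [u] is not assumed measurable, so its integral is a lower integral. *)
Lemma le_integral_affine (f m u : T -> R) (c : R) :
  measurable_fun setT f -> measurable_fun setT m ->
  (forall x, 0 <= f x)%R -> (forall x, 0 <= m x)%R -> (forall x, 0 <= u x)%R ->
  (0 <= c)%R -> (forall x, f x <= m x + c * u x)%R ->
  \int[mu]_x (f x)%:E <= \int[mu]_x (m x)%:E + c%:E * \int[mu]_x (u x)%:E.
Proof.
move=> mf mm f0 m0 u0 c0 fmu.
have [c00|cn0] := eqVneq c 0%R.
  rewrite c00 mul0e adde0; apply: le_lower_integral => x; rewrite lee_fin//.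
  by rewrite (le_trans (fmu x))// c00 mul0r addr0.
have {cn0}c0 : (0 < c)%R by rewrite lt_neqAle eq_sym cn0.
(* A measurable function below [u], large enough for [f <= m + c * g], which is integrated in its
   place. *)
pose g x := (c^-1 * Num.max (f x - m x) 0)%R.
have g0 x : (0 <= g x)%R by rewrite mulr_ge0// ?invr_ge0 ?(ltW c0)// le_max lexx orbT.
have mg : measurable_fun setT (EFin \o g).
  apply/measurable_EFinP; apply: measurable_funM => //; apply: measurable_maxr => //.
  exact: measurable_funB.
apply: (@le_trans _ _ (\int[mu]_x ((m x)%:E + c%:E * (g x)%:E))).
  apply: le_lower_integral => x; rewrite lee_fin// /g mulVKf ?gt_eqF//.
  by rewrite -lerBlDl le_max lexx.
have mm' : measurable_fun setT (fun x => (m x)%:E) by exact/measurable_EFinP.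
have mcg : measurable_fun setT (fun x => c%:E * (g x)%:E).
  exact: measurable_funeM mg.
have cg0 x : 0 <= c%:E * (g x)%:E by rewrite mule_ge0// lee_fin ?(ltW c0).
have m0' x : 0 <= (m x)%:E by rewrite lee_fin.
rewrite (ge0_integralD _ _ (fun x _ => m0' x) mm' (fun x _ => cg0 x) mcg)//.
rewrite leeD2l// ge0_integralZl//; last 2 first.
- by move=> x _; rewrite lee_fin.
- by rewrite lee_fin ltW.
rewrite lee_wpmul2l ?lee_fin ?(ltW c0)//; apply: le_lower_integral => x; rewrite lee_fin//.
rewrite /g mulrC ler_pdivrMr// ge_max mulr_ge0 ?(ltW c0)// andbT.
by rewrite lerBlDl mulrC.
Qed.

End LowerIntegral.

(** * Growth envelopes *)

Section GrowthEnvelope.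
Context {R : realType} {d : nat}.
Variables (S : 'M[R]_d) (alpha : R) (P1 P2 : 'cV[R]_d -> R).
Variables (beta gamma delta : nat -> R).

Definition growth_class : Prop :=
  [/\ 0 <= alpha,
      forall w, 0 <= P1 w /\ 0 <= P2 w,
      forall w (a : R), 1 < a -> P1 w <= P1 (a *: w) /\ P2 w <= P2 (a *: w) &
      forall k, (0 < k)%N ->
        [/\ 0 <= beta k, 0 <= gamma k, 0 <= delta k,
            forall w : 'I_k -> 'cV[R]_d,
              P1 (\sum_(j < k) w j) <= beta k * \sum_(j < k) P1 (w j) &
            forall w : 'I_k -> 'cV[R]_d,
              P2 (\sum_(j < k) w j) <= gamma k * \prod_(j < k) P2 (delta k *: w j)]].

Hypothesis PG : growth_class.
Implicit Types (u w x y z : 'cV[R]_d) (l r c : R).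

Let P w := alpha + P1 w + P2 w.

Let alpha0 : 0 <= alpha. Proof. by case: PG. Qed.
Let P_ge0 w : 0 <= P1 w /\ 0 <= P2 w. Proof. by case: PG. Qed.
Let P_radial w (a : R) : 1 < a -> P1 w <= P1 (a *: w) /\ P2 w <= P2 (a *: w).
Proof. by case: PG => _ _ + _; exact. Qed.

Let P_sub k : (0 < k)%N ->
  [/\ 0 <= beta k, 0 <= gamma k, 0 <= delta k,
      forall w : 'I_k -> 'cV[R]_d,
        P1 (\sum_(j < k) w j) <= beta k * \sum_(j < k) P1 (w j) &
      forall w : 'I_k -> 'cV[R]_d,
        P2 (\sum_(j < k) w j) <= gamma k * \prod_(j < k) P2 (delta k *: w j)].
Proof. by case: PG => _ _ _; exact. Qed.

Let P1_ge0 w : 0 <= P1 w. Proof. by have [] := P_ge0 w. Qed.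
Let P2_ge0 w : 0 <= P2 w. Proof. by have [] := P_ge0 w. Qed.

Lemma envelope_sub2 x y :
  P1 (x + y) <= beta 2%N * (P1 x + P1 y) /\
  P2 (x + y) <= gamma 2%N * (P2 (delta 2%N *: x) * P2 (delta 2%N *: y)).
Proof.
have [_ _ _ h1 h2] := @P_sub 2 isT.
have := h1 (fun j => if j == 0 then x else y).
have := h2 (fun j => if j == 0 then x else y).
by rewrite !big_ord_recl !big_ord0 /= !addr0 mulr1.
Qed.

(** Monotonicity is applied with the factor [c^-1]. The value [c = 0] is excluded, as condition (i)
    does not compare the value at 0 with any other. *)
Lemma envelope_contract c x : 0 < c <= 1 -> P1 (c *: x) <= P1 x /\ P2 (c *: x) <= P2 x.
Proof.
move=> /andP[c0]; rewrite le_eqVlt => /orP[/eqP ->|c1]; first by rewrite scale1r.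
have ci : 1 < c^-1 by rewrite invf_gt1.
have := P_radial (c *: x) ci; rewrite scalerA mulVf ?scale1r//.
by rewrite gt_eqF.
Qed.

(* Only multiples of the basis vectors matter, and along each axis radial
   monotonicity bounds the functions by finitely many values. *)
Lemma envelope_locally_bounded : locally_bounded P1 /\ locally_bounded P2.
Proof.
have [d0|dgt0] := posnP d.
  have E u : u = 0 by apply/matrixP => i; have := ltn_ord i; rewrite {2}d0.
  by split => r; [exists (P1 0) => // u _; rewrite (E u)|exists (P2 0) => // u _; rewrite (E u)].
have [b0 g0 dl0 h1 h2] := P_sub dgt0.
pose e i : 'cV[R]_d := delta_mx i 0.
have axis (Q : 'cV[R]_d -> R) r i : (forall w, 0 <= Q w) ->
    (forall w (a : R), 1 < a -> Q w <= Q (a *: w)) -> 0 <= r ->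
    forall t, `|t| <= r -> Q (t *: e i) <= Q 0 + Q ((r + 1) *: e i) + Q (- (r + 1) *: e i).
  move=> Q0 Qr r0 t tr; have [t0|t0|->] := ltgtP t 0.
  - have a1 : 1 < - (r + 1) / t.
      rewrite -[- _ / t]mulrNN -invrN ltr_pdivlMr ?oppr_gt0// mul1r.
      by rewrite opprK; move: tr; rewrite ltr0_norm//; lra.
    have := Qr (t *: e i) _ a1; rewrite scalerA divfK ?lt_eqF//.
    by have := Q0 0; have := Q0 ((r + 1) *: e i); lra.
  - have a1 : 1 < (r + 1) / t.
      by rewrite ltr_pdivlMr// mul1r; move: tr; rewrite gtr0_norm//; lra.
    have := Qr (t *: e i) _ a1; rewrite scalerA divfK ?gt_eqF//.
    by have := Q0 0; have := Q0 (- (r + 1) *: e i); lra.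
  - by rewrite scale0r -addrA lerDl addr_ge0.
have usum u : u = \sum_(i < d) u i 0 *: e i.
  apply/matrixP => j k; rewrite summxE (bigD1 j)//= !mxE (ord1 k) !eqxx mulr1.
  by rewrite big1 ?addr0// => i ij; rewrite !mxE eq_sym (negbTE ij) mulr0.
split => r.
- pose r' := `|r|; pose M i := P1 0 + P1 ((r' + 1) *: e i) + P1 (- (r' + 1) *: e i).
  exists (beta d * \sum_(i < d) M i).
    by rewrite mulr_ge0// sumr_ge0// => i _; rewrite !addr_ge0.
  move=> u ur; rewrite {1}(usum u) (le_trans (h1 _))// ler_wpM2l//.
  apply: ler_sum => i _; apply: axis => //.
  - by move=> w a a1; have [] := P_radial w a1.
  - exact: normr_ge0.
  by rewrite (le_trans (norm1_coord _ _))// (le_trans ur)// ler_norm.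
- pose r' := `|delta d * r|.
  pose M i := P2 0 + P2 ((r' + 1) *: e i) + P2 (- (r' + 1) *: e i).
  exists (gamma d * \prod_(i < d) M i).
    by rewrite mulr_ge0// prodr_ge0// => i _; rewrite !addr_ge0.
  move=> u ur; rewrite {1}(usum u) (le_trans (h2 _))// ler_wpM2l//.
  apply: ler_prod => i _; rewrite P2_ge0/= scalerA; apply: axis => //.
  - by move=> w a a1; have [] := P_radial w a1.
  - exact: normr_ge0.
  rewrite /r' !normrM ler_wpM2l//.
  rewrite (le_trans (norm1_coord _ _))// (le_trans ur)//.
  exact: ler_norm.
Qed.

Lemma locally_bounded_envelope : locally_bounded P.
Proof.
move=> r; have [B1 B2] := envelope_locally_bounded.
have [M1 M10 H1] := B1 r; have [M2 M20 H2] := B2 r.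
exists (alpha + M1 + M2) => [|q qr]; first by rewrite !addr_ge0.
by rewrite /P !lerD ?H1 ?H2.
Qed.

(** Condition (ii) with [k = 2] separates [c *: z] from [u]; the first is contracted to [z], the
    second stays in a ball where the functions are bounded. *)
Lemma envelope_translate_bound l : 0 <= l -> exists2 A : R, 0 <= A &
  forall z c u, 0 <= c <= 1 -> norm1 u <= l ->
    1 + P (c *: z + u) <= A * (1 + P1 z + P2 (delta 2%N *: z)).
Proof.
move=> l0; have [B1 B2] := envelope_locally_bounded.
have [M1 M10 H1] := B1 l; have [M2 M20 H2] := B2 l.
have [M3 M30 H3] := B2 (delta 2%N * l).
have [b0 g0 dl0 _ _] := @P_sub 2 isT.
exists (1 + alpha + beta 2%N * (1 + M1) + M1 + M2 + gamma 2%N * M3).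
  by rewrite !addr_ge0// mulr_ge0// addr_ge0.
move=> z c u /andP[c0 c1] ul.
set Q := 1 + P1 z + P2 (delta 2%N *: z).
have Q1 : 1 <= Q by rewrite /Q -addrA lerDl addr_ge0.
have QP1 : P1 z <= Q by have := P2_ge0 (delta 2%N *: z); rewrite /Q; lra.
have QP2 : P2 (delta 2%N *: z) <= Q by have := P1_ge0 z; rewrite /Q; lra.
have le1 : P1 (c *: z + u) <= (beta 2%N * (1 + M1) + M1) * Q.
  (* Contraction says nothing for [c = 0], but then only the bounded part [u] is left. *)
  move: c0; rewrite le_eqVlt => /orP[/eqP <-|c0].
    rewrite scale0r add0r (le_trans (H1 u ul))// mulrDl ler_wpDl//.
      by rewrite !mulr_ge0 ?addr_ge0// (le_trans _ Q1).
    by rewrite ler_peMr.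
  have [h _] := envelope_sub2 (c *: z) u; rewrite (le_trans h)//.
  have [|h1 _] := @envelope_contract c z; first by rewrite c0.
  rewrite mulrDl ler_wpDr//; first by rewrite mulr_ge0// (le_trans _ Q1).
  rewrite -mulrA ler_wpM2l// mulrDl mul1r lerD//; first exact: le_trans QP1.
  by rewrite (le_trans (H1 u ul))// ler_peMr.
have le2 : P2 (c *: z + u) <= (M2 + gamma 2%N * M3) * Q.
  move: c0; rewrite le_eqVlt => /orP[/eqP <-|c0].
    rewrite scale0r add0r (le_trans (H2 u ul))// mulrDl ler_wpDr//.
      by rewrite !mulr_ge0// (le_trans _ Q1).
    by rewrite ler_peMr.
  have [_ h] := envelope_sub2 (c *: z) u; rewrite (le_trans h)//.
  have [|_ h1] := @envelope_contract c (delta 2%N *: z); first by rewrite c0.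
  rewrite mulrDl ler_wpDl//; first by rewrite mulr_ge0// (le_trans _ Q1).
  rewrite -mulrA ler_wpM2l// [leRHS]mulrC ler_pM//.
    by rewrite scalerA mulrC -scalerA (le_trans h1).
  by apply: H3; rewrite norm1Z ger0_norm// ler_wpM2l.
rewrite /P; have : (1 + alpha) <= (1 + alpha) * Q by rewrite ler_peMr// addr_ge0.
move: le1 le2; rewrite !mulrDl; lra.
Qed.

(** The supremum over contractions and translates is taken so that translating [z] merely enlarges
    [l], which is what shifting the Gaussian vector requires. Measurability in [z] is given up. *)
Definition envelope l z : R := sup [set y | exists c u,
  [/\ 0 <= c <= 1, norm1 u <= l & y = 1 + P (c *: (S *m z) + u)]].

Lemma envelope_has_sup l z : 0 <= l -> has_sup [set y | exists c u,
  [/\ 0 <= c <= 1, norm1 u <= l & y = 1 + P (c *: (S *m z) + u)]].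
Proof.
move=> l0; have [A _ HA] := envelope_translate_bound l0; split.
  by exists (1 + P (0 *: (S *m z) + 0)), 0, 0; split; rewrite ?lexx ?ler01 ?norm10.
exists (A * (1 + P1 (S *m z) + P2 (delta 2%N *: (S *m z)))).
by move=> _ [c [u [c01 ul ->]]]; exact: HA.
Qed.

Lemma le_envelope l z c u : 0 <= c <= 1 -> norm1 u <= l ->
  1 + P (c *: (S *m z) + u) <= envelope l z.
Proof.
move=> c01 ul; have l0 : 0 <= l by rewrite (le_trans _ ul)// norm1_ge0.
have [_ ub] := envelope_has_sup z l0.
by apply: (ub_le_sup ub); exists c, u.
Qed.

Lemma envelope_le l z M : 0 <= l -> (forall c u, 0 <= c <= 1 -> norm1 u <= l ->
  1 + P (c *: (S *m z) + u) <= M) -> envelope l z <= M.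
Proof.
move=> l0 H; apply: ge_sup; first by have [] := envelope_has_sup z l0.
by move=> _ [c [u [c01 ul ->]]]; exact: H.
Qed.

Lemma envelope_ge1 l z : 0 <= l -> 1 <= envelope l z.
Proof.
move=> l0; have := @le_envelope l z 0 0; rewrite lexx ler01 norm10 => /(_ isT l0).
apply: le_trans; rewrite lerDl /P; have [? ?] := P_ge0 (0 *: (S *m z) + 0).
by rewrite !addr_ge0.
Qed.

Lemma envelope_mono l m z : 0 <= l <= m -> envelope l z <= envelope m z.
Proof.
move=> /andP[l0 lm]; apply: envelope_le => // c u c01 ul.
by apply: le_envelope => //; exact: le_trans lm.
Qed.

Lemma envelope_shift : exists2 kap : R, 0 <= kap & forall l z b, 0 <= l ->
  envelope l (z + b) <= envelope (l + kap * norm1 b) z.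
Proof.
have [kap kap0 Hk] := norm1_mulmx S; exists kap => // l z b l0.
apply: envelope_le => // c u /andP[c0 c1] ul.
rewrite mulmxDr scalerDr -addrA; apply: le_envelope; first by rewrite c0.
rewrite addrC (le_trans (norm1D _ _))// lerD// norm1Z ger0_norm//.
by rewrite (le_trans _ (Hk b))// ler_piMl// norm1_ge0.
Qed.

Lemma envelope_bound l : 0 <= l -> exists2 A : R, 0 <= A & forall z,
  envelope l z <= A * (1 + P1 (S *m z) + P2 (delta 2%N *: (S *m z))).
Proof.
move=> l0; have [A A0 HA] := envelope_translate_bound l0; exists A => // z.
by apply: envelope_le => // c u c01 ul; exact: HA.
Qed.

End GrowthEnvelope.

(** * Integrability of the envelope *)

Section FiniteEnvelopeIntegral.
Context {R : realType} {disp : measure_display} {Omega : measurableType disp}.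
Variables (Pr : probability Omega R) (d : nat) (Z : 'I_d -> {RV Pr >-> R}).
Hypothesis HZ : std_normal_vector Z.
Variables (S : 'M[R]_d) (P1 P2 : 'cV[R]_d -> R) (d2 : R).
Hypothesis P1_ge0 : forall w, 0 <= P1 w.
Hypothesis P2_ge0 : forall w, 0 <= P2 w.
Hypothesis iP1 : Pr.-integrable setT (fun om => (P1 (S *m vecZ Z om))%:E).
Variable U : R -> 'cV[R]_d -> R.
Hypothesis U_bound : forall l, 0 <= l -> exists2 A : R, 0 <= A & forall z,
  U l z <= A * (1 + P1 (S *m z) + P2 (d2 *: (S *m z))).
Implicit Types (F : 'cV[R]_d -> R) (z : 'cV[R]_d) (l : R).

Let finite_bound (A : R) (u : Omega -> R) : 0 <= A -> (forall om, 0 <= u om) ->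
  (\int[Pr]_om (u om)%:E < +oo)%E ->
  exists2 K : R, 0 <= K & forall F, borel F -> (forall z, 0 <= F z) ->
    (forall om, F (vecZ Z om) <= A * (1 + P1 (S *m vecZ Z om)) + A * u om) ->
    (\int[Pr]_om (F (vecZ Z om))%:E <= K%:E)%E.
Proof.
move=> A0 u0 fu; pose m om := A * (1 + P1 (S *m vecZ Z om)).
have mP1 : measurable_fun setT (fun om => P1 (S *m vecZ Z om)).
  by apply/measurable_EFinP; exact: measurable_int iP1.
have mm : measurable_fun setT m by apply: measurable_funM => //; exact: measurable_funD.
have m0 om : 0 <= m om by rewrite mulr_ge0// addr_ge0.
have im : (\int[Pr]_om (m om)%:E < +oo)%E.
  have : Pr.-integrable setT (fun om => (m om)%:E).
    have := integrableZl measurableT A (integrableD measurableT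
      (finite_measure_integrable_cst Pr 1 measurableT) iP1).
    by apply: eq_integrable => // om _; rewrite /m EFinM EFinD.
  move=> /integrableP[_]; apply: le_lt_trans; apply: le_lower_integral => om.
    by rewrite lee_fin.
  by rewrite lee_fin ler_norm.
pose K := (\int[Pr]_om (m om)%:E + A%:E * \int[Pr]_om (u om)%:E)%E.
have K0 : (0 <= K)%E.
  rewrite adde_ge0//; first by apply: integral_ge0 => om _; rewrite lee_fin.
  by rewrite mule_ge0// ?lee_fin//; apply: integral_ge0 => om _; rewrite lee_fin.
have Kfin : K \is a fin_num.
  rewrite ge0_fin_numE// lte_add_pinfty// muleC.
  have : (\int[Pr]_om (u om)%:E)%E \is a fin_num.
    by rewrite ge0_fin_numE//; apply: integral_ge0 => om _; rewrite lee_fin.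
  by move=> /fineK <-; rewrite -EFinM ltry.
exists (fine K); first by rewrite fine_ge0.
move=> F bF F0 FA; rewrite fineK//; apply: le_integral_affine => //.
exact: borel_vecZ.
Qed.

Lemma envelope_integral_case1 : (\int[Pr]_om (P2 (d2 *: (S *m vecZ Z om)))%:E < +oo)%E ->
  forall l, 0 <= l -> exists2 K : R, 0 <= K &
  forall F, borel F -> (forall z, 0 <= F z <= U l z) ->
    (\int[Pr]_om (F (vecZ Z om))%:E <= K%:E)%E.
Proof.
move=> fP2 l l0; have [A A0 HA] := U_bound l0.
have [K K0 HK] := finite_bound A0 (fun om => P2_ge0 (d2 *: (S *m vecZ Z om))) fP2.
exists K => // F bF FU; apply: HK => // [z|om]; first by have /andP[] := FU z.
by have /andP[_] := FU (vecZ Z om); have := HA (vecZ Z om); rewrite mulrDr; lra.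
Qed.

Variable kap : R.
Hypothesis kap0 : 0 <= kap.
Hypothesis U_shift : forall l z b, 0 <= l -> U l (z + b) <= U (l + kap * norm1 b) z.

(* Where [|dotv b Z| >= 1] the weight only helps.  The strip [|dotv b Z| < 1] is
   moved off itself by a translation whose density is bounded on the strip. *)
Lemma envelope_integral_case2 (b : 'cV[R]_d) : 0 < dotv b b ->
  (\int[Pr]_om (`|dotv b (vecZ Z om) * P2 (d2 *: (S *m vecZ Z om))|)%:E < +oo)%E ->
  forall l, 0 <= l -> exists2 K : R, 0 <= K &
  forall F, borel F -> (forall z, 0 <= F z <= U l z) ->
    (\int[Pr]_om (F (vecZ Z om))%:E <= K%:E)%E.
Proof.
move=> bb0 fP2.
have off l : 0 <= l -> exists2 K : R, 0 <= K &
  forall F, borel F -> (forall z, 0 <= F z <= U l z) ->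
    (forall z, `|dotv b z| < 1 -> F z = 0) ->
    (\int[Pr]_om (F (vecZ Z om))%:E <= K%:E)%E.
  move=> l0; have [A A0 HA] := U_bound l0.
  have [K K0 HK] := finite_bound A0 (fun om => normr_ge0 _) fP2.
  exists K => // F bF FU F0; apply: HK => // [z|om]; first by have /andP[] := FU z.
  set z := vecZ Z om.
  have [/F0 ->|b1] := ltP `|dotv b z| 1.
    by rewrite addr_ge0// mulr_ge0// addr_ge0.
  have /andP[_] := FU z => /le_trans; apply; rewrite (le_trans (HA z))//.
  rewrite -mulrDr ler_wpM2l// lerD2l normrM (ger0_norm (P2_ge0 _)).
  by rewrite ler_peMl.
move=> l l0; have [K1 K10 HK1] := off l l0.
(* Translation by [tau] raises [dotv b] by 2, which carries the strip off itself. *)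
pose tau := (2 / dotv b b) *: b.
have btau : dotv b tau = 2 by rewrite dotvZ divfK// gt_eqF.
have l'0 : 0 <= l + kap * norm1 tau by rewrite addr_ge0// mulr_ge0// norm1_ge0.
have [K2 K20 HK2] := off _ l'0.
(* [C] bounds the compensating factor [expR (dotv tau tau / 2 - dotv tau z)], since [dotv tau z] is
   at least [- (2 / dotv b b)] on the strip. *)
pose C := expR (2 / dotv b b + dotv tau tau / 2).
exists (K1 + C * K2); first by rewrite addr_ge0// mulr_ge0// expR_ge0.
move=> F bF FU; pose strip z : R := \1_(`]-1, 1[%classic) (dotv b z).
have stripE z : strip z = (`|dotv b z| < 1)%R%:R.
  by rewrite /strip indicE mem_setE in_itv/= ltr_norml.
have F0 z : 0 <= F z by have /andP[] := FU z.
have bstrip : borel strip.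
  apply: (borel_comp1 (f := \1_(`]-1, 1[%classic))) (borel_dotv b).
  exact: measurable_indic.
have strip0 z : 0 <= strip z by rewrite stripE.
have strip1 z : strip z <= 1 by rewrite stripE; case: (_ < _).
pose F1 z := F z * (1 - strip z); pose F2 z := F z * strip z.
have bF1 : borel F1 by apply: borelM => //; apply: borelB => //; exact: borel_cst.
have bF2 : borel F2 by exact: borelM.
have -> : (\int[Pr]_om (F (vecZ Z om))%:E =
   \int[Pr]_om (F1 (vecZ Z om))%:E + \int[Pr]_om (F2 (vecZ Z om))%:E)%E.
  rewrite -ge0_integralD//.
  - by apply: eq_integral => om _; rewrite -EFinD /F1 /F2 -mulrDr subrK mulr1.
  - by move=> om _; rewrite lee_fin mulr_ge0// subr_ge0.
  - by apply/measurable_EFinP; exact: borel_vecZ.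
  - by move=> om _; rewrite lee_fin mulr_ge0.
  - by apply/measurable_EFinP; exact: borel_vecZ.
rewrite EFinD leeD//.
  apply: HK1 => // z; first rewrite /F1.
    have /andP[h1 h2] := FU z; rewrite mulr_ge0 ?subr_ge0//= (le_trans _ h2)//.
    by rewrite ler_piMr// lerBlDr lerDl.
  by rewrite /F1 stripE => ->; rewrite subrr mulr0.
(* [G] undoes the density of the translation, which turns the integral of [F2] into that of a
   function vanishing on the strip. *)
pose G z := F2 z * expR (dotv tau tau / 2 - dotv tau z).
have bG : borel G.
  apply: borelM => //; apply: borel_expR; apply: borelB; first exact: borel_cst.
  exact: borel_dotv.
have G0 z : 0 <= G z by rewrite !mulr_ge0// expR_ge0.
have -> : (\int[Pr]_om (F2 (vecZ Z om))%:E =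
    \int[Pr]_om (G (vecZ Z om + tau))%:E)%E.
  rewrite (shift_vec HZ tau bG G0); apply: eq_integral => om _.
  congr (_%:E); rewrite /G /shift_density -mulrA -expRD.
  by rewrite addrA subrK subrr expR0 mulr1.
have bF2t : borel (fun z => F2 (z + tau)) by exact: borel_translate.
apply: (@le_trans _ _ (\int[Pr]_om (C%:E * (F2 (vecZ Z om + tau))%:E))%E).
  apply: le_lower_integral => om; first by rewrite lee_fin.
  rewrite -EFinM lee_fin /G /F2 stripE; set z := vecZ Z om + tau.
  have [bz|_] := ltP `|dotv b z| 1; last by rewrite !mulr0 mul0r.
  rewrite mulr1 mulrC ler_wpM2r// ler_expR addrC lerD2r.
  rewrite -[leRHS]mulr1 [dotv tau z]dotvC dotvZ dotvC -mulrN.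
  rewrite ler_wpM2l ?divr_ge0 ?(ltW bb0)//.
  by rewrite (le_trans (ler_norm _))// normrN ltW.
rewrite ge0_integralZl ?lee_fin ?expR_ge0//; last 2 first.
- by apply/measurable_EFinP; exact: (borel_vecZ Z bF2t).
- by move=> om _; rewrite lee_fin mulr_ge0.
rewrite EFinM lee_wpmul2l ?lee_fin ?expR_ge0//; apply: (HK2 (fun z => F2 (z + tau))) => //.
  move=> z; rewrite mulr_ge0//=; have /andP[_ h] := FU (z + tau).
  rewrite (le_trans _ (U_shift _ _ l0))// (le_trans _ h)//.
  by rewrite ler_piMr.
move=> z bz; rewrite /F2 stripE dotvD btau.
rewrite (_ : (`|dotv b z + 2| < 1) = false) ?mulr0//; apply/negbTE.
rewrite -leNgt; move: bz; rewrite ltr_norml => /andP[h1 h2].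
by rewrite ger0_norm; lra.
Qed.

End FiniteEnvelopeIntegral.

(** * Weighted Gaussian means *)

Section TameFunctions.
Context {R : realType} {d : nat}.
Variables (S : 'M[R]_d) (P : 'cV[R]_d -> R) (U : R -> 'cV[R]_d -> R).
Hypothesis P_loc : locally_bounded P.
Hypothesis U1 : forall l z, 0 <= l -> 1 <= U l z.
Hypothesis PU : forall l z c u, 0 <= c <= 1 -> norm1 u <= l ->
  1 + P (c *: (S *m z) + u) <= U l z.
Implicit Types (psi : 'cV[R]_d -> R) (w x z : 'cV[R]_d) (a c l r t : R).

Let dir (i : 'I_d) : 'cV[R]_d := delta_mx i 0.

(* A Dini bound, because the derivatives of [h \o g] of order [n - 1] need not be
   differentiable: [h^(n-1)] is only Lipschitz. *)
Definition tame C psi := 0 <= C /\ axis_plip psi (fun x => C * (1 + P x)).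

Section Tame.
Variables (C : R) (psi : 'cV[R]_d -> R).
Hypothesis tpsi : tame C psi.

Let C0 : 0 <= C. Proof. by case: tpsi. Qed.

Lemma tame_continuous : norm1_continuous psi.
Proof.
case: tpsi => _ pp; apply: (axis_plip_continuous pp) => r.
have [M M0 HM] := P_loc r; exists (C * (1 + M)); first by rewrite mulr_ge0// addr_ge0.
by move=> q /HM qM; rewrite ler_wpM2l// lerD2l.
Qed.

Lemma borel_tame : borel psi.
Proof. exact/borel_continuous/tame_continuous. Qed.

Lemma borel_tame_affine a c w : borel (fun z => psi (a *: w + c *: (S *m z))).
Proof. by apply: borel_affine; exact: borel_tame. Qed.

(** A point near the segment between the two arguments is [c'' *: (S *m z) + u] with [c''] between
    [c] and [c']; the extra 1 in [U (l + 1)] is the width of the neighbourhood. *)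
Lemma tame_segment l z a c a' c' w w' : 0 <= l ->
  norm1 (a *: w) <= l -> norm1 (a' *: w') <= l -> 0 <= c <= 1 -> 0 <= c' <= 1 ->
  `|psi (a' *: w' + c' *: (S *m z)) - psi (a *: w + c *: (S *m z))| <=
  C * U (l + 1) z * norm1 ((a' *: w' - a *: w) + (c' - c) *: (S *m z)).
Proof.
move=> l0 wl w'l /andP[c0 c1] /andP[c'0 c'1].
have -> : a' *: w' - a *: w + (c' - c) *: (S *m z) =
    (a' *: w' + c' *: (S *m z)) - (a *: w + c *: (S *m z)).
  by rewrite scalerBl opprD addrACA.
case: tpsi => _ pp; apply: (segment_lipschitz pp) => t q /andP[t0 t1] qt.
set X := a *: w + c *: (S *m z) in qt *; set Y := a' *: w' + c' *: (S *m z) in qt *.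
rewrite ler_wpM2l//.
pose c'' := c + t * (c' - c).
pose u := a *: w + t *: (a' *: w' - a *: w) + (q - (X + t *: (Y - X))).
have -> : q = c'' *: (S *m z) + u.
  rewrite /u /X /Y /c''; apply/matrixP => i j; rewrite !mxE; ring.
apply: PU.
  rewrite /c''; apply/andP; split.
    have -> : c + t * (c' - c) = (1 - t) * c + t * c' by ring.
    by rewrite addr_ge0 ?mulr_ge0// subr_ge0.
  have -> : c + t * (c' - c) = (1 - t) * c + t * c' by ring.
  have : (1 - t) * c <= (1 - t) * 1 by rewrite ler_wpM2l// subr_ge0.
  have : t * c' <= t * 1 by rewrite ler_wpM2l.
  lra.
rewrite /u (le_trans (norm1D _ _))// lerD//.
have -> : a *: w + t *: (a' *: w' - a *: w) = (1 - t) *: (a *: w) + t *: (a' *: w').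
  by apply/matrixP => i j; rewrite !mxE; ring.
rewrite (le_trans (norm1D _ _))// !(norm1Z _ (_ *: _)).
rewrite (ger0_norm t0) ger0_norm ?subr_ge0//.
have : (1 - t) * norm1 (a *: w) <= (1 - t) * l by rewrite ler_wpM2l// subr_ge0.
have : t * norm1 (a' *: w') <= t * l by rewrite ler_wpM2l.
lra.
Qed.

Let U0 l z : 0 <= l -> 0 <= U l z.
Proof. by move=> l0; rewrite (le_trans _ (U1 z l0)). Qed.

(** Comparison with the value at 0: the length of the segment grows linearly in [norm1 z], which the
    exponential in the majorant absorbs. The pair [p] holds the constant and the index. *)
Lemma tame_growth r : 0 <= r -> exists p : R * R, [/\ 0 <= p.1, 0 <= p.2 &
  forall a c w, 0 <= a <= 1 -> 0 <= c <= 1 -> norm1 w <= r ->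
    dominated U p.2 p.1 (fun z => psi (a *: w + c *: (S *m z)))].
Proof.
move=> r0; have [kap kap0 Hk] := norm1_mulmx S.
exists (`|psi 0| + C * (r + kap), r + 1); split=> /=.
- by rewrite addr_ge0// mulr_ge0// addr_ge0.
- by rewrite addr_ge0.
move=> a c w /andP[a0 a1] c01 wr z.
have awr : norm1 (a *: w) <= r.
  by rewrite norm1Z ger0_norm// (le_trans _ wr)// ler_piMl// norm1_ge0.
have := @tame_segment r z 0 0 a c 0 w r0.
rewrite norm1Z normr0 mul0r lexx ler01 !scale0r !subr0 !addr0 => /(_ r0 awr isT c01) h.
have n0 := norm1_ge0 z.
have e1 : 1 <= expR (norm1 z) by rewrite -expR0 ler_expR.
have en : norm1 z <= expR (norm1 z) by rewrite (le_trans _ (expR_ge1Dx _))// lerDr.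
have eM : expR (norm1 z) * U (r + 1) z <= majorant U (r + 1) z.
  rewrite /majorant ler_wpM2r ?U0 ?addr_ge0// ler_expR.
  by rewrite ler_peMl// lerDr.
have M1 : 1 <= majorant U (r + 1) z by apply: majorant_ge1 => //; rewrite addr_ge0.
rewrite -[psi _](subrK (psi 0)) (le_trans (ler_normD _ _))// addrC mulrDl lerD//.
  by rewrite ler_peMr.
rewrite (le_trans h)// -!mulrA ler_wpM2l// [leRHS]mulrC.
apply: (@le_trans _ _ (U (r + 1) z * (expR (norm1 z) * (r + kap)))); last first.
  by rewrite mulrA [X in X * _]mulrC ler_wpM2r// addr_ge0.
rewrite ler_wpM2l ?U0 ?addr_ge0// (le_trans (norm1D _ _))// mulrDr lerD//.
  by rewrite (le_trans awr)// ler_peMl.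
have /andP[c0 c1] := c01.
rewrite norm1Z ger0_norm// (le_trans (ler_piMl (norm1_ge0 _) c1))//.
by rewrite (le_trans (Hk z))// mulrC ler_wpM2r.
Qed.

Lemma tame_lipschitz i r : 0 <= r -> exists p : R * R, [/\ 0 <= p.1, 0 <= p.2 &
  forall a c w t, 0 <= a <= 1 -> 0 <= c <= 1 -> norm1 w <= r -> `|t| <= 1 ->
    dominated U p.2 (a * `|t| * p.1) (fun z =>
      psi (a *: (w + t *: dir i) + c *: (S *m z)) - psi (a *: w + c *: (S *m z)))].
Proof.
move=> r0; exists (C, r + 1 + 1); split => //=; first by rewrite !addr_ge0.
move=> a c w t /andP[a0 a1] c01 wr t1 z.
have wtr : norm1 (w + t *: dir i) <= r + 1.
  by rewrite (le_trans (norm1D _ _))// lerD// norm1Z norm1_delta mulr1.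
have contr (v : 'cV[R]_d) : norm1 v <= r + 1 -> norm1 (a *: v) <= r + 1.
  by move=> vr; rewrite norm1Z ger0_norm// (le_trans _ vr)// ler_piMl// norm1_ge0.
have r10 : 0 <= r + 1 by rewrite addr_ge0.
have wr1 : norm1 w <= r + 1 by lra.
have := @tame_segment (r + 1) z a c a c w (w + t *: dir i) r10 (contr _ wr1) (contr _ wtr) c01 c01.
rewrite subrr scale0r addr0 -scalerBr [w + _]addrC addrK !norm1Z norm1_delta mulr1.
rewrite (ger0_norm a0) [in _ *: _ + w]addrC => /le_trans; apply.
rewrite [leRHS](_ : _ = C * majorant U (r + 1 + 1) z * (a * `|t|)); last by ring.
rewrite ler_wpM2r ?mulr_ge0// ler_wpM2l// /majorant ler_peMl ?U0 ?addr_ge0//.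
by rewrite -expR0 ler_expR mulr_ge0 ?norm1_ge0 ?addr_ge0.
Qed.

(* The right end [c = 1], [a = 0] is the limit [s -> +oo] of the Mehler path. *)
Lemma tame_endpoint r : 0 <= r -> exists p : R * R, [/\ 0 <= p.1, 0 <= p.2 &
  forall a c w, 0 <= a <= 1 -> 0 <= c <= 1 -> 1 - c <= a -> norm1 w <= r ->
    dominated U p.2 (a * p.1) (fun z =>
      psi (a *: w + c *: (S *m z)) - psi (S *m z))].
Proof.
move=> r0; have [kap kap0 Hk] := norm1_mulmx S.
exists (C * (r + kap), r + 1); split=> /=.
- by rewrite mulr_ge0// addr_ge0.
- by rewrite addr_ge0.
move=> a c w /andP[a0 a1] c01 ca wr z; have /andP[c0 c1] := c01.
have awr : norm1 (a *: w) <= r.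
  by rewrite norm1Z ger0_norm// (le_trans _ wr)// ler_piMl// norm1_ge0.
have := @tame_segment r z 0 1 a c 0 w r0.
rewrite norm1Z normr0 mul0r lexx ler01 !scale0r scale1r !subr0 add0r => /(_ r0 awr isT c01) h.
have n0 := norm1_ge0 z.
have e1 : 1 <= expR (norm1 z) by rewrite -expR0 ler_expR.
have en : norm1 z <= expR (norm1 z) by rewrite (le_trans _ (expR_ge1Dx _))// lerDr.
have eM : expR (norm1 z) * U (r + 1) z <= majorant U (r + 1) z.
  rewrite /majorant ler_wpM2r ?U0 ?addr_ge0// ler_expR.
  by rewrite ler_peMl// lerDr.
rewrite (le_trans h)// [leRHS](_ : _ = C * (majorant U (r + 1) z * (a * (r + kap)))); last by ring.
rewrite -mulrA ler_wpM2l//.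
apply: (@le_trans _ _ (U (r + 1) z * (expR (norm1 z) * (a * (r + kap))))); last first.
  by rewrite mulrA [X in X * _]mulrC ler_wpM2r// mulr_ge0// addr_ge0.
rewrite ler_wpM2l ?U0 ?addr_ge0// (le_trans (norm1D _ _))//.
rewrite mulrCA mulrDr mulrDr lerD//.
  rewrite norm1Z ger0_norm// ler_wpM2l// (le_trans wr)// ler_peMl//.
rewrite norm1Z ler0_norm ?subr_le0// opprB ler_pM ?norm1_ge0 ?subr_ge0//.
by rewrite (le_trans (Hk z))// mulrC ler_wpM2r.
Qed.

End Tame.

End TameFunctions.

Section SequentialDerivative.
Context {R : realType} {d : nat}.
Implicit Types (F : 'cV[R]_d -> R) (w v : 'cV[R]_d).

(** Dominated convergence works along sequences, so derivatives are tested on them. Increments above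
    1 occur only finitely often in a null sequence and can be replaced. *)
Lemma seq_is_derive F w v D :
  (forall t_ : nat -> R, (forall n, t_ n != 0) -> (forall n, `|t_ n| <= 1) ->
     t_ n @[n --> \oo] --> 0 ->
     (t_ n)^-1 * (F (w + t_ n *: v) - F w) @[n --> \oo] --> D) ->
  is_derive w v F D.
Proof.
move=> H; have cD : h^-1 *: ((F \o shift w) (h *: v) - F w) @[h --> (0 : R)^'] --> D.
  apply/cvgr_dnbhsP => u [u0 cu].
  pose t_ n := if `|u n| <= 1 then u n else 1.
  have nt : \forall n \near \oo, t_ n = u n.
    have /cvgrPdist_le/(_ 1 ltr01) := cu; apply: filterS => n.
    by rewrite sub0r normrN /t_ => ->.
  have ct : t_ n @[n --> \oo] --> 0.
    by apply: cvg_trans cu; apply: near_eq_cvg; apply: filterS nt => n ->.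
  have t0 n : t_ n != 0 by rewrite /t_; case: ifP => // _; exact: oner_neq0.
  have t1 n : `|t_ n| <= 1 by rewrite /t_; case: ifP => // _; rewrite normr1.
  apply: cvg_trans (H t_ t0 t1 ct); apply: near_eq_cvg.
  by apply: filterS nt => n -> /=; rewrite (addrC w).
split; first by apply/cvg_ex; exists D.
exact: cvg_lim cD.
Qed.

Lemma is_derive_seq F w v D (t_ : nat -> R) : is_derive w v F D -> (forall n, t_ n != 0) ->
  t_ n @[n --> \oo] --> 0 ->
  (t_ n)^-1 * (F (w + t_ n *: v) - F w) @[n --> \oo] --> D.
Proof.
move=> [dF DF] t0 ct.
have cD : h^-1 *: ((F \o shift w) (h *: v) - F w) @[h --> (0 : R)^'] --> D.
  by rewrite -DF; exact: dF.
have /cvgr_dnbhsP/(_ t_ (conj t0 ct)) := cD; apply: cvg_trans; apply: near_eq_cvg.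
by apply: nearW => n /=; rewrite (addrC w).
Qed.

End SequentialDerivative.

Section ExpDifference.
Context {R : realType}.
Implicit Types x t : R.

Lemma norm_expR_sub1 x : `|expR x - 1| <= `|x| * expR `|x|.
Proof.
have [x0|x0] := leP 0 x.
  rewrite ger0_norm ?subr_ge0 -?expR0 ?ler_expR// expR0 ger0_norm//.
  have := expR_ge1Dx (- x); rewrite expRN => h.
  have e0 := expR_gt0 x.
  have : expR x * (1 - x) <= expR x * (expR x)^-1 by rewrite ler_wpM2l// ltW.
  by rewrite divff ?gt_eqF//; lra.
have e1 : expR x <= 1 by rewrite -expR0 ler_expR ltW.
rewrite ler0_norm ?subr_le0// (ltr0_norm x0).
have := expR_ge1Dx x; have : 1 <= expR (- x) by rewrite -expR0 ler_expR oppr_ge0 ltW.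
have : - x * 1 <= - x * expR (- x) -> - (expR x - 1) <= - x * expR (- x).
  have := expR_ge1Dx x; lra.
move=> h ex _; apply: h; rewrite ler_wpM2l// oppr_ge0 ltW//.
Qed.

(** A weight times a translation density, differentiated at 0 in the size [t] of the translation. *)
Lemma is_derive_tilt (al be ga de : R) :
  is_derive (0 : R) (1 : R) (fun t => (al - t * be) * expR (t * ga - t ^+ 2 * de))
    (al * ga - be).
Proof.
have d1 : is_derive (0 : R) (1 : R) (fun t : R => al - t * be) (- be).
  by apply: is_derive_eq; rewrite !scale0r /GRing.scale/=; ring.
have d2 : is_derive (0 : R) (1 : R) (fun t : R => t * ga - t ^+ 2 * de) ga.
  by apply: is_derive_eq; rewrite /GRing.scale/=; ring.
have d3 : is_derive (0 * ga - 0 ^+ 2 * de) (1 : R) (@expR R) 1.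
  by have := is_derive_expR (0 * ga - 0 ^+ 2 * de); rewrite mul0r expr0n mul0r subrr expR0.
have d4 := @is_derive1_comp _ (@expR R) (fun t : R => t * ga - t ^+ 2 * de) 0 1 ga d3 d2.
have d5 : is_derive (0 : R) (1 : R)
  ((fun t : R => al - t * be) * (expR \o (fun t : R => t * ga - t ^+ 2 * de))) (al * ga - be).
  apply: is_derive_eq; rewrite /GRing.scale/= !mul0r expr0n mul0r subrr expR0; ring.
exact: d5.
Qed.

End ExpDifference.

Definition integrable_envelope {R : realType} {disp : measure_display}
    {Omega : measurableType disp} {Pr : probability Omega R} {d : nat}
    (Z : 'I_d -> {RV Pr >-> R}) (S : 'M[R]_d) (P : 'cV[R]_d -> R)
    (U : R -> 'cV[R]_d -> R) : Prop :=
  [/\ locally_bounded P,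
      forall l z, 0 <= l -> 1 <= U l z,
      forall l m z, 0 <= l <= m -> U l z <= U m z,
      forall l z c u, 0 <= c <= 1 -> norm1 u <= l -> 1 + P (c *: (S *m z) + u) <= U l z &
      forall l, 0 <= l -> exists2 K : R, 0 <= K &
        forall F, borel F -> (forall z, 0 <= F z <= majorant U l z) ->
          (\int[Pr]_om (F (vecZ Z om))%:E <= K%:E)%E].

Section WeightedMean.
Context {R : realType} {disp : measure_display} {Omega : measurableType disp}.
Variables (Pr : probability Omega R) (d : nat) (Z : 'I_d -> {RV Pr >-> R}).
Hypothesis HZ : std_normal_vector Z.
Variables (S : 'M[R]_d) (P : 'cV[R]_d -> R) (U : R -> 'cV[R]_d -> R).
Hypothesis UE : integrable_envelope Z S P U.
Implicit Types (F : 'cV[R]_d -> R) (w x y z : 'cV[R]_d) (a c l r t : R).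

Let P_loc : locally_bounded P. Proof. by case: UE. Qed.
Let U1 l z : 0 <= l -> 1 <= U l z. Proof. by case: UE => _ + _ _ _; exact. Qed.
Let Ule l m z : 0 <= l <= m -> U l z <= U m z. Proof. by case: UE => _ _ + _ _; exact. Qed.
Let PU l z c u : 0 <= c <= 1 -> norm1 u <= l -> 1 + P (c *: (S *m z) + u) <= U l z.
Proof. by case: UE => _ _ _ + _; exact. Qed.
Let MB l : 0 <= l -> exists2 K : R, 0 <= K &
  forall F, borel F -> (forall z, 0 <= F z <= majorant U l z) ->
    (\int[Pr]_om (F (vecZ Z om))%:E <= K%:E)%E.
Proof. by case: UE => _ _ _ _; exact. Qed.

Let dir (i : 'I_d) : 'cV[R]_d := delta_mx i 0.

Variables (C : R) (psi : 'cV[R]_d -> R).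
Hypothesis tpsi : tame P C psi.
Variables (y0 : R) (yl : 'cV[R]_d).

(** An affine weight covers both situations: [y0 = 1], [yl = 0] before an integration by parts, and
    [y0 = 0], [yl = m] after it. *)
Definition weight z : R := y0 + dotv yl z.

Definition mean a c w : R := EZ Z (fun z => weight z * psi (a *: w + c *: (S *m z))).

Lemma borel_weight : borel weight.
Proof. by apply: borelD; [exact: borel_cst|exact: borel_dotv]. Qed.

Let exp_ge1 (m : R) z : 0 <= m -> 1 <= expR (m * norm1 z).
Proof. by move=> m0; rewrite -expR0 ler_expR mulr_ge0// norm1_ge0. Qed.

Let B := `|y0| + norm1 yl.

Let B0 : 0 <= B. Proof. by rewrite addr_ge0// norm1_ge0. Qed.

Lemma weight_le z : `|weight z| <= B * expR (1 * norm1 z).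
Proof.
rewrite (le_trans (ler_normD _ _))// mulrDl lerD//.
  by rewrite ler_peMr// exp_ge1.
rewrite (le_trans (dotv_norm1 _ _))// mul1r ler_wpM2l ?norm1_ge0//.
by rewrite (le_trans _ (expR_ge1Dx _))// lerDr.
Qed.

Let int_of l A F := @dominated_integrable _ _ _ Pr d Z U MB l A F.

Lemma borel_mean a c w : borel (fun z => weight z * psi (a *: w + c *: (S *m z))).
Proof. by apply: borelM; [exact: borel_weight|exact: (borel_tame_affine S P_loc tpsi)]. Qed.

Lemma mean_dominated r : 0 <= r -> exists p : R * R, [/\ 0 <= p.1, 0 <= p.2 &
  forall a c w, 0 <= a <= 1 -> 0 <= c <= 1 -> norm1 w <= r ->
    dominated U p.2 p.1 (fun z => weight z * psi (a *: w + c *: (S *m z)))].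
Proof.
move=> r0; have [[A l] /= [A0 l0 H]] := tame_growth U1 PU tpsi r0.
exists (A * B, l + 1); split => /=; [exact: mulr_ge0|exact: addr_ge0|].
move=> a c w a01 c01 wr.
exact: (dominatedM Ule l0 ler01 A0 B0 weight_le (H a c w a01 c01 wr)).
Qed.

Lemma mean_integrable a c w : 0 <= a <= 1 -> 0 <= c <= 1 ->
  Pr.-integrable setT
    (fun om => (weight (vecZ Z om) * psi (a *: w + c *: (S *m vecZ Z om)))%:E).
Proof.
move=> a01 c01; have [[A l] /= [A0 l0 H]] := mean_dominated (norm1_ge0 w).
exact: (int_of l0 A0 (borel_mean a c w) (H a c w a01 c01 (lexx _))).
Qed.

Lemma mean_bound r : 0 <= r -> exists2 K : R, 0 <= K &
  forall a c w, 0 <= a <= 1 -> 0 <= c <= 1 -> norm1 w <= r -> `|mean a c w| <= K.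
Proof.
move=> r0; have [[A l] /= [A0 l0 H]] := mean_dominated r0.
have [K K0 HK] := dominated_bound MB l0.
exists (A * K) => [|a c w a01 c01 wr]; first exact: mulr_ge0.
have [h1 h2] := HK _ _ A0 (borel_mean a c w) (H a c w a01 c01 wr).
by rewrite (le_trans (EZ_norm (borel_mean a c w) h1)).
Qed.

Lemma mean_sub a c w a' c' w' : 0 <= a <= 1 -> 0 <= c <= 1 -> 0 <= a' <= 1 -> 0 <= c' <= 1 ->
  mean a c w - mean a' c' w' =
  EZ Z (fun z => weight z * (psi (a *: w + c *: (S *m z)) - psi (a' *: w' + c' *: (S *m z)))).
Proof.
move=> a01 c01 a'01 c'01; rewrite /mean /EZ -RintegralB//; last 2 first.
- exact: mean_integrable.
- exact: mean_integrable.
by apply: eq_Rintegral => om _; rewrite mulrBr.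
Qed.

Lemma weighted_lipschitz i r : 0 <= r -> exists p : R * R, [/\ 0 <= p.1, 0 <= p.2 &
  forall a c w t, 0 <= a <= 1 -> 0 <= c <= 1 -> norm1 w <= r -> `|t| <= 1 ->
    dominated U p.2 (a * `|t| * p.1) (fun z => weight z *
     (psi (a *: (w + t *: dir i) + c *: (S *m z)) - psi (a *: w + c *: (S *m z))))].
Proof.
move=> r0; have [[A l] /= [A0 l0 H]] := tame_lipschitz U1 PU tpsi i r0.
exists (A * B, l + 1); split => /=; [exact: mulr_ge0|exact: addr_ge0|].
move=> a c w t a01 c01 wr t1; have /andP[a0 _] := a01.
rewrite mulrA; apply: (dominatedM Ule l0 ler01 _ B0 weight_le (H a c w t a01 c01 wr t1)).
by rewrite !mulr_ge0.
Qed.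

Let borel_diff a c w a' c' w' : borel (fun z => weight z *
  (psi (a *: w + c *: (S *m z)) - psi (a' *: w' + c' *: (S *m z)))).
Proof.
apply: borelM; first exact: borel_weight.
by apply: borelB; exact: (borel_tame_affine S P_loc tpsi).
Qed.

Lemma mean_lipschitz i r : 0 <= r -> exists2 K : R, 0 <= K &
  forall a c w t, 0 <= a <= 1 -> 0 <= c <= 1 -> norm1 w <= r -> `|t| <= 1 ->
  `|mean a c (w + t *: dir i) - mean a c w| <= `|t| * (a * K).
Proof.
move=> r0; have [[A l] /= [A0 l0 H]] := weighted_lipschitz i r0.
have [K K0 HK] := dominated_bound MB l0.
exists (A * K) => [|a c w t a01 c01 wr t1]; first exact: mulr_ge0.
have atA : 0 <= a * `|t| * A by have /andP[? _] := a01; rewrite !mulr_ge0.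
have bd := borel_diff a c (w + t *: dir i) a c w.
have [h1 h2] := HK _ _ atA bd (H a c w t a01 c01 wr t1).
rewrite mean_sub// (le_trans (EZ_norm bd h1))// (le_trans h2)//.
by rewrite [leRHS](_ : _ = a * `|t| * A * K)//; ring.
Qed.

(** The factor [a] makes the integral that defines the solution converge at infinity. *)
Lemma mean_endpoint r : y0 = 1 -> yl = 0 -> 0 <= r -> exists2 K : R, 0 <= K &
  forall a c w, 0 <= a <= 1 -> 0 <= c <= 1 -> 1 - c <= a -> norm1 w <= r ->
  `|mean a c w - EZ Z (fun z => psi (S *m z))| <= a * K.
Proof.
move=> y01 yl0 r0; have [[A l] /= [A0 l0 H]] := tame_endpoint U1 PU tpsi r0.
have [K K0 HK] := dominated_bound MB l0.
exists (A * K) => [|a c w a01 c01 ca wr]; first exact: mulr_ge0.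
have aA : 0 <= a * A by have /andP[? _] := a01; rewrite !mulr_ge0.
have w1 z : weight z = 1.
  by rewrite /weight y01 yl0 /dotv big1 ?addr0// => i _; rewrite mxE mul0r.
have -> : EZ Z (fun z => psi (S *m z)) = mean 0 1 w.
  by apply: eq_Rintegral => om _; rewrite w1 mul1r scale0r scale1r add0r.
rewrite mean_sub// ?lexx ?ler01//.
rewrite (_ : (fun z => _) = fun z => psi (a *: w + c *: (S *m z)) - psi (S *m z)); last first.
  by apply/funext => z; rewrite w1 mul1r scale0r scale1r add0r.
have bd : borel (fun z => psi (a *: w + c *: (S *m z)) - psi (S *m z)).
  apply: borelB; first exact: (borel_tame_affine S P_loc tpsi).
  have := borel_tame_affine S P_loc tpsi 0 1 0.
  by under eq_fun do rewrite scale0r scale1r add0r.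
have [h1 h2] := HK _ _ aA bd (H a c w a01 c01 ca wr).
by rewrite (le_trans (EZ_norm bd h1))// mulrA.
Qed.

Lemma mean_cvg (a_ c_ : nat -> R) a c w :
  (forall n, 0 <= a_ n <= 1) -> (forall n, 0 <= c_ n <= 1) ->
  a_ n @[n --> \oo] --> a -> c_ n @[n --> \oo] --> c ->
  mean (a_ n) (c_ n) w @[n --> \oo] --> mean a c w.
Proof.
move=> a01 c01 ca cc; have [[A l] /= [A0 l0 H]] := mean_dominated (norm1_ge0 w).
have Q := EZ_dominated_cvg MB l0 A0
  (F_ := fun n z => weight z * psi (a_ n *: w + c_ n *: (S *m z)))
  (F := fun z => weight z * psi (a *: w + c *: (S *m z))).
apply: Q => [n|n|z].
- exact: borel_mean.
- by apply: H.
apply: cvgM; first exact: cvg_cst.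
apply: norm1_continuous_cvg; first exact: (tame_continuous P_loc tpsi).
apply/cvgrPdist_le => e e0.
have C0 : `|a_ n - a| * norm1 w + `|c_ n - c| * norm1 (S *m z) @[n --> \oo] --> (0 : R).
  rewrite -[X in _ --> X](_ : `|a - a| * norm1 w + `|c - c| * norm1 (S *m z) = 0).
    by apply: cvgD; apply: cvgM; try exact: cvg_cst; apply: cvg_norm;
       apply: cvgB => //; exact: cvg_cst.
  by rewrite !subrr !normr0 !mul0r addr0.
move/cvgrPdist_le : C0 => /(_ e e0); apply: filterS => n.
rewrite !sub0r !normrN => h; rewrite ger0_norm ?norm1_ge0//.
rewrite (le_trans _ h)// (le_trans _ (ler_norm _))//=.
rewrite (_ : _ - _ = (a_ n - a) *: w + (c_ n - c) *: (S *m z)).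
  by rewrite (le_trans (norm1D _ _))// !norm1Z.
by rewrite !scalerBl opprD addrACA.
Qed.

Let quotient i a c w t z := t^-1 * (weight z *
  (psi (a *: (w + t *: dir i) + c *: (S *m z)) - psi (a *: w + c *: (S *m z)))).

Let borel_quotient i a c w t : borel (quotient i a c w t).
Proof. by apply: borelM; [exact: borel_cst|exact: borel_diff]. Qed.

Let dominated_quotient i r : 0 <= r -> exists p : R * R, [/\ 0 <= p.1, 0 <= p.2 &
  forall a c w t, 0 <= a <= 1 -> 0 <= c <= 1 -> norm1 w <= r -> t != 0 -> `|t| <= 1 ->
    dominated U p.2 p.1 (quotient i a c w t)].
Proof.
move=> r0; have [[A l] /= [A0 l0 H]] := weighted_lipschitz i r0.
exists (A, l); split => //= a c w t a01 c01 wr t0 t1 z.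
rewrite normrM normfV mulrC ler_pdivrMr ?normr_gt0//.
rewrite (le_trans (H a c w t a01 c01 wr t1 z))//.
have /andP[a0 a1] := a01.
rewrite [leLHS](_ : _ = a * (`|t| * A * majorant U l z)); last by ring.
have MJ : 0 <= majorant U l z by exact: majorant_ge0.
rewrite [leRHS](_ : _ = `|t| * A * majorant U l z); last by ring.
apply: ler_piMl a1; apply: mulr_ge0; last exact: MJ.
by apply: mulr_ge0; [exact: normr_ge0|exact: A0].
Qed.

Let quotientE i a c w t : 0 <= a <= 1 -> 0 <= c <= 1 -> t != 0 -> `|t| <= 1 ->
  t^-1 * (mean a c (w + t *: dir i) - mean a c w) = EZ Z (quotient i a c w t).
Proof.
move=> a01 c01 t0 t1; rewrite mean_sub// /EZ -RintegralZl//.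
have [[A l] /= [A0 l0 H]] := weighted_lipschitz i (norm1_ge0 w).
have ta : 0 <= a * `|t| * A by have /andP[? _] := a01; rewrite !mulr_ge0.
exact: (int_of l0 ta (borel_diff _ _ _ _ _ _) (H a c w t a01 c01 (lexx _) t1)).
Qed.

Lemma is_derive_mean i a c w : 0 <= a <= 1 -> 0 <= c <= 1 ->
  (forall x, derivable psi x (dir i)) ->
  is_derive w (dir i) (mean a c)
    (EZ Z (fun z => weight z * (a * 'D_(dir i) psi (a *: w + c *: (S *m z))))).
Proof.
move=> a01 c01 dpsi; have /andP[a0 a1] := a01.
apply: seq_is_derive => t_ t0 t1 ct.
have [[A l] /= [A0 l0 H]] := dominated_quotient i (norm1_ge0 w).
apply: (@cvg_trans _ (EZ Z (quotient i a c w (t_ n)) @[n --> \oo])).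
  by apply: near_eq_cvg; apply: nearW => n; rewrite quotientE.
apply: (EZ_dominated_cvg MB l0 A0 (F_ := fun n => quotient i a c w (t_ n))) => [n|n|z].
- exact: borel_quotient.
- exact: H.
(* The argument of [psi] moves by [a * t_ n], which is a valid increment only for nonzero [a]. *)
set x := a *: w + c *: (S *m z); have [a00|an0] := eqVneq a 0.
  rewrite a00 mul0r mulr0; apply: (@cvg_trans _ ((0 : R) @[n --> \oo])); last exact: cvg_cst.
  apply: near_eq_cvg; apply: nearW => n.
  by rewrite /quotient !scale0r subrr !mulr0.
have atn n : a * t_ n != 0 by rewrite mulf_neq0.
have cat : a * t_ n @[n --> \oo] --> 0 by rewrite -(mulr0 a); apply: cvgM => //; exact: cvg_cst.
have cq := is_derive_seq (derivableP (dpsi x)) atn cat.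
have : weight z * (a * ((a * t_ n)^-1 * (psi (x + (a * t_ n) *: dir i) - psi x))) @[n --> \oo] -->
    weight z * (a * 'D_(dir i) psi x).
  by apply: cvgM; [exact: cvg_cst|apply: cvgM => //; exact: cvg_cst].
apply: cvg_trans; apply: near_eq_cvg.
apply: nearW => n /=; rewrite /quotient scalerDr scalerA addrAC -/x invfM.
by field; rewrite an0 t0.
Qed.

(** This serves the top order, where [psi] need not be differentiable. [G] is the upper limit of the
    weighted difference quotients; it is Borel, whereas [P] need not be measurable. *)
Lemma mean_limsup i a c w (H : R) : 0 <= a <= 1 -> 0 <= c <= 1 -> 0 <= H ->
  (forall x, plip (line psi x (dir i)) 0 (H * P x)) ->
  exists G, [/\ borel G, Pr.-integrable setT (fun om => (G (vecZ Z om))%:E),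
    forall z, 0 <= G z <= `|weight z| * (a * (H * P (a *: w + c *: (S *m z)))) &
    forall e, 0 < e -> \forall n \near \oo,
      `|n.+1%:R * (mean a c (w + n.+1%:R^-1 *: dir i) - mean a c w)| <= EZ Z G + e].
Proof.
move=> a01 c01 H0 pH; have /andP[a0 a1] := a01.
pose t_ n : R := n.+1%:R^-1.
have t0 n : t_ n != 0 by rewrite invr_neq0// pnatr_eq0.
have t1 n : `|t_ n| <= 1 by rewrite ger0_norm ?invr_ge0// invf_le1// ler1n.
have [[A l] /= [A0 l0 HA]] := dominated_quotient i (norm1_ge0 w).
have := EZ_limsup MB l0 A0 (fun n => borel_quotient i a c w (t_ n))
  (fun n => HA a c w (t_ n) a01 c01 (lexx _) (t0 n) (t1 n)).
move=> [G [bG dG G0 GM EG]]; exists G; split => //.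
- exact: int_of l0 A0 bG dG.
- move=> z; rewrite G0/=; apply/ler_addgt0Pr => e e0.
  set x := a *: w + c *: (S *m z).
  have e1 : 0 < e / (`|weight z| * a + 1).
    by rewrite divr_gt0// ltr_wpDl// mulr_ge0.
  apply: (@le_trans _ _ (`|weight z| * (a * (H * P x + e / (`|weight z| * a + 1))))); last first.
    rewrite !mulrDr lerD2l mulrA mulrA ler_pdivrMr; last by rewrite ltr_wpDl// mulr_ge0.
    by rewrite mulrC ler_pM2l// lerDl.
  apply: GM; have cat : a * t_ n @[n --> \oo] --> 0.
    rewrite -[X in _ --> X](mulr0 a); apply: cvgM; first exact: cvg_cst.
    exact: (@cvg_harmonic R).
  have Hn : \forall n \near \oo,
      `|line psi x (dir i) (a * t_ n) - line psi x (dir i) 0| <=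
      (H * P x + e / (`|weight z| * a + 1)) * `|a * t_ n - 0| := cat _ (pH x _ e1).
  move: Hn; apply: filterS => n.
  rewrite line0 subr0 /line => h.
  rewrite /quotient normrM normrM mulrCA ler_wpM2l//.
  rewrite normfV mulrC ler_pdivrMr ?normr_gt0//.
  rewrite scalerDr scalerA addrAC -/x (le_trans h)//.
  by rewrite normrM (ger0_norm a0) mulrA [a * _]mulrC.
- move=> e /EG; apply: filterS => n; rewrite -quotientE// /t_ invrK.
  exact.
Qed.

(* Moving [w] by [t] along the axis [i] amounts to translating [Z] by a multiple of
   [m], and the translation is absorbed by the Gaussian density. *)
Lemma is_derive_mean_shift i m a c w : 0 <= a <= 1 -> 0 < c <= 1 -> S *m m = dir i ->
  is_derive w (dir i) (mean a c) (EZ Z (fun z => psi (a *: w + c *: (S *m z)) *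
    (a / c * (weight z * dotv m z - dotv yl m)))).
Proof.
move=> a01 /andP[c0 c1] Sm; have c01 : 0 <= c <= 1 by rewrite ltW.
(* [b] is chosen so that [c *: (S *m b) = a *: dir i]. *)
pose b := (a / c) *: m; pose del := dotv b b / 2; pose be := dotv yl b.
have del0 : 0 <= del.
  by rewrite /del divr_ge0// sumr_ge0// => k _; rewrite -expr2 sqr_ge0.
(* The weight at [z - t *: b] times the density of the translation by [t *: b]. *)
pose tilt t z := (weight z - t * be) * expR (t * dotv b z - t ^+ 2 * del).
have btilt t : borel (tilt t).
  apply: borelM; first by apply: borelB; [exact: borel_weight|exact: borel_cst].
  apply: borel_expR; apply: borelB; last exact: borel_cst.
  by apply: borelM; [exact: borel_cst|exact: borel_dotv].
have b1 t : `|t| <= 1 -> forall z, `|t * dotv b z - t ^+ 2 * del| <=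
    `|t| * (norm1 b * norm1 z + del).
  move=> t1 z; rewrite (le_trans (ler_normB _ _))// mulrDr lerD//.
    by rewrite normrM ler_wpM2l// dotv_norm1.
  by rewrite normrM (ger0_norm del0) ler_wpM2r// normrX expr2 ler_piMr.
have [[A l] /= [A0 l0 HA]] := tame_growth U1 PU tpsi (norm1_ge0 w).
have {}HA := HA a c w a01 c01 (lexx _).
set arg := fun z => a *: w + c *: (S *m z).
have barg : borel (fun z => psi (arg z)) by exact: (borel_tame_affine S P_loc tpsi).
pose B1 := B * expR (2 * del) + `|be| * expR del.
have B10 : 0 <= B1 by rewrite addr_ge0// mulr_ge0// expR_ge0.
pose l1 := 1 + 2 * norm1 b.
have l10 : 0 <= l1 by rewrite addr_ge0// mulr_ge0// norm1_ge0.
have dtilt t : `|t| <= 1 -> forall z,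
    `|tilt t z - weight z| <= `|t| * B1 * expR (l1 * norm1 z).
  move=> t1 z; rewrite /tilt; set x := _ - t ^+ 2 * del.
  set y := norm1 b * norm1 z + del.
  have y0' : 0 <= y by rewrite addr_ge0// mulr_ge0// norm1_ge0.
  have xy : `|x| <= `|t| * y by exact: b1.
  have xy1 : `|x| <= y by rewrite (le_trans xy)// ler_piMl.
  have yey : y * expR y <= expR (2 * y).
    move: y y0' {xy xy1} => v v0; rewrite (_ : 2 * v = v + v); last by ring.
    by rewrite expRD ler_wpM2r ?expR_ge0// (le_trans _ (expR_ge1Dx _))// lerDr.
  have E1 : `|expR x - 1| <= `|t| * expR (2 * y).
    rewrite (le_trans (norm_expR_sub1 x))//.
    apply: (@le_trans _ _ ((`|t| * y) * expR y)).
      by rewrite ler_pM ?expR_ge0// ler_expR.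
    by rewrite -mulrA ler_wpM2l.
  have Ex : expR x <= expR y by rewrite ler_expR (le_trans (ler_norm x)).
  have -> : (weight z - t * be) * expR x - weight z =
    weight z * (expR x - 1) - t * be * expR x by ring.
  rewrite (le_trans (ler_normB _ _))// !normrM (ger0_norm (expR_ge0 x)).
  apply: (@le_trans _ _ ((B * expR (1 * norm1 z)) * (`|t| * expR (2 * y)) +
      `|t| * `|be| * expR y)).
    rewrite lerD//; first by rewrite ler_pM// weight_le.
    by rewrite ler_wpM2l// mulr_ge0.
  rewrite [leRHS](_ : _ = `|t| * B * (expR (2 * del) * expR (l1 * norm1 z)) +
    `|t| * `|be| * (expR del * expR (l1 * norm1 z))); last by rewrite /B1; ring.
  apply: lerD; rewrite -!expRD.
    rewrite (_ : 2 * del + l1 * norm1 z = 1 * norm1 z + 2 * y); last by rewrite /l1 /y; ring.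
    by rewrite [in leRHS]expRD le_eqVlt; apply/orP; left; apply/eqP; ring.
  apply: ler_wpM2l; first exact: mulr_ge0.
  rewrite ler_expR /y addrC lerD2l ler_wpM2r ?norm1_ge0// /l1.
  by have := norm1_ge0 b; lra.
have dpsitilt t : `|t| <= 1 -> dominated U (l + l1) (A * (`|t| * B1))
    (fun z => (tilt t z - weight z) * psi (arg z)).
  move=> t1; apply: (dominatedM Ule l0 l10 A0 _ (dtilt t t1) HA).
  by rewrite mulr_ge0.
have bpsitilt t : borel (fun z => (tilt t z - weight z) * psi (arg z)).
  by apply: borelM => //; apply: borelB => //; exact: borel_weight.
have l2 : 0 <= l + l1 by rewrite addr_ge0.
have itilt t : `|t| <= 1 -> Pr.-integrable setT
    (fun om => ((tilt t (vecZ Z om) - weight (vecZ Z om)) * psi (arg (vecZ Z om)))%:E).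
  move=> t1; apply: (int_of l2 _ (bpsitilt t) (dpsitilt t t1)).
  by rewrite !mulr_ge0.
have meanE t : `|t| <= 1 -> mean a c (w + t *: dir i) - mean a c w =
    EZ Z (fun z => (tilt t z - weight z) * psi (arg z)).
  move=> t1; have -> : mean a c (w + t *: dir i) =
      EZ Z (fun z => tilt t z * psi (arg z)).
    (* The weight is moved back by [t *: b], because the substitution translates the whole
       integrand. *)
    pose F z := weight (z - t *: b) * psi (arg z).
    have bF : borel F.
      apply: borelM => //; apply: borel_translate; exact: borel_weight.
    transitivity (EZ Z (fun z => F (z + t *: b))).
      apply: eq_Rintegral => om _; rewrite /F addrK; congr (_ * psi _).
      rewrite /arg mulmxDr -scalemxAr /b -scalemxAr Sm.
      rewrite !scalerDr !scalerA addrAC -!addrA; congr (_ + (_ + _)).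
      by congr (_ *: _); field; rewrite gt_eqF.
    rewrite (EZ_shift HZ _ bF); apply: eq_Rintegral => om _.
    rewrite /F /tilt /shift_density mulrAC; congr (_ * expR _ * _).
      rewrite /weight -scaleN1r dotvD dotvZ dotvZ mulN1r addrA.
      by [].
    by rewrite !(dotvZl t b) (dotvZ t b b) /del; ring.
  rewrite /mean /EZ -RintegralB//; last exact: mean_integrable.
    by apply: eq_Rintegral => om _; rewrite mulrBl.
  have := integrableD measurableT (itilt t t1) (mean_integrable w a01 c01).
  apply: eq_integrable => // om _ /=.
  by rewrite -EFinD mulrBl subrK.
apply: seq_is_derive => t_ t0 t1 ct.
pose F_ n z := (t_ n)^-1 * ((tilt (t_ n) z - weight z) * psi (arg z)).
apply: (@cvg_trans _ (EZ Z (F_ n) @[n --> \oo])).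
  apply: near_eq_cvg; apply: nearW => n; rewrite meanE// /EZ -RintegralZl//.
  exact: itilt.
have AB : 0 <= A * B1 by rewrite mulr_ge0.
apply: (EZ_dominated_cvg MB l2 AB (F_ := F_)) => [n|n|z].
- by apply: borelM; [exact: borel_cst|exact: bpsitilt].
- move=> z; rewrite normrM normfV mulrC ler_pdivrMr ?normr_gt0//.
  rewrite (le_trans (dpsitilt _ (t1 n) z))//.
  by rewrite le_eqVlt; apply/orP; left; apply/eqP; ring.
have d1 := @is_derive_tilt _ (weight z) be (dotv b z) del.
have -> : psi (arg z) * (a / c * (weight z * dotv m z - dotv yl m)) =
    (weight z * dotv b z - be) * psi (arg z).
  by rewrite /be /b dotvZl dotvZ; ring.
have cq : (t_ n)^-1 * (tilt (t_ n) z - weight z) @[n --> \oo] -->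
    weight z * dotv b z - be.
  have [dd <-] := d1.
  have /cvgr_dnbhsP/(_ t_ (conj t0 ct)) : h^-1 *: ((fun t => tilt t z) (h + 0) - tilt 0 z)
      @[h --> (0 : R)^'] --> 'D_1 (fun t => tilt t z) (0 : R).
    by move: dd; rewrite /derivable /derive; under eq_fun do rewrite /= [_%:A]mulr1.
  apply: cvg_trans; apply: near_eq_cvg; apply: nearW => n /=.
  rewrite addr0; congr (_ * (_ - _)).
  by rewrite /tilt !mul0r expr0n mul0r !subr0 expR0 mulr1.
have : (t_ n)^-1 * (tilt (t_ n) z - weight z) * psi (arg z) @[n --> \oo] -->
    (weight z * dotv b z - be) * psi (arg z).
  by apply: cvgM => //; exact: cvg_cst.
apply: cvg_trans; apply: near_eq_cvg.
by apply: nearW => n; rewrite /F_ mulrA.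
Qed.

End WeightedMean.

Lemma weight_cst1 (R : realType) (d : nat) (z : 'cV[R]_d) : weight 1 0 z = 1.
Proof. by rewrite /weight /dotv big1 ?addr0// => k _; rewrite mxE mul0r. Qed.

(** * The Mehler integral *)

Section IntegralDerivative.
Context {R : realType} {disp : measure_display} {T : measurableType disp}.
Variables (mu : {measure set T -> \bar R}) (D : set T).
Hypothesis mD : measurable D.

Lemma Rintegral_dominated_cvg (f_ : nat -> T -> R) (f g : T -> R) :
  (forall n, measurable_fun D (f_ n)) ->
  (forall s, D s -> f_ n s @[n --> \oo] --> f s) ->
  mu.-integrable D (EFin \o g) -> (forall n s, D s -> `|f_ n s| <= g s) ->
  mu.-integrable D (EFin \o f) /\
  \int[mu]_(s in D) f_ n s @[n --> \oo] --> \int[mu]_(s in D) f s.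
Proof.
move=> mf cf ig fg.
have mF_ n : measurable_fun D (EFin \o f_ n) by exact/measurable_EFinP.
have mF : measurable_fun D (EFin \o f).
  by apply/measurable_EFinP; exact: measurable_fun_cvg cf.
have cE : {ae mu, forall s, D s -> (EFin \o f_ n) s @[n --> \oo] --> (EFin \o f) s}.
  by apply: aeW => s Ds; apply: cvg_EFin; [exact: nearW|exact: cf].
have dE : {ae mu, forall s n, D s -> (`|(EFin \o f_ n) s| <= (EFin \o g) s)%E}.
  by apply: aeW => s n Ds; rewrite lee_fin fg.
have [iF _ cI] := dominated_convergence mD mF_ mF cE ig dE; split => //.
move: cI; rewrite -[X in _ --> X](@fineK _ (\int[mu]_(s in D) (EFin \o f) s)%E); last first.
  exact: integrable_fin_num.
by move/fine_cvg.
Qed.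

Context {d : nat}.
Variables (k : T -> 'cV[R]_d -> R) (w v : 'cV[R]_d) (Kd : T -> R).
Hypothesis ik : forall w', mu.-integrable D (EFin \o (k^~ w')).
Hypothesis iKd : mu.-integrable D (EFin \o Kd).
Hypothesis kKd : forall s t, D s -> `|t| <= 1 ->
  `|k s (w + t *: v) - k s w| <= `|t| * Kd s.

Let quot (t : R) s := t^-1 * (k s (w + t *: v) - k s w).

Let iquot t : mu.-integrable D (EFin \o quot t).
Proof.
have := integrableZl mD t^-1 (integrableB mD (ik (w + t *: v)) (ik w)).
by apply: eq_integrable => // s _ /=; rewrite -EFinB -EFinM.
Qed.

Let mquot t : measurable_fun D (quot t).
Proof. by apply/measurable_EFinP; exact: measurable_int (iquot t). Qed.

Let quot_le t s : D s -> t != 0 -> `|t| <= 1 -> `|quot t s| <= Kd s.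
Proof.
move=> Ds t0 t1; rewrite normrM normfV mulrC ler_pdivrMr ?normr_gt0//.
by rewrite mulrC kKd.
Qed.

Let quotE t : t^-1 * (\int[mu]_(s in D) k s (w + t *: v) - \int[mu]_(s in D) k s w) =
  \int[mu]_(s in D) quot t s.
Proof.
rewrite -RintegralB// -RintegralZl//.
have := integrableB mD (ik (w + t *: v)) (ik w).
by apply: eq_integrable => // s _ /=; rewrite -EFinB.
Qed.

Lemma is_derive_integral (Dk : T -> R) :
  (forall s, D s -> is_derive w v (k s) (Dk s)) ->
  mu.-integrable D (EFin \o Dk) /\
  is_derive w v (fun w => \int[mu]_(s in D) k s w) (\int[mu]_(s in D) Dk s).
Proof.
move=> dk.
have H (t_ : nat -> R) : (forall n, t_ n != 0) -> (forall n, `|t_ n| <= 1) ->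
     t_ n @[n --> \oo] --> 0 -> mu.-integrable D (EFin \o Dk) /\
     \int[mu]_(s in D) quot (t_ n) s @[n --> \oo] --> \int[mu]_(s in D) Dk s.
  move=> t0 t1 ct; apply: (Rintegral_dominated_cvg (g := Kd)) => // [s Ds|n s Ds].
    exact: (is_derive_seq (dk s Ds) t0 ct).
  exact: quot_le.
split.
  have t0 n : n.+1%:R^-1 != 0 :> R by rewrite invr_neq0// pnatr_eq0.
  have t1 n : `|n.+1%:R^-1 : R| <= 1 by rewrite ger0_norm ?invr_ge0// invf_le1// ler1n.
  by have [] := H _ t0 t1 (@cvg_harmonic R).
apply: seq_is_derive => t_ t0 t1 ct; have [_] := H t_ t0 t1 ct.
by apply: cvg_trans; apply: near_eq_cvg; apply: nearW => n; rewrite quotE.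
Qed.

(** The integrand need not be differentiable. The upper limit passes through the integral by way of
    the excess of the quotients over [Bd], which is dominated by [Kd] and tends to 0. *)
Lemma norm_derive_integral_le (Bd : T -> R) :
  derivable (fun w => \int[mu]_(s in D) k s w) w v ->
  mu.-integrable D (EFin \o Bd) -> (forall s, D s -> 0 <= Bd s) ->
  (forall s, D s -> forall e, 0 < e -> \forall n \near \oo,
    `|n.+1%:R * (k s (w + n.+1%:R^-1 *: v) - k s w)| <= Bd s + e) ->
  `|'D_v (fun w => \int[mu]_(s in D) k s w) w| <= \int[mu]_(s in D) Bd s.
Proof.
move=> dJ iB B0 HB; pose t_ n : R := n.+1%:R^-1.
have t0 n : t_ n != 0 by rewrite invr_neq0// pnatr_eq0.
have t1 n : `|t_ n| <= 1 by rewrite ger0_norm ?invr_ge0// invf_le1// ler1n.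
have ct : t_ n @[n --> \oo] --> 0 by exact: (@cvg_harmonic R).
have cJ := is_derive_seq (derivableP dJ) t0 ct.
have mB : measurable_fun D Bd by apply/measurable_EFinP; exact: measurable_int iB.
pose ex n s := Num.max (`|quot (t_ n) s| - Bd s) 0.
have mex n : measurable_fun D (ex n).
  apply: measurable_maxr => //; apply: measurable_funB => //.
  by apply: measurableT_comp.
have ex0 n s : 0 <= ex n s by rewrite le_max lexx orbT.
have exK n s : D s -> `|ex n s| <= Kd s.
  move=> Ds; rewrite ger0_norm// ge_max; have := quot_le Ds (t0 n) (t1 n).
  by have := B0 s Ds; have := normr_ge0 (quot (t_ n) s); lra.
have cex s : D s -> ex n s @[n --> \oo] --> 0.
  move=> Ds; apply/cvgrPdist_le => e e0; have := HB s Ds e e0; apply: filterS => n h.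
  rewrite sub0r normrN ger0_norm// ge_max (ltW e0) andbT lerBlDl.
  by rewrite /quot /t_ invrK.
have [_] := Rintegral_dominated_cvg mex cex iKd exK.
rewrite Rintegral_cst ?mul0r// => cI.
have iex n : mu.-integrable D (EFin \o ex n).
  apply: le_integrable iKd => //; first exact/measurable_EFinP.
  by move=> s Ds /=; rewrite lee_fin (le_trans (exK n s Ds))// ler_norm.
apply/ler_addgt0Pr => e e0.
have e2 : 0 < e / 2 by rewrite divr_gt0.
have /cvgrPdist_le/(_ _ e2) h1 := cI.
have /cvgrPdist_le/(_ _ e2) h2 := cJ.
have [n [h1n h2n]] := @filter_ex _ _ _ _ (filterI h1 h2).
move: h1n; rewrite /= sub0r normrN => h1n.
have : `|\int[mu]_(s in D) quot (t_ n) s| <= \int[mu]_(s in D) Bd s + e / 2.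
  rewrite (le_trans (le_normr_Rintegral _ _))//.
  apply: (@le_trans _ _ (\int[mu]_(s in D) (Bd s + ex n s))).
    apply: le_Rintegral => //.
    - exact: integrable_abse (iquot _).
    - have := integrableD mD iB (iex n).
      by apply: eq_integrable.
    - by move=> s Ds; rewrite -lerBlDl le_max lexx.
  rewrite RintegralD// lerD2l (le_trans _ h1n)//; exact: ler_norm.
move: h2n => /=; rewrite quotE; set Q := \int[mu]_(s in D) quot _ _.
set DJ := 'D_v _ w => h hQ.
have -> : DJ = (DJ - Q) + Q by rewrite subrK.
by rewrite (le_trans (ler_normD _ _))//; lra.
Qed.

End IntegralDerivative.

Section MehlerKernel.
Context {R : realType}.
Implicit Types (s x : R) (k : nat).
Local Notation lam := (@lebesgue_measure R).
Local Notation Rpos := (`]0%R, +oo[%classic : set R).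

Definition mehler_a s : R := expR (- s).
Definition mehler_c s : R := Num.sqrt (1 - expR (- (2 * s))).

Lemma mehler_a01 s : 0 <= s -> 0 <= mehler_a s <= 1.
Proof.
by move=> s0; rewrite expR_ge0/= -expR0 ler_expR oppr_le0.
Qed.

Lemma mehler_a2 s : expR (- (2 * s)) = mehler_a s ^+ 2.
Proof. by rewrite /mehler_a -expRM_natl mulrN. Qed.

Lemma mehler_c01 s : 0 <= s -> 0 <= mehler_c s <= 1.
Proof.
move=> s0; rewrite sqrtr_ge0/= -[leRHS]sqrtr1 ler_wsqrtr//.
Qed.

Lemma mehler_c_gt0 s : 0 < s -> 0 < mehler_c s.
Proof.
move=> s0; rewrite sqrtr_gt0 subr_gt0 -expR0 ltr_expR oppr_lt0.
by rewrite mulr_gt0.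
Qed.

Lemma mehler_c2 s : 0 <= s -> mehler_c s ^+ 2 = 1 - mehler_a s ^+ 2.
Proof.
move=> s0; rewrite sqr_sqrtr ?mehler_a2// subr_ge0.
by have /andP[a0 a1] := mehler_a01 s0; rewrite expr_le1.
Qed.

Lemma mehler_ca s : 0 <= s -> 1 - mehler_c s <= mehler_a s.
Proof.
move=> s0; have /andP[a0 a1] := mehler_a01 s0; have /andP[c0 c1] := mehler_c01 s0.
have := mehler_c2 s0; nra.
Qed.

Lemma mehler_continuous : continuous mehler_a /\ continuous mehler_c.
Proof.
split=> s.
  apply: (@continuous_comp _ _ _ -%R expR); first exact: opp_continuous.
  exact: continuous_expR.
apply: (@continuous_comp _ _ _ (fun s => 1 - expR (- (2 * s))) Num.sqrt).
  apply: cvgB; first exact: cvg_cst.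
  apply: (@continuous_comp _ _ _ (fun s => - (2 * s)) expR); last exact: continuous_expR.
  by apply: cvgN; apply: cvgM; [exact: cvg_cst|exact: cvg_id].
exact: sqrt_continuous.
Qed.

Lemma ge0_integral_oy_le (f F : R -> R) (b : R) : 
  (forall x, 0 < x -> 0 <= f x) -> (forall x, 0 < x -> {for x, continuous f}) ->
  (forall x, 0 < x -> is_derive x 1 F (f x)) -> (forall x, 0 < x -> 0 <= F x) ->
  F x @[x --> +oo%R] --> b ->
  lam.-integrable Rpos (EFin \o f) /\ \int[lam]_(x in Rpos) f x <= b.
Proof.
move=> f0 cf dF F0 Fb.
pose I n : set R := `[n.+1%:R^-1, +oo[%classic.
have n0 n : 0 < n.+1%:R^-1 :> R by rewrite invr_gt0.
have IE : \bigcup_n I n = Rpos.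
  apply/seteqP; split => x /=.
    by move=> [n _]; rewrite /I/= !in_itv/= !andbT; exact: lt_le_trans.
  rewrite in_itv/= andbT => x0; exists (Num.truncn x^-1) => //.
  rewrite /I/= in_itv/= andbT invf_ple// ?posrE//.
  by rewrite ltW// truncnS_gt.
have In n : (\int[lam]_(x in I n) (f x)%:E <= b%:E)%E.
  rewrite (@ge0_continuous_FTC2y _ f F n.+1%:R^-1 b)//.
  - by rewrite -EFinB lee_fin lerBlDr lerDl F0.
  - by move=> x nx; rewrite f0// (lt_le_trans (n0 n)).
  - apply: continuous_in_subspaceT => x; rewrite inE/= in_itv/= andbT => nx.
    by apply: cf; exact: lt_le_trans nx.
  - by move=> x nx; have [] := dF x (lt_trans (n0 n) nx).
  - apply: cvg_at_right_filter; apply/differentiable_continuous/derivable1_diffP.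
    by have [] := dF _ (n0 n).
  - move=> x; rewrite in_itv/= andbT => nx; have [_ <-] := dF x (lt_trans (n0 n) nx).
    by rewrite derive1E.
have mf : measurable_fun Rpos f.
  apply: open_continuous_measurable_fun => //.
  by move=> x; rewrite inE/= in_itv/= andbT; exact: cf.
have fI : (\int[lam]_(x in Rpos) (f x)%:E <= b%:E)%E.
  have nd : nondecreasing_seq (I : nat -> set (measurableTypeR R)).
    move=> m n mn; apply/subsetPset => x; rewrite /I/= !in_itv/= !andbT.
    by apply: le_trans; rewrite lef_pV2 ?posrE// ler_nat.
  have mI n : measurable (I n : set (measurableTypeR R)) by exact: measurable_itv.
  have mfI n : measurable_fun (I n : set (measurableTypeR R)) (EFin \o f).
    by apply/measurable_EFinP; apply: measurable_funS mf => //; rewrite -IE; exact: bigcup_sup.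
  have f0I n x : I n x -> (0 <= (EFin \o f) x)%E.
    by rewrite /I/= in_itv/= andbT => nx; rewrite lee_fin f0//; exact: lt_le_trans nx.
  have cI := ge0_nondecreasing_set_cvg_integral (mu := lam) nd mI mfI f0I.
  rewrite -IE -(cvg_lim _ cI)//; apply: lime_le; last by apply: nearW => n; exact: In.
  exact: cvgP cI.
have int : lam.-integrable Rpos (EFin \o f).
  apply/integrableP; split; first exact/measurable_EFinP.
  rewrite (_ : (\int[_]_(x in _) _)%E = (\int[lam]_(x in Rpos) (f x)%:E)%E).
    by rewrite (le_lt_trans fI)// ltry.
  apply: eq_integral => x; rewrite inE/= in_itv/= andbT => x0.
  by rewrite ger0_norm// f0.
split => //; rewrite /Rintegral -lee_fin fineK//.
exact: integrable_fin_num.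
Qed.

Lemma mehler_exp_integral k : (0 < k)%N ->
  lam.-integrable Rpos (EFin \o (fun s => mehler_a s ^+ k)) /\
  \int[lam]_(s in Rpos) mehler_a s ^+ k <= k%:R^-1.
Proof.
move=> k0; have kR : 0 < k%:R :> R by rewrite ltr0n.
have E s : mehler_a s ^+ k = expR (- (k%:R * s)).
  by rewrite /mehler_a -expRM_natl mulrN.
apply: (@ge0_integral_oy_le _ (fun s => k%:R^-1 * (1 - mehler_a s ^+ k))).
- by move=> s _; rewrite E expR_ge0.
- move=> s _; apply: (@continuous_comp _ _ _ mehler_a (fun x => x ^+ k)).
    exact: mehler_continuous.1.
  exact: exprn_continuous.
- move=> s _; under eq_fun do rewrite E.
  have d1 : is_derive s 1 (fun x : R => - (k%:R * x)) (- k%:R).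
    by apply: is_derive_eq; rewrite /GRing.scale/=; ring.
  have d2 := @is_derive1_comp _ (@expR R) (fun x : R => - (k%:R * x)) s _ _ (is_derive_expR _) d1.
  have d3 : is_derive s 1 (fun x : R => k%:R^-1 * (1 - (expR \o (fun x : R => - (k%:R * x))) x))
     (expR (- (k%:R * s))).
    by apply: is_derive_eq; rewrite /GRing.scale/=; field; rewrite gt_eqF.
  by rewrite E; exact: d3.
- move=> s s0; rewrite mulr_ge0// ?invr_ge0// subr_ge0.
  by have /andP[? ?] := mehler_a01 (ltW s0); rewrite exprn_ile1.
- rewrite -[X in _ --> X]mulr1; apply: cvgM; first exact: cvg_cst.
  rewrite -[X in _ --> X]subr0; apply: cvgB; first exact: cvg_cst.
  rewrite (_ : 0 = 0 ^+ k); last by rewrite expr0n gtn_eqF.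
  by apply: (@cvg_comp _ _ _ mehler_a (fun x => x ^+ k)); [exact: cvgr_expR|exact: exprn_continuous].
Qed.

(** The primitive is [mehler_c] itself, which tends to 1 at infinity. *)
Lemma mehler_singular_integral :
  lam.-integrable Rpos (EFin \o (fun s => mehler_a s ^+ 2 / mehler_c s)) /\
  \int[lam]_(s in Rpos) (mehler_a s ^+ 2 / mehler_c s) <= 1.
Proof.
apply: (@ge0_integral_oy_le _ mehler_c).
- by move=> s s0; rewrite divr_ge0 ?sqr_ge0// ltW// mehler_c_gt0.
- move=> s s0; apply: cvgM.
    apply: (@continuous_comp _ _ _ mehler_a (fun x => x ^+ 2)).
      exact: mehler_continuous.1.
    exact: exprn_continuous.
  apply: cvgV; first by rewrite gt_eqF// mehler_c_gt0.
  exact: mehler_continuous.2.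
- move=> s s0.
  have d1 : is_derive s 1 (fun x : R => - (2 * x)) (- 2).
    by apply: is_derive_eq; rewrite /GRing.scale/=; ring.
  have d2 := @is_derive1_comp _ (@expR R) (fun x : R => - (2 * x)) s _ _ (is_derive_expR _) d1.
  have d3 : is_derive s 1 (fun x : R => 1 - (expR \o (fun x : R => - (2 * x))) x)
     (2 * expR (- (2 * s))).
    by apply: is_derive_eq; rewrite /GRing.scale/=; ring.
  have pos : 0 < 1 - expR (- (2 * s)) by have := mehler_c_gt0 s0; rewrite sqrtr_gt0.
  have d4 := @is_derive1_comp _ (@Num.sqrt R) _ s _ _ (is_derive1_sqrt pos) d3.
  apply: is_derive_eq d4 _.
  rewrite -[LHS]/((2 * mehler_c s)^-1 * (2 * expR (- (2 * s)))) mehler_a2.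
  by field; rewrite gt_eqF// mehler_c_gt0.
- by move=> s _; rewrite sqrtr_ge0.
- have c1 : 1 - expR (- (2 * s)) @[s --> +oo%R] --> (1 : R).
    have c2 : expR (- s) * expR (- s) @[s --> +oo%R] --> (0 * 0 : R).
      by apply: cvgM; exact: cvgr_expR.
    have : 1 - expR (- s) * expR (- s) @[s --> +oo%R] --> (1 - 0 * 0 : R).
      by apply: cvgB => //; exact: cvg_cst.
    rewrite mul0r subr0; apply: cvg_trans; apply: near_eq_cvg; apply: nearW => s.
    by rewrite mehler_a2 expr2.
  by have := cvg_comp _ _ c1 (@sqrt_continuous R 1); rewrite sqrtr1.
Qed.

(** After multiplication by [mehler_c s] this is [mehler_a s + mehler_c s >= 1]. Both terms on the
    right are integrable, hence so is the kernel of an integration by parts. *)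
Lemma mehler_ac s : 0 < s -> mehler_a s / mehler_c s <=
  mehler_a s ^+ 2 / mehler_c s + mehler_a s.
Proof.
move=> s0; have c0 := mehler_c_gt0 s0.
have /andP[a0 a1] := mehler_a01 (ltW s0); have /andP[_ c1] := mehler_c01 (ltW s0).
rewrite -(ler_pM2r c0) mulrDl !divfK ?gt_eqF//.
have := mehler_c2 (ltW s0); have := mehler_ca (ltW s0); nra.
Qed.

End MehlerKernel.

Section MehlerIntegral.
Context {R : realType} {disp : measure_display} {Omega : measurableType disp}.
Variables (Pr : probability Omega R) (d : nat) (Z : 'I_d -> {RV Pr >-> R}).
Variables (S : 'M[R]_d) (P : 'cV[R]_d -> R) (U : R -> 'cV[R]_d -> R).
Hypothesis UE : integrable_envelope Z S P U.
Implicit Types (w x z yl : 'cV[R]_d) (s b C : R) (psi : 'cV[R]_d -> R) (kap : R -> R).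

Let dir (i : 'I_d) : 'cV[R]_d := delta_mx i 0.
Local Notation lam := (@lebesgue_measure R).
Local Notation Rpos := (`]0%R, +oo[%classic : set R).

Let RposE s : Rpos s -> 0 < s.
Proof. by rewrite /= in_itv/= andbT. Qed.

Let mRpos : measurable (Rpos : set (measurableTypeR R)).
Proof. exact: measurable_itv. Qed.

Definition mehler_mean psi y0 yl s w : R :=
  mean Z S psi y0 yl (mehler_a s) (mehler_c s) w.

(** For the solution [kap] is [-1] and [b] is the Gaussian mean. Differentiation keeps the shape,
    with [b = 0] and a new [kap], and either [psi] or the weight changed. *)
Definition mehler_integral kap b psi y0 yl w : R :=
  \int[lam]_(s in Rpos) (kap s * (mehler_mean psi y0 yl s w - b)).

Lemma measurable_mehler_mean C psi y0 yl w : tame P C psi ->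
  measurable_fun Rpos (fun s => mehler_mean psi y0 yl s w).
Proof.
move=> tpsi.
(* With [Num.max s 0] the function extends continuously to the whole line, and continuity gives
   measurability. *)
pose M s := mehler_mean psi y0 yl (Num.max s 0) w.
have cM : continuous M.
  move=> s; apply/(@cvg_nbhsP _ R^o) => u us.
  have cmax : Num.max (u n) 0 @[n --> \oo] --> Num.max s 0.
    apply/cvgrPdist_le => e e0; move/cvgrPdist_le : us => /(_ e e0).
    apply: filterS => n; apply: le_trans.
    have := ler_norm (s - u n); have := lerNnormlW (lexx `|s - u n|).
    have := normr_ge0 (s - u n).
    by case: (leP s 0) => s0; case: (leP (u n) 0) => un0; rewrite ler_norml => *;
      apply/andP; split; lra.
  have [ca cc] := @mehler_continuous R.
  apply: (mean_cvg UE tpsi).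
  - by move=> n; apply: mehler_a01; rewrite le_max lexx orbT.
  - by move=> n; apply: mehler_c01; rewrite le_max lexx orbT.
  - by apply: (cvg_comp _ _ cmax); exact: ca.
  - by apply: (cvg_comp _ _ cmax); exact: cc.
apply: (eq_measurable_fun M).
  by move=> s; rewrite inE => /RposE s0; rewrite /M max_l// ltW.
by apply: measurable_funTS; exact: continuous_measurable_fun.
Qed.

Lemma integrable_mehler C psi y0 yl kap w : tame P C psi ->
  lam.-integrable Rpos (EFin \o kap) ->
  lam.-integrable Rpos (EFin \o (fun s => kap s * (mehler_mean psi y0 yl s w - 0))).
Proof.
move=> tpsi ik; have mk : measurable_fun Rpos kap.
  by apply/measurable_EFinP; exact: measurable_int ik.
have [K K0 HK] := mean_bound UE tpsi y0 yl (norm1_ge0 w).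
have iK : lam.-integrable Rpos (EFin \o (fun s => K * `|kap s|)).
  have := integrableZl mRpos K (integrable_abse ik).
  by apply: eq_integrable => // s _ /=; rewrite EFinM.
apply: le_integrable iK => //.
  apply/measurable_EFinP; apply: measurable_funM => //; apply: measurable_funB => //.
  exact: measurable_mehler_mean tpsi.
move=> s /RposE s0 /=; rewrite lee_fin subr0 normrM normrM normr_id (ger0_norm K0) mulrC.
rewrite ler_wpM2r// HK//; [exact/mehler_a01/ltW|exact/mehler_c01/ltW].
Qed.

Lemma integrable_mehler0 C psi w : tame P C psi ->
  lam.-integrable Rpos (EFin \o (fun s => -1 * (mehler_mean psi 1 0 s w
    - EZ Z (fun z => psi (S *m z))))).
Proof.
move=> tpsi.
have [K K0 HK] := mean_endpoint UE tpsi (erefl (1 : R)) (erefl (0 : 'cV[R]_d)) (norm1_ge0 w).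
have [iE _] := @mehler_exp_integral R 1 isT.
have iK : lam.-integrable Rpos (EFin \o (fun s => K * mehler_a s)).
  have := integrableZl mRpos K iE.
  by apply: eq_integrable => // s _ /=; rewrite EFinM.
apply: le_integrable iK => //.
  apply/measurable_EFinP; apply: measurable_funM => //; apply: measurable_funB => //.
  exact: measurable_mehler_mean tpsi.
move=> s /RposE s0 /=; have a01 := mehler_a01 (ltW s0); have /andP[a0 _] := a01.
rewrite lee_fin mulN1r normrN normrM (ger0_norm K0) (ger0_norm a0) mulrC.
by apply: HK => //; [exact/mehler_c01/ltW|exact/mehler_ca/ltW].
Qed.

Section Differentiation.
Variables (C : R) (psi : 'cV[R]_d -> R) (y0 : R) (yl : 'cV[R]_d).
Variables (kap : R -> R) (b : R).
Hypothesis tpsi : tame P C psi.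
Hypothesis ik : forall w, lam.-integrable Rpos
  (EFin \o (fun s => kap s * (mehler_mean psi y0 yl s w - b))).
Hypothesis ika : lam.-integrable Rpos (EFin \o (fun s => kap s * mehler_a s)).

Let domination (i : 'I_d) w : exists2 K : R, 0 <= K &
  lam.-integrable Rpos (EFin \o (fun s => K * `|kap s * mehler_a s|)) /\
  forall s t, Rpos s -> `|t| <= 1 ->
   `|kap s * (mehler_mean psi y0 yl s (w + t *: dir i) - b) -
     kap s * (mehler_mean psi y0 yl s w - b)| <=
   `|t| * (K * `|kap s * mehler_a s|).
Proof.
have [K K0 HK] := mean_lipschitz UE tpsi y0 yl i (norm1_ge0 w).
exists K => //; split.
  have := integrableZl mRpos K (integrable_abse ika).
  by apply: eq_integrable => // s _ /=; rewrite EFinM.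
move=> s t /RposE s0 t1; have /andP[a0 a1] := mehler_a01 (ltW s0).
rewrite -mulrBr opprB addrA subrK normrM.
have := HK (mehler_a s) (mehler_c s) w t (mehler_a01 (ltW s0)) (mehler_c01 (ltW s0)) (lexx _) t1.
move=> /(ler_wpM2l (normr_ge0 (kap s)))/le_trans; apply.
by rewrite normrM (ger0_norm a0) le_eqVlt; apply/orP; left; apply/eqP; ring.
Qed.

Lemma is_derive_mehler (i : 'I_d) w (Dk : R -> R) :
  (forall s, 0 < s -> is_derive w (dir i) (mehler_mean psi y0 yl s) (Dk s)) ->
  lam.-integrable Rpos (EFin \o (fun s => kap s * Dk s)) /\
  is_derive w (dir i) (mehler_integral kap b psi y0 yl)
    (\int[lam]_(s in Rpos) (kap s * Dk s)).
Proof.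
move=> dk; have [K K0 [iK HK]] := domination i w.
apply: (is_derive_integral mRpos ik iK HK) => s /RposE s0.
have ds := dk s s0.
have d1 : is_derive w (dir i) (kap s *: (mehler_mean psi y0 yl s - cst b)) (kap s * Dk s).
  by apply: is_derive_eq; rewrite subr0.
exact: d1.
Qed.

(** The Borel functions [G] stand in for the growth bound, which need not be measurable. *)
Lemma norm_derive_mehler_le (i : 'I_d) w (H Bd : R) : 0 <= H -> 0 <= Bd ->
  derivable (mehler_integral kap b psi y0 yl) w (dir i) ->
  (forall x, plip (line psi x (dir i)) 0 (H * P x)) ->
  (forall s G, 0 < s -> borel G ->
     Pr.-integrable setT (fun om => (G (vecZ Z om))%:E) ->
     (forall z, 0 <= G z <= `|weight y0 yl z| *
        (mehler_a s * (H * P (mehler_a s *: w + mehler_c s *: (S *m z))))) ->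
     EZ Z G <= mehler_a s * H * Bd) ->
  `|'D_(dir i) (mehler_integral kap b psi y0 yl) w| <=
  \int[lam]_(s in Rpos) (`|kap s * mehler_a s| * (H * Bd)).
Proof.
move=> H0 Bd0 dJ pH HG; have [K K0 [iK HK]] := domination i w.
apply: (norm_derive_integral_le mRpos ik iK HK) => //.
- have := integrableZr mRpos (H * Bd) (integrable_abse ika).
  by apply: eq_integrable => // s _ /=; rewrite EFinM.
- by move=> s _; rewrite !mulr_ge0.
move=> s /RposE s0 e e0; have a01 := mehler_a01 (ltW s0); have /andP[a0 a1] := a01.
have [G [bG iG G0 EG]] := mean_limsup UE tpsi y0 yl w a01 (mehler_c01 (ltW s0)) H0 pH.
have e1 : 0 < e / (`|kap s| + 1) by rewrite divr_gt0// ltr_wpDl.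
have := EG _ e1; apply: filterS => n h.
rewrite -mulrBr opprB addrA subrK mulrCA normrM.
rewrite (le_trans (ler_wpM2l (normr_ge0 _) h))// mulrDr lerD//.
  rewrite normrM (ger0_norm a0) -!mulrA ler_wpM2l// mulrA.
  exact: HG.
by rewrite mulrA ler_pdivrMr ?ltr_wpDl// mulrC ler_pM2l// lerDl.
Qed.

End Differentiation.

End MehlerIntegral.

(** * Derivatives of the Stein solution *)

Section CompositionTame.
Context {R : realType} {d : nat}.
Variables (h : R -> R) (g P : 'cV[R]_d -> R) (n : nat).
Hypothesis hn : C_b n h.
Hypothesis gn : C_P n P g.
Hypothesis P_ge0 : forall w, 0 <= P w.
Implicit Types (s : seq 'I_d) (x : 'cV[R]_d).

Let dir (i : 'I_d) : 'cV[R]_d := delta_mx i 0.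

Let dn0 k : 0 <= deriv_norm h k. Proof. exact: deriv_norm_ge0. Qed.

Let gder s w : (size s <= n)%N -> has_pderiv s g w. Proof. by case: gn => + _; exact. Qed.

Let hder k y : (k < n.-1)%N -> derivable (derive1n k h) y 1.
Proof. by move=> kn; apply: (C_b_derivable hn); case: (n) kn. Qed.

Let gP B x : (0 < size B <= n)%N -> `|pderiv B g x| `^ (n%:R / (size B)%:R) <= P x.
Proof. by case: gn => _; exact. Qed.

Let sum_bound s x : (0 < size s <= n)%N ->
  \sum_(p <- set_parts s) faa_bound g (deriv_norm h) p x <=
  h_const (size s) h * P x `^ ((size s)%:R / n%:R).
Proof.
move=> sn; rewrite (le_trans (sum_faa_bound dn0 sn (P_ge0 x) (fun B => gP x)))//.
have -> : \sum_(p <- set_parts s) deriv_norm h (size p) = h_const (size s) h; last by [].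
by case/andP: sn => + _; case E : (size s) => [//|k] _; exact: h_constE E.
Qed.

Let size_lt_pred s : (size s < n)%N -> (size s <= n.-1)%N.
Proof. by case: (n). Qed.

Lemma plip_pderiv_comp_le s x i : (size s < n)%N ->
  plip (line (pderiv s (h \o g)) x (dir i)) 0
    (h_const (size s).+1 h * P x `^ ((size s).+1%:R / n%:R)).
Proof.
move=> sn; apply: plip_le (sum_bound (s := i :: s) x _) _ => //.
have hb k y : (0 < k < n)%N -> `|derive1n k h y| <= deriv_norm h k.
  by move=> kn; exact: (C_b_bound hn).
exact: (plip_pderiv_comp (leq_pred n) gder hder dn0 hb
  (fun k y z => @C_b_lipschitz _ _ _ hn k y z) i x sn (size_lt_pred sn)).
Qed.

Lemma plip_top_pderiv_comp s x i : (size s).+1 = n ->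
  plip (line (pderiv s (h \o g)) x (dir i)) 0 (h_const n h * P x).
Proof.
move=> sn; have ltsn : (size s < n)%N by rewrite -sn.
have := plip_pderiv_comp_le x i ltsn.
by rewrite sn divff ?powRr1// pnatr_eq0 -sn.
Qed.

(** A power of [P] with exponent in [0, 1] is at most [1 + P], whence the form of the bound in
    [tame]. *)
Lemma tame_pderiv_comp s : (size s < n)%N ->
  tame P (h_const (size s).+1 h) (pderiv s (h \o g)).
Proof.
move=> sn; split; first exact: h_const_ge0.
move=> x i; apply: plip_le (plip_pderiv_comp_le x i sn).
rewrite ler_wpM2l ?h_const_ge0//.
have n0 : (0 < n)%N by exact: leq_trans sn.
have th0 : 0 <= (size s).+1%:R / n%:R :> R by rewrite divr_ge0.
have th1 : (size s).+1%:R / n%:R <= 1 :> R.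
  by rewrite ler_pdivrMr ?ltr0n// mul1r ler_nat.
have [P1|P1] := leP (P x) 1.
  rewrite (@le_trans _ _ (1 `^ ((size s).+1%:R / n%:R)))//.
    by apply: ge0_ler_powR => //; rewrite nnegrE.
  by rewrite powR1 lerDl.
rewrite (@le_trans _ _ (P x `^ 1))//; first by apply: ler_powR => //; exact: ltW.
by rewrite powRr1// lerDr.
Qed.

Lemma derivable_pderiv_comp s x i : ((size s).+1 < n)%N ->
  derivable (pderiv s (h \o g)) x (dir i).
Proof.
move=> sn; have sn' : (size (i :: s) <= n.-1)%N by rewrite /=; case: (n) sn.
have [[_ dx] _] := pderiv_comp (leq_pred n) gder hder x sn'.
exact: dx.
Qed.

Lemma derivable_top_pderiv_comp s x i : (forall y, derivable (derive1n n.-1 h) y 1) ->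
  (size s < n)%N -> derivable (pderiv s (h \o g)) x (dir i).
Proof.
move=> htop sn.
have hd k y : (k < n)%N -> derivable (derive1n k h) y 1.
  move=> kn; have [->//|/eqP kn'] := eqVneq k n.-1; apply: hder.
  by case: (n) kn kn' => // m; rewrite ltnS /= leq_eqVlt => /orP[/eqP ->|].
have sn' : (size (i :: s) <= n)%N by [].
have [[_ dx] _] := pderiv_comp (leqnn n) gder hd x sn'.
exact: dx.
Qed.

End CompositionTame.

Section MehlerKernelIntegrable.
Context {R : realType}.
Local Notation lam := (@lebesgue_measure R).
Local Notation Rpos := (`]0%R, +oo[%classic : set R).

Let mRpos : measurable (Rpos : set (measurableTypeR R)).
Proof. exact: measurable_itv. Qed.

Lemma integrable_mehler_exp k : (0 < k)%N ->
  lam.-integrable Rpos (EFin \o (fun t => - mehler_a t ^+ k)).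
Proof.
move=> k0; have [iE _] := @mehler_exp_integral R k k0.
exact: eq_integrable (integrableN iE).
Qed.

Lemma integrable_mehler_singular k :
  lam.-integrable Rpos (EFin \o (fun t => - mehler_a t ^+ k * (mehler_a t / mehler_c t))).
Proof.
have [i1 _] := @mehler_exp_integral R 1 isT.
have [i2 _] := @mehler_singular_integral R.
have [ca cc] := @mehler_continuous R.
have ma : measurable_fun Rpos (@mehler_a R).
  by apply: measurable_funTS; exact: continuous_measurable_fun.
have mc : measurable_fun Rpos (fun t => (@mehler_c R t)^-1).
  apply: open_continuous_measurable_fun => //.
  move=> t; rewrite inE/= in_itv/= andbT => t0; apply: cvgV; last exact: cc.
  by rewrite gt_eqF// mehler_c_gt0.
apply: le_integrable (integrableD mRpos i2 i1) => //.
  apply/measurable_EFinP; apply: measurable_funM.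
    by apply: measurableT_comp => //; exact: measurable_funX.
  exact: measurable_funM.
move=> t; rewrite /= in_itv/= andbT => t0.
have /andP[a0 a1] := mehler_a01 (ltW t0); have c0 := mehler_c_gt0 t0.
have ac0 : 0 <= mehler_a t / mehler_c t by rewrite divr_ge0// ltW.
rewrite lee_fin normrM normrN normrX (ger0_norm a0) (ger0_norm ac0).
rewrite (le_trans _ (ler_norm _))// expr1 (le_trans _ (mehler_ac t0))//.
by rewrite ler_piMl// exprn_ile1.
Qed.

Lemma integrable_mehler_expM k :
  lam.-integrable Rpos (EFin \o (fun t => - mehler_a t ^+ k * mehler_a t)).
Proof.
have := @integrable_mehler_exp k.+1 isT; apply: eq_integrable => // t _ /=.
by rewrite exprSr mulNr.
Qed.

Lemma integrable_mehler_singularM k : lam.-integrable Rpos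
  (EFin \o (fun t => - mehler_a t ^+ k * (mehler_a t / mehler_c t) * mehler_a t)).
Proof.
have := integrable_mehler_singular k.+1; apply: eq_integrable => // t _ /=.
by rewrite exprSr; congr EFin; ring.
Qed.

End MehlerKernelIntegrable.

Section Representation.
Context {R : realType} {disp : measure_display} {Omega : measurableType disp}.
Variables (Pr : probability Omega R) (d : nat) (Z : 'I_d -> {RV Pr >-> R}).
Hypothesis HZ : std_normal_vector Z.
Variables (S : 'M[R]_d) (P : 'cV[R]_d -> R) (U : R -> 'cV[R]_d -> R).
Hypothesis P_ge0 : forall w, 0 <= P w.
Hypothesis UE : integrable_envelope Z S P U.
Implicit Types (w x z m yl : 'cV[R]_d) (t b C : R) (psi : 'cV[R]_d -> R) (kap : R -> R).

Let dir (i : 'I_d) : 'cV[R]_d := delta_mx i 0.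
Local Notation lam := (@lebesgue_measure R).
Local Notation Rpos := (`]0%R, +oo[%classic : set R).
Local Notation mint := (mehler_integral Z S).

Let ik_hyp kap b psi y0 yl := forall w, lam.-integrable Rpos
  (EFin \o (fun t => kap t * (mehler_mean Z S psi y0 yl t w - b))).

Let RposE t : Rpos t -> 0 < t.
Proof. by rewrite /= in_itv/= andbT. Qed.

Let pos01 t : 0 < t -> 0 <= mehler_a t <= 1 /\ 0 <= mehler_c t <= 1.
Proof. by move=> /ltW t0; split; [exact: mehler_a01|exact: mehler_c01]. Qed.

Lemma derivable_mehler C psi (y0 : R) yl kap b i w : tame P C psi ->
  ik_hyp kap b psi y0 yl ->
  lam.-integrable Rpos (EFin \o (fun t => kap t * mehler_a t)) ->
  (forall x, derivable psi x (dir i)) ->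
  derivable (mint kap b psi y0 yl) w (dir i).
Proof.
move=> tpsi ik ika dpsi.
have [_ [dJ _]] := is_derive_mehler UE tpsi ik ika (fun t pt =>
  is_derive_mean UE tpsi y0 yl w (pos01 pt).1 (pos01 pt).2 dpsi).
exact: dJ.
Qed.

Lemma derive_mehler C C' psi (y0 : R) yl kap b i w : tame P C psi ->
  ik_hyp kap b psi y0 yl ->
  lam.-integrable Rpos (EFin \o (fun t => kap t * mehler_a t)) ->
  (forall x, derivable psi x (dir i)) -> tame P C' ('D_(dir i) psi) ->
  'D_(dir i) (mint kap b psi y0 yl) w =
  mint (fun t => kap t * mehler_a t) 0 ('D_(dir i) psi) y0 yl w.
Proof.
move=> tpsi ik ika dpsi tpsi'.
have [_ [_ ->]] := is_derive_mehler UE tpsi ik ika (fun t pt =>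
  is_derive_mean UE tpsi y0 yl w (pos01 pt).1 (pos01 pt).2 dpsi).
apply: eq_Rintegral => t; rewrite inE => /RposE t0; have [a01 c01] := pos01 t0.
rewrite subr0 -mulrA; congr (_ * _).
rewrite /mehler_mean /mean /EZ -RintegralZl//.
  by apply: eq_Rintegral => om _; rewrite mulrCA.
exact: (mean_integrable UE tpsi').
Qed.

Lemma derivable_mehler_shift C psi (y0 : R) yl kap b i m w : tame P C psi ->
  ik_hyp kap b psi y0 yl ->
  lam.-integrable Rpos (EFin \o (fun t => kap t * mehler_a t)) ->
  S *m m = dir i -> derivable (mint kap b psi y0 yl) w (dir i).
Proof.
move=> tpsi ik ika Sm.
have c01 t : 0 < t -> 0 < mehler_c t <= 1.
  by move=> t0; rewrite mehler_c_gt0//; have [_ /andP[]] := pos01 t0.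
have [_ [dJ _]] := is_derive_mehler UE tpsi ik ika (fun t pt =>
  is_derive_mean_shift HZ UE tpsi y0 yl w (pos01 pt).1 (c01 t pt) Sm).
exact: dJ.
Qed.

(** Starting from weight 1 there is no correction term: [dotv yl m] vanishes and the new weight is
    [dotv m]. *)
Lemma derive_mehler_shift C psi kap b i m w : tame P C psi ->
  ik_hyp kap b psi 1 0 ->
  lam.-integrable Rpos (EFin \o (fun t => kap t * mehler_a t)) ->
  S *m m = dir i ->
  'D_(dir i) (mint kap b psi 1 0) w =
  mint (fun t => kap t * (mehler_a t / mehler_c t)) 0 psi 0 m w.
Proof.
move=> tpsi ik ika Sm.
have c01 t : 0 < t -> 0 < mehler_c t <= 1.
  by move=> t0; rewrite mehler_c_gt0//; have [_ /andP[]] := pos01 t0.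
have [_ [_ ->]] := is_derive_mehler UE tpsi ik ika (fun t pt =>
  is_derive_mean_shift HZ UE tpsi 1 0 w (pos01 pt).1 (c01 t pt) Sm).
apply: eq_Rintegral => t; rewrite inE => /RposE t0; have [a01 {}c01] := pos01 t0.
rewrite subr0 -mulrA; congr (_ * _).
rewrite /mehler_mean /mean /EZ -RintegralZl//.
  apply: eq_Rintegral => om _; rewrite /weight.
  have z0 x : dotv (0 : 'cV[R]_d) x = 0 by rewrite /dotv big1// => k _; rewrite mxE mul0r.
  by rewrite !z0; ring.
exact: (mean_integrable UE tpsi).
Qed.

Variables (h : R -> R) (g : 'cV[R]_d -> R) (n : nat).
Hypothesis hn : C_b n h.
Hypothesis gn : C_P n P g.
Implicit Types s : seq 'I_d.

Let phi := h \o g.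
Let b0 := EZ Z (fun z => phi (S *m z)).
Let f0 := mint (fun=> -1) b0 phi 1 0.
(** The Gaussian mean is subtracted only in the solution itself and disappears with the first
    derivative. *)
Let bs s := if s is [::] then b0 else 0.
Let kap1 k t := - (mehler_a t : R) ^+ k.
(** The additional factor comes from the one derivative that does not fall on [phi]. *)
Let kap2 k t := kap1 k t * (mehler_a t / mehler_c t).

Let tphi s : (size s < n)%N -> tame P (h_const (size s).+1 h) (pderiv s phi).
Proof. exact: (tame_pderiv_comp hn gn P_ge0). Qed.

Lemma integrable_mehler_pderiv s : (size s < n)%N ->
  ik_hyp (kap1 (size s)) (bs s) (pderiv s phi) 1 0.
Proof.
case: s => [|i s] sn w.
  exact: (integrable_mehler0 UE w (tphi sn)).
apply: (integrable_mehler UE 1 0 w (tphi sn)).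
exact: integrable_mehler_exp.
Qed.

Lemma pderiv_mehler s : (size s < n)%N -> (forall w, has_pderiv s f0 w) /\
  pderiv s f0 = mint (kap1 (size s)) (bs s) (pderiv s phi) 1 0.
Proof.
elim: s => [|i s IH] sn; first by [].
have sn' : (size s < n)%N by exact: ltnW.
have [hs Es] := IH sn'; have ik := integrable_mehler_pderiv sn'.
have dphi x : derivable (pderiv s phi) x (dir i).
  exact: (derivable_pderiv_comp hn gn sn).
split=> [w|]; first by split=> //; rewrite Es; exact: (derivable_mehler (tphi sn') ik (integrable_mehler_expM _)).
rewrite -[LHS]/('D_(dir i) (pderiv s f0)) Es; apply/funext => w.
rewrite (derive_mehler w (tphi sn') ik (integrable_mehler_expM _) dphi (tphi sn)).
by apply: eq_Rintegral => t _; rewrite /kap1 exprSr mulNr.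
Qed.

Lemma derivable_top_pderiv_mehler s i w : (size s).+1 = n ->
  ((exists m, S *m m = dir i) \/ forall y, derivable (derive1n n.-1 h) y 1) ->
  derivable (pderiv s f0) w (dir i).
Proof.
move=> sn; have sn' : (size s < n)%N by rewrite -sn.
have [_ ->] := pderiv_mehler sn'; have ik := integrable_mehler_pderiv sn'.
case=> [[m Sm]|htop].
  exact: (derivable_mehler_shift (tphi sn') ik (integrable_mehler_expM _) Sm).
apply: (derivable_mehler (tphi sn') ik (integrable_mehler_expM _)) => x.
exact: (derivable_top_pderiv_comp hn gn htop sn').
Qed.

Lemma integrable_mehler_pderiv_shift s yl : (size s < n)%N ->
  ik_hyp (kap2 (size s)) 0 (pderiv s phi) 0 yl.
Proof.
move=> sn w; apply: (integrable_mehler UE 0 yl w (tphi sn)).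
exact: integrable_mehler_singular.
Qed.

(** The inner derivatives [s2] fall on [phi], then [j] is traded for the weight [dotv m]; as this
    weight does not depend on [w], the outer derivatives [s1] fall on [phi] again. *)
Lemma pderiv_mehler_shift s1 s2 j m : (size (s1 ++ s2) < n)%N -> S *m m = dir j ->
  (forall w, has_pderiv (s1 ++ j :: s2) f0 w) /\
  pderiv (s1 ++ j :: s2) f0 =
    mint (kap2 (size (s1 ++ s2))) 0 (pderiv (s1 ++ s2) phi) 0 m.
Proof.
move=> + Sm; elim: s1 => [|i s1 IH] sn.
  have [hs Es] := pderiv_mehler sn; have ik := integrable_mehler_pderiv sn.
  split=> [w|].
    by split=> //; rewrite Es; exact: (derivable_mehler_shift (tphi sn) ik (integrable_mehler_expM _) Sm).
  rewrite -[LHS]/('D_(dir j) (pderiv s2 f0)) Es; apply/funext => w.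
  exact: (derive_mehler_shift w (tphi sn) ik (integrable_mehler_expM _) Sm).
have sn' : (size (s1 ++ s2) < n)%N by exact: ltnW.
have [hs Es] := IH sn'; have ik := integrable_mehler_pderiv_shift m sn'.
have dphi x : derivable (pderiv (s1 ++ s2) phi) x (dir i).
  exact: (derivable_pderiv_comp hn gn sn).
split=> [w|].
  by split=> //; rewrite Es; exact: (derivable_mehler (tphi sn') ik (integrable_mehler_singularM _)).
rewrite -[LHS]/('D_(dir i) (pderiv (s1 ++ j :: s2) f0)) Es; apply/funext => w.
rewrite (derive_mehler w (tphi sn') ik (integrable_mehler_singularM _) dphi (tphi sn)).
by apply: eq_Rintegral => t _; rewrite /kap2 /kap1 /= exprSr; ring.
Qed.

Lemma derivable_top_pderiv_mehler_shift s1 s2 j m i m' w :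
  (size (s1 ++ s2)).+1 = n -> S *m m = dir j -> S *m m' = dir i ->
  derivable (pderiv (s1 ++ j :: s2) f0) w (dir i).
Proof.
move=> sn Sm Sm'; have sn' : (size (s1 ++ s2) < n)%N by rewrite -sn.
have [_ ->] := pderiv_mehler_shift sn' Sm.
have ik := integrable_mehler_pderiv_shift m sn'.
exact: (derivable_mehler_shift (tphi sn') ik (integrable_mehler_singularM _) Sm').
Qed.

End Representation.

(** * Comparison of Gaussian means with the brackets *)

Section Bracket.
Context {R : realType} {disp : measure_display} {Omega : measurableType disp}.
Variables (Pr : probability Omega R) (d : nat) (Z : 'I_d -> {RV Pr >-> R}).
Variables (S : 'M[R]_d) (alpha : R) (P1 P2 : 'cV[R]_d -> R).
Variables (beta gamma delta : nat -> R).
Hypothesis PG : growth_class alpha P1 P2 beta gamma delta.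
Let X om := S *m vecZ Z om.
Hypothesis iP1 : Pr.-integrable setT (fun om => (P1 (X om))%:E).
Let P w := alpha + P1 w + P2 w.
Let b2 y := bound2 Pr y X alpha P1 P2 (beta 2) (gamma 2) (delta 2).

Let alpha0 : 0 <= alpha. Proof. by case: PG. Qed.
Let P1_ge0 w : 0 <= P1 w. Proof. by case: PG => _ /(_ w)[]. Qed.
Let P2_ge0 w : 0 <= P2 w. Proof. by case: PG => _ /(_ w)[]. Qed.
Let beta0 : 0 <= beta 2. Proof. by case: PG => _ _ _ /(_ 2 isT)[]. Qed.
Let gamma0 : 0 <= gamma 2. Proof. by case: PG => _ _ _ /(_ 2 isT)[]. Qed.

Lemma bound2_ge0 y w : (0 <= b2 y w)%E.
Proof.
have I0 (u : Omega -> R) : (0 <= \int[Pr]_om `|u om|%:E)%E.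
  by apply: integral_ge0 => om _; rewrite lee_fin.
have e0 (r : R) : 0 <= r -> (0 <= r%:E)%E by rewrite lee_fin.
rewrite /b2 /bound2 unlock; apply: adde_ge0; first apply: adde_ge0.
- by apply: mule_ge0 => //; exact: e0.
- by apply: mule_ge0; [exact: e0|apply: adde_ge0 => //; apply: mule_ge0 => //; exact: e0].
- by apply: mule_ge0; [apply: mule_ge0 => //|]; exact: e0.
Qed.

Lemma mehler_arg_le a c w x : 0 < a <= 1 -> 0 < c <= 1 ->
  P (a *: w + c *: x) <= alpha + beta 2 * (P1 w + P1 x) +
    gamma 2 * P2 (delta 2 *: w) * P2 (delta 2 *: x).
Proof.
move=> a01 c01; have [h1 h2] := envelope_sub2 PG (a *: w) (c *: x).
have [aw1 _] := envelope_contract PG w a01.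
have [cx1 _] := envelope_contract PG x c01.
have [_ aw2] := envelope_contract PG (delta 2 *: w) a01.
have [_ cx2] := envelope_contract PG (delta 2 *: x) c01.
rewrite /P -!addrA lerD2l; apply: lerD.
  by rewrite (le_trans h1)// ler_wpM2l// lerD.
rewrite (le_trans h2)// -mulrA ler_wpM2l// ler_pM//.
  by rewrite scalerA mulrC -scalerA.
by rewrite scalerA mulrC -scalerA.
Qed.

(** In the majorant of [G] everything but the term in [P2] is measurable and is integrated exactly;
    that term goes into the lower integral of [le_integral_affine]. *)
Lemma EZ_le_bound2 (y0 : R) yl a c (H : R) w (G : 'cV[R]_d -> R) :
  0 < a <= 1 -> 0 < c <= 1 -> 0 <= H -> borel G ->
  Pr.-integrable setT (fun om => (G (vecZ Z om))%:E) ->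
  (forall z, 0 <= G z <= `|weight y0 yl z| * (a * (H * P (a *: w + c *: (S *m z))))) ->
  ((EZ Z G)%:E <= (a * H)%:E * b2 (fun om => weight y0 yl (vecZ Z om)) w)%E.
Proof.
move=> a01 c01 H0 bG iG GP; rewrite EZ_EFin//.
have a0 : 0 <= a by case/andP: a01 => /ltW.
have aH : 0 <= a * H by rewrite mulr_ge0.
pose q om := `|weight y0 yl (vecZ Z om)|.
have mq : measurable_fun setT q.
  by apply: (borel_vecZ Z (F := fun z => `|weight y0 yl z|)); apply: borel_norm; exact: borel_weight.
have mP1 : measurable_fun setT (P1 \o X).
  by apply/measurable_EFinP; exact: measurable_int iP1.
have mG : measurable_fun setT (fun om => G (vecZ Z om)) by exact: borel_vecZ.
have mqP : measurable_fun setT (fun om => q om * P1 (X om)) by exact: measurable_funM.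
have ID (u v : Omega -> R) : measurable_fun setT u -> measurable_fun setT v ->
    (forall om, 0 <= u om) -> (forall om, 0 <= v om) ->
    (\int[Pr]_om (u om + v om)%:E = \int[Pr]_om (u om)%:E + \int[Pr]_om (v om)%:E)%E.
  move=> mu mv u0 v0; rewrite -ge0_integralD//; first by move=> om _; rewrite lee_fin.
  - exact/measurable_EFinP.
  - by move=> om _; rewrite lee_fin.
  - exact/measurable_EFinP.
have IZ (u : Omega -> R) (k : R) : measurable_fun setT u ->
    (forall om, 0 <= u om) -> 0 <= k ->
    (\int[Pr]_om (k * u om)%:E = k%:E * \int[Pr]_om (u om)%:E)%E.
  move=> mu u0 k0; rewrite -ge0_integralZl//; first exact/measurable_EFinP.
  by move=> om _; rewrite lee_fin.
pose m om := (a * H) * (alpha * q om + beta 2 * (q om * P1 (X om) + P1 w * q om)).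
have mZ (u : Omega -> R) (k : R) : measurable_fun setT u -> measurable_fun setT (fun om => k * u om).
  by move=> mu; exact: measurable_funM.
have q0 om : 0 <= q om by exact: normr_ge0.
have qP0 om : 0 <= q om * P1 (X om) by rewrite mulr_ge0.
have Pq0 om : 0 <= P1 w * q om by rewrite mulr_ge0.
have bq0 om : 0 <= beta 2 * (q om * P1 (X om) + P1 w * q om) by rewrite mulr_ge0// addr_ge0.
have aq0 om : 0 <= alpha * q om by rewrite mulr_ge0.
have mbr : measurable_fun setT (fun om => q om * P1 (X om) + P1 w * q om).
  by apply: measurable_funD => //; exact: mZ.
have maq : measurable_fun setT (fun om => alpha * q om + beta 2 * (q om * P1 (X om) + P1 w * q om)).
  by apply: measurable_funD; exact: mZ.
have key := le_integral_affine Pr (f := fun om => G (vecZ Z om)) (m := m)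
  (u := fun om => q om * P2 (delta 2 *: X om)) (c := a * H * (gamma 2 * P2 (delta 2 *: w))) mG _ _ _ _ _ _.
apply: (le_trans (key _ _ _ _ _ _)) => {key}.
- exact: mZ.
- by move=> om; have /andP[] := GP (vecZ Z om).
- by move=> om; rewrite mulr_ge0// addr_ge0.
- by move=> om; rewrite mulr_ge0.
- by rewrite !mulr_ge0.
- move=> om; have /andP[_] := GP (vecZ Z om) => /le_trans; apply.
  have := mehler_arg_le w (X om) a01 c01; rewrite /X -/(q om) => /(ler_wpM2l H0)/(ler_wpM2l a0).
  move=> /(ler_wpM2l (q0 om))/le_trans; apply.
  by rewrite /m /X le_eqVlt; apply/orP; left; apply/eqP; ring.
rewrite /m IZ//; last by move=> om; rewrite addr_ge0.
rewrite ID//; [|exact: mZ|exact: mZ].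
rewrite IZ// IZ//; last by move=> om; rewrite addr_ge0.
rewrite ID//; last exact: mZ.
rewrite IZ// /b2 /bound2 unlock.
rewrite [(a * H * (_ * _))%:E]EFinM -[((a * H)%:E * _ * _)%E]muleA -ge0_muleDr; last 2 first.
- rewrite adde_ge0// mule_ge0 ?lee_fin//; first by apply: integral_ge0 => om _; rewrite lee_fin.
  by rewrite adde_ge0// ?mule_ge0 ?lee_fin//; apply: integral_ge0 => om _; rewrite lee_fin.
- by rewrite mule_ge0 ?lee_fin ?mulr_ge0//; apply: integral_ge0 => om _; rewrite lee_fin mulr_ge0.
apply: lee_wpmul2l; first by rewrite lee_fin.
rewrite le_eqVlt; apply/orP; left; apply/eqP.
have E1 : (\int[Pr]_om (q om * P1 (X om))%:E =
    \int[Pr]_om `|weight y0 yl (vecZ Z om) * P1 (X om)|%:E)%E.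
  by apply: eq_integral => om _; rewrite normrM (ger0_norm (P1_ge0 _)).
have E2 : (\int[Pr]_om (q om * P2 (delta 2 *: X om))%:E =
    \int[Pr]_om `|weight y0 yl (vecZ Z om) * P2 (delta 2 *: X om)|%:E)%E.
  by apply: eq_integral => om _; rewrite normrM (ger0_norm (P2_ge0 _)).
rewrite E1 E2; congr (_ + _ * (_ + _) + _)%E; first by rewrite muleC.
by rewrite EFinM muleAC.
Qed.

End Bracket.

Section TopDerivativeBounds.
Context {R : realType} {disp : measure_display} {Omega : measurableType disp}.
Variables (Pr : probability Omega R) (d : nat) (Z : 'I_d -> {RV Pr >-> R}).
Hypothesis HZ : std_normal_vector Z.
Variables (S : 'M[R]_d) (alpha : R) (P1 P2 : 'cV[R]_d -> R).
Variables (beta gamma delta : nat -> R).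
Hypothesis PG : growth_class alpha P1 P2 beta gamma delta.
Let X om := S *m vecZ Z om.
Hypothesis iP1 : Pr.-integrable setT (fun om => (P1 (X om))%:E).
Let P w := alpha + P1 w + P2 w.
Let b2 y := bound2 Pr y X alpha P1 P2 (beta 2) (gamma 2) (delta 2).
Variable U : R -> 'cV[R]_d -> R.
Hypothesis UE : integrable_envelope Z S P U.
Variables (h : R -> R) (g : 'cV[R]_d -> R) (n : nat).
Hypothesis hn : C_b n h.
Hypothesis gn : C_P n P g.
Implicit Types (s : seq 'I_d) (w x z m yl : 'cV[R]_d) (t b H : R).

Let dir (i : 'I_d) : 'cV[R]_d := delta_mx i 0.
Local Notation lam := (@lebesgue_measure R).
Local Notation Rpos := (`]0%R, +oo[%classic : set R).
Local Notation mint := (mehler_integral Z S).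
Let phi := h \o g.
Let b0 := EZ Z (fun z => phi (S *m z)).
Let f0 := mint (fun=> -1) b0 phi 1 0.

Let P0 w : 0 <= P w.
Proof. by case: PG => ? /(_ w)[? ?] _ _; rewrite !addr_ge0. Qed.

Let mRpos : measurable (Rpos : set (measurableTypeR R)).
Proof. exact: measurable_itv. Qed.

Let RposE t : Rpos t -> 0 < t.
Proof. by rewrite /= in_itv/= andbT. Qed.

Let tphi s : (size s < n)%N -> tame P (h_const (size s).+1 h) (pderiv s phi).
Proof. exact: (tame_pderiv_comp hn gn P0). Qed.

Let hc0 : 0 <= h_const n h. Proof. exact: h_const_ge0. Qed.

Let EZ_le (y0 : R) yl w H (Bd : R) :
  b2 (fun om => weight y0 yl (vecZ Z om)) w = Bd%:E -> 0 <= H ->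
  forall t (G : 'cV[R]_d -> R), 0 < t -> borel G ->
  Pr.-integrable setT (fun om => (G (vecZ Z om))%:E) ->
  (forall z, 0 <= G z <= `|weight y0 yl z| *
    (mehler_a t * (H * P (mehler_a t *: w + mehler_c t *: (S *m z))))) ->
  EZ Z G <= mehler_a t * H * Bd.
Proof.
move=> Eb H0 t G t0 bG iG GP; rewrite -lee_fin EFinM -Eb.
apply: (EZ_le_bound2 PG iP1 _ _ H0 bG iG GP).
  by have /andP[_ ->] := mehler_a01 (ltW t0); rewrite andbT expR_gt0.
by rewrite mehler_c_gt0//; have /andP[_ ->] := mehler_c01 (ltW t0).
Qed.

Let Bd_ge0 y w (Bd : R) : b2 y w = Bd%:E -> 0 <= Bd.
Proof. by move=> E; rewrite -lee_fin -E bound2_ge0. Qed.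

Lemma norm_top_pderiv_mehler_le s i w (Bd : R) : (size s).+1 = n ->
  b2 (fun om => weight 1 0 (vecZ Z om)) w = Bd%:E ->
  derivable (pderiv s f0) w (dir i) ->
  `|pderiv (i :: s) f0 w| <= h_const n h / n%:R * Bd.
Proof.
move=> sn Eb df; have sn' : (size s < n)%N by rewrite -sn.
have [_ Es] := pderiv_mehler P0 UE hn gn sn'.
have ik := integrable_mehler_pderiv P0 UE hn gn sn'.
rewrite -[pderiv _ _ _]/('D_(dir i) (pderiv s f0) w); move: df; rewrite Es => df.
have plp x : plip (line (pderiv s phi) x (dir i)) 0 (h_const n h * P x).
  exact: (plip_top_pderiv_comp hn gn P0 x i sn).
have := norm_derive_mehler_le UE (tphi sn') ik (integrable_mehler_expM _)
  hc0 (Bd_ge0 Eb) df plp (EZ_le Eb hc0).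
move=> /le_trans; apply.
have n0 : (0 < n)%N by rewrite -sn.
have [iE Ile] := @mehler_exp_integral R n n0.
under eq_Rintegral => t tp.
  rewrite inE in tp; have /andP[a0 _] := mehler_a01 (ltW (RposE tp)).
  rewrite mulNr normrN -exprSr sn normrX (ger0_norm a0).
  over.
rewrite RintegralZr// mulrC [leRHS]mulrAC ler_wpM2l// mulr_ge0//.
exact: Bd_ge0 Eb.
Qed.

(** The integrand has at least two factors [mehler_a], so it stays below [c] times the kernel of
    integral at most 1. *)
Let singular_le k (c : R) : (0 < k)%N -> 0 <= c ->
  \int[lam]_(t in Rpos)
    (`|- mehler_a t ^+ k.-1 * (mehler_a t / mehler_c t) * mehler_a t| * c) <= c.
Proof.
move=> k0 c0; have [iE Ile] := @mehler_singular_integral R.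
rewrite (le_trans _ (ler_piMl c0 Ile))// -RintegralZr//.
apply: le_Rintegral => //.
- have := integrableZr mRpos c (integrable_abse (integrable_mehler_singularM k.-1)).
  by apply: eq_integrable => // t _ /=; rewrite EFinM.
- have := integrableZr mRpos c iE.
  by apply: eq_integrable => // t _ /=; rewrite EFinM.
move=> t /RposE t0; rewrite ler_wpM2r//.
have /andP[a0 a1] := mehler_a01 (ltW t0); have cp := mehler_c_gt0 t0.
rewrite !normrM normrN normrX (ger0_norm a0).
rewrite [leLHS](_ : _ = mehler_a t ^+ k.-1 * (mehler_a t ^+ 2 / mehler_c t)).
  by rewrite ler_piMl ?exprn_ile1// divr_ge0 ?sqr_ge0// ltW.
by rewrite normfV (gtr0_norm cp); ring.
Qed.

Lemma norm_top_pderiv_mehler_shift_le s1 s2 i j m w (Bd : R) :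
  (size (s1 ++ s2)).+1 = n -> S *m m = dir j ->
  b2 (fun om => weight 0 m (vecZ Z om)) w = Bd%:E ->
  derivable (pderiv (s1 ++ j :: s2) f0) w (dir i) ->
  `|pderiv (i :: s1 ++ j :: s2) f0 w| <= h_const n h * Bd.
Proof.
move=> sn Sm Eb df; have sn' : (size (s1 ++ s2) < n)%N by rewrite -sn.
have [_ Es] := pderiv_mehler_shift HZ P0 UE hn gn sn' Sm.
have ik := integrable_mehler_pderiv_shift P0 UE hn gn m sn'.
rewrite -[pderiv _ _ _]/('D_(dir i) (pderiv (s1 ++ j :: s2) f0) w).
move: df; rewrite Es => df.
have plp x : plip (line (pderiv (s1 ++ s2) phi) x (dir i)) 0 (h_const n h * P x).
  exact: (plip_top_pderiv_comp hn gn P0 x i sn).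
have := norm_derive_mehler_le UE (tphi sn') ik (integrable_mehler_singularM _)
  hc0 (Bd_ge0 Eb) df plp (EZ_le Eb hc0).
move=> /le_trans; apply.
have n0 : (0 < n)%N by rewrite -sn.
rewrite (_ : size (s1 ++ s2) = n.-1); last by rewrite -sn.
apply: singular_le => //; exact: (mulr_ge0 hc0 (Bd_ge0 Eb)).
Qed.

(* The weight produced by two integrations by parts is symmetric in the two axes,
   so the two derivatives may be exchanged at each time of the semigroup. *)
Lemma norm_top_pderiv_mehler_swap_le s i j mi mj w (Bd : R) :
  (size s).+1 = n -> S *m mi = dir i -> S *m mj = dir j ->
  b2 (fun om => weight 0 mi (vecZ Z om)) w = Bd%:E ->
  `|pderiv (i :: j :: s) f0 w| <= h_const n h * Bd.
Proof.
move=> sn Smi Smj Eb; have sn' : (size s < n)%N by rewrite -sn.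
have [_ Es] := pderiv_mehler_shift (s1 := [::]) HZ P0 UE hn gn sn' Smj.
have ik := integrable_mehler_pderiv_shift P0 UE hn gn mj sn'.
rewrite -[pderiv _ _ _]/('D_(dir i) (pderiv ([::] ++ j :: s) f0) w) Es /=.
have a01 t : 0 < t -> 0 <= mehler_a t <= 1 by move=> /ltW; exact: mehler_a01.
have c01 t : 0 < t -> 0 < mehler_c t <= 1.
  by move=> t0; rewrite mehler_c_gt0//; have /andP[] := mehler_c01 (ltW t0).
have dk t (pt : 0 < t) := is_derive_mean_shift HZ UE (tphi sn') 0 mj w
  (a01 t pt) (c01 t pt) Smi.
have [iD [_ ->]] := is_derive_mehler UE (tphi sn') ik (integrable_mehler_singularM _) dk.
have Bd0 := Bd_ge0 Eb; have HB0 : 0 <= h_const n h * Bd by rewrite mulr_ge0.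
have n0 : (0 < n)%N by rewrite -sn.
rewrite (le_trans (le_normr_Rintegral _ iD))// (le_trans _ (singular_le n0 HB0))//.
apply: le_Rintegral => //; first exact: (integrable_abse iD).
  have := integrableZr mRpos (h_const n h * Bd) (integrable_abse (integrable_mehler_singularM n.-1)).
  by apply: eq_integrable => // t _ /=; rewrite EFinM.
have -> : n.-1 = size s by rewrite -sn.
move=> t /RposE t0 /=; rewrite normrM [leRHS](_ : _ =
  `|- mehler_a t ^+ size s * (mehler_a t / mehler_c t)| * (mehler_a t * (h_const n h * Bd))).
  rewrite ler_wpM2l//.
  have plp x : plip (line (pderiv s phi) x (dir j)) 0 (h_const n h * P x).
    exact: (plip_top_pderiv_comp hn gn P0 x j sn).
  have c01' : 0 <= mehler_c t <= 1 by have /andP[/ltW -> ->] := c01 t t0.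
  (* The axes are now exchanged: the weight belongs to [i], and the difference quotients run along
     [j]. *)
  have [G [bG iG GP EG]] := mean_limsup UE (tphi sn') 0 mi w (a01 t t0) c01' hc0 plp.
  have dj := is_derive_mean_shift HZ UE (tphi sn') 0 mi w
    (a01 t t0) (c01 t t0) Smj.
  have tn0 k : k.+1%:R^-1 != 0 :> R by rewrite invr_neq0// pnatr_eq0.
  have cj := is_derive_seq dj tn0 (@cvg_harmonic R).
  rewrite mulrA; apply/ler_addgt0Pr => e e0; set D := EZ Z _.
  have -> : D = EZ Z (fun z => pderiv s phi (mehler_a t *: w + mehler_c t *: (S *m z)) *
      (mehler_a t / mehler_c t * (weight 0 mi z * dotv mj z - dotv mi mj))).
    apply: eq_Rintegral => om _; rewrite /weight !add0r (dotvC mj mi).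
    by rewrite [dotv mj _ * _]mulrC.
  rewrite -(cvg_lim _ (cvg_norm cj))//; apply: limr_le; first by apply/cvg_ex; eexists; exact: cvg_norm cj.
  apply: filterS (EG e e0) => k; rewrite invrK => /le_trans; apply.
  by rewrite lerD2r; exact: EZ_le Eb hc0 t G t0 bG iG GP.
by have /andP[a0 _] := a01 t t0; rewrite [in LHS]normrM (ger0_norm a0) -!mulrA.
Qed.

End TopDerivativeBounds.

Section SquareRoot.
Context {R : realType} {d : nat}.
Implicit Types S A : 'M[R]_d.

Lemma sqrtmx_unit S A : is_sqrtmx S A -> pos_definite A -> S \in unitmx.
Proof.
move=> [[ST _] SA] [_ A0]; rewrite -row_free_unit -kermx_eq0; apply/negPn/negP => kS.
pose v := nz_row (kermx S).
have v0 : v^T != 0 by rewrite trmx_eq0 nz_row_eq0.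
have vS : v *m S = 0 by apply/eqP; rewrite -sub_kermx nz_row_sub.
by have := A0 _ v0; rewrite trmxK -SA mulmxA vS !mul0mx mxE ltxx.
Qed.

(** By symmetry of the root, the [l]-th row of its inverse is the [l]-th column. *)
Lemma invmx_weight S A z l : is_sqrtmx S A ->
  (invmx S *m z) l 0 = weight 0 (invmx S *m delta_mx l 0) z.
Proof.
move=> [[ST _] _]; rewrite mxE /weight add0r; apply: eq_bigr => k _; congr (_ * _).
have E : (invmx S)^T = invmx S by rewrite trmx_inv ST.
by rewrite -colE mxE -[in RHS]E mxE.
Qed.

Lemma dotv_invmx_gt0 S (l : 'I_d) : S \in unitmx ->
  0 < dotv (invmx S *m delta_mx l 0) (invmx S *m delta_mx l 0).
Proof.
move=> uS; set m := invmx S *m _; have sq k : 0 <= m k 0 * m k 0 by rewrite -expr2 sqr_ge0.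
rewrite lt_neqAle sumr_ge0// andbT eq_sym; apply/negP => /eqP/psumr_eq0P m0.
have : S *m m = delta_mx l 0 by rewrite mulKVmx.
rewrite (_ : m = 0) ?mulmx0.
  by move=> /matrixP/(_ l 0); rewrite !mxE !eqxx => /esym/eqP; rewrite oner_eq0.
apply/matrixP => k j; rewrite (ord1 j) [RHS]mxE; apply/eqP.
by rewrite -sqrf_eq0 expr2; apply/eqP/m0.
Qed.

End SquareRoot.

(** * The Stein solution as a Mehler integral *)

Section SteinSolution.
Context {R : realType} {disp : measure_display} {Omega : measurableType disp}.
Variables (Pr : probability Omega R) (d : nat) (Z : 'I_d -> {RV Pr >-> R}).
Hypothesis HZ : std_normal_vector Z.
Variables (S : 'M[R]_d) (alpha : R) (P1 P2 : 'cV[R]_d -> R).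
Variables (beta gamma delta : nat -> R).
Let X om := S *m vecZ Z om.
Hypothesis PF : class_F Pr X alpha P1 P2 beta gamma delta.
Let P w := alpha + P1 w + P2 w.
Let U := envelope S alpha P1 P2.

Lemma class_F_growth : growth_class alpha P1 P2 beta gamma delta.
Proof. by case: PF => ? [? ?] ? _. Qed.

Let PG := class_F_growth.
Let alpha0 : 0 <= alpha. Proof. by case: PF. Qed.
Let P_ge0 w : 0 <= P1 w /\ 0 <= P2 w. Proof. by case: PG. Qed.
Let beta0 : 0 <= beta 2. Proof. by case: PG => _ _ _ /(_ 2 isT)[]. Qed.
Let gamma0 : 0 <= gamma 2. Proof. by case: PG => _ _ _ /(_ 2 isT)[]. Qed.
Let iP1 : Pr.-integrable setT (fun om => (P1 (X om))%:E). Proof. by case: PF => _ _ _ []. Qed.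

Lemma envelope_integrable :
  (forall l, 0 <= l -> exists2 K : R, 0 <= K &
    forall F, borel F -> (forall z, 0 <= F z <= U l z) ->
      (\int[Pr]_om (F (vecZ Z om))%:E <= K%:E)%E) -> integrable_envelope Z S P U.
Proof.
move=> KH; have [kap kap0 Ush] := envelope_shift S PG.
have U1 := envelope_ge1 S PG; split=> //.
- exact: locally_bounded_envelope PG.
- exact: envelope_mono PG.
- exact: le_envelope PG.
- by move=> l; apply: (majorant_bound HZ kap0 U1 Ush KH).
Qed.

(* If [gamma 2 * P2 (delta 2 *: w) = 0] then [P2] vanishes identically. *)
Let P2_dichotomy w (q : Omega -> R) : (forall om, 0 <= q om) ->
  ((gamma 2)%:E * (P2 (delta 2 *: w))%:E * \int[Pr]_om (q om * P2 (delta 2 *: X om))%:E < +oo)%E ->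
  (\int[Pr]_om (q om * P2 (delta 2 *: X om))%:E < +oo)%E.
Proof.
move=> q0 fI; have [g0|gn0] := eqVneq (gamma 2 * P2 (delta 2 *: w)) 0.
  have P20 x : P2 x = 0.
    have [_] := envelope_sub2 PG w (x - w).
    rewrite mulrA g0 mul0r addrC subrK => h.
    by apply/eqP; rewrite eq_le h; have [_ ->] := P_ge0 x.
  by rewrite integral0_eq// => om _; rewrite P20 mulr0.
have I0 : (0 <= \int[Pr]_om (q om * P2 (delta 2 *: X om))%:E)%E.
  by apply: integral_ge0 => om _; rewrite lee_fin mulr_ge0//; have [] := P_ge0 (delta 2 *: X om).
rewrite ltNge leye_eq; apply/negP => /eqP E; move: fI; rewrite E -EFinM gt0_muley//.
by rewrite lte_fin lt_neqAle eq_sym gn0/= mulr_ge0//; have [] := P_ge0 (delta 2 *: w).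
Qed.

Let int_ge0 (u : Omega -> R) : (forall om, 0 <= u om) -> (0 <= \int[Pr]_om (u om)%:E)%E.
Proof. by move=> u0; apply: integral_ge0 => om _; rewrite lee_fin. Qed.

(** With weight 1 the first bracket is a case of the second, so one comparison serves both
    bounds. *)
Lemma bound1E w : bound1 Pr X alpha P1 P2 (beta 2) (gamma 2) (delta 2) w =
  bound2 Pr (fun om => weight 1 0 (vecZ Z om)) X alpha P1 P2 (beta 2) (gamma 2) (delta 2) w.
Proof.
have I1 : (\int[Pr]_om `|weight 1 0 (vecZ Z om)|%:E = 1)%E.
  under eq_integral do rewrite weight_cst1 normr1.
  by rewrite integral_cst//; have := @probability_setT _ _ _ Pr; rewrite mul1e.
rewrite /bound1 /bound2 unlock I1 mule1 mul1e muleAC; congr (_ + _ * (_ + _) + _ * _ * _)%E.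
  by apply: eq_integral => om _; rewrite weight_cst1 mul1r ger0_norm//; have [] := P_ge0 (X om).
by apply: eq_integral => om _; rewrite weight_cst1 mul1r ger0_norm//; have [] := P_ge0 (delta 2 *: X om).
Qed.

Lemma integrable_envelope1 w :
  (bound1 Pr X alpha P1 P2 (beta 2) (gamma 2) (delta 2) w < +oo)%E -> integrable_envelope Z S P U.
Proof.
move=> fb; apply: envelope_integrable.
have fI : (\int[Pr]_om (1 * P2 (delta 2 *: X om))%:E < +oo)%E.
  apply: (P2_dichotomy (w := w)) => //; apply: le_lt_trans fb.
  rewrite /bound1 unlock; under eq_integral do rewrite mul1r.
  apply: leeDr.
  apply: adde_ge0; first by rewrite lee_fin.
  apply: mule_ge0; first by rewrite lee_fin.
  apply: adde_ge0; first by apply: int_ge0 => om; have [] := P_ge0 (X om).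
  by rewrite lee_fin; have [] := P_ge0 w.
have p1 x : 0 <= P1 x by have [] := P_ge0 x.
have p2 x : 0 <= P2 x by have [] := P_ge0 x.
have ub l := envelope_bound S PG (l := l).
apply: (envelope_integral_case1 p1 p2 iP1 ub).
by move: fI; under eq_integral do rewrite mul1r.
Qed.

Lemma integrable_envelope2 m w : 0 < dotv m m ->
  (bound2 Pr (fun om => weight 0 m (vecZ Z om)) X alpha P1 P2 (beta 2) (gamma 2) (delta 2) w < +oo)%E ->
  integrable_envelope Z S P U.
Proof.
move=> m0 fb; apply: envelope_integrable.
have [kap kap0 Ush] := envelope_shift S PG.
have fI : (\int[Pr]_om (`|weight 0 m (vecZ Z om)| * P2 (delta 2 *: X om))%:E < +oo)%E.
  apply: (P2_dichotomy (w := w)) => //; apply: le_lt_trans fb.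
  have -> : (\int[Pr]_om (`|weight 0 m (vecZ Z om)| * P2 (delta 2 *: X om))%:E =
     \int[Pr]_om `|weight 0 m (vecZ Z om) * P2 (delta 2 *: X om)|%:E)%E.
    apply: eq_integral => om _; rewrite normrM (ger0_norm (_ : 0 <= P2 _))//.
    by have [] := P_ge0 (delta 2 *: X om).
  rewrite /bound2 unlock [in leRHS]muleAC; apply: leeDr.
  apply: adde_ge0; first by apply: mule_ge0; [rewrite lee_fin|exact: int_ge0].
  apply: mule_ge0; first by rewrite lee_fin.
  apply: adde_ge0; first exact: int_ge0.
  by apply: mule_ge0; [exact: int_ge0|rewrite lee_fin; have [] := P_ge0 w].
have p1 x : 0 <= P1 x by have [] := P_ge0 x.
have p2 x : 0 <= P2 x by have [] := P_ge0 x.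
have ub l := envelope_bound S PG (l := l).
apply: (envelope_integral_case2 HZ p1 p2 iP1 ub kap0 Ush m0).
apply: le_lt_trans fI; rewrite le_eqVlt; apply/orP; left; apply/eqP.
by apply: eq_integral => om _; rewrite /weight add0r normrM (ger0_norm (p2 _)).
Qed.

Lemma stein_solutionE (h : R -> R) (g : 'cV[R]_d -> R) n : (0 < n)%N -> C_b n h ->
  C_P n P g -> integrable_envelope Z S P U ->
  stein_solution Pr X h g =
  mehler_integral Z S (fun=> -1) (EZ Z (fun z => (h \o g) (S *m z))) (h \o g) 1 0.
Proof.
move=> n0 hn gn UE; apply/funext => w.
have P0 x : 0 <= P x by have [? ?] := P_ge0 x; rewrite !addr_ge0.
have tphi : tame P (h_const 1 h) (h \o g) := tame_pderiv_comp (s := [::]) hn gn P0 n0.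
have ii := integrable_mehler0 UE w tphi.
have mRpos : measurable (`]0%R, +oo[%classic : set (measurableTypeR R)) by exact: measurable_itv.
rewrite /stein_solution -[LHS]mulN1r -RintegralZl//; last first.
  have := integrableN ii; apply: eq_integrable => // t _ /=.
  rewrite mulN1r opprK unlock /mehler_mean /mean /EZ /Rintegral.
  congr ((fine _ - fine _)%:E); apply: eq_integral => om _.
  by rewrite weight_cst1 mul1r.
apply: eq_Rintegral => t _; congr (_ * _).
rewrite unlock /mehler_mean /mean /EZ /Rintegral.
congr (fine _ - fine _); apply: eq_integral => om _.
by rewrite weight_cst1 mul1r.
Qed.

End SteinSolution.

Section ConstantTestFunction.
Context {R : realType} {disp : measure_display} {Omega : measurableType disp}.
Variables (Pr : probability Omega R) (d : nat).

(** The expectations involved are all the same expression, so they cancel without any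
    integrability. *)
Lemma stein_solution_cst (X : Omega -> 'cV[R]_d) h g : (forall x y, h x = h y) ->
  stein_solution Pr X h g = cst 0.
Proof.
move=> hc; have E (u : Omega -> R) : ('E_Pr[fun om => h (u om)] = 'E_Pr[fun=> h 0%R])%E.
  by congr expectation; apply/funext => om; exact: hc.
apply/funext => w; rewrite /stein_solution.
have mRpos : measurable (`]0%R, +oo[%classic : set (measurableTypeR R)) by exact: measurable_itv.
rewrite (@eq_Rintegral _ _ _ _ _ (cst 0)) => [|t _].
  by rewrite Rintegral_cst// mul0r oppr0.
by rewrite !E subrr.
Qed.

Lemma pderiv_cst0 s (w : 'cV[R]_d) :
  has_pderiv s (cst (0 : R)) w /\ pderiv s (cst (0 : R)) = cst 0.
Proof.
elim: s w => [|i s IH] w //=; have E : pderiv s (cst (0 : R)) = cst 0 by have [] := IH w.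
split; first by split=> [x|]; [have [] := IH x|rewrite E; exact: derivable_cst].
by apply/funext => x; rewrite E derive_cst.
Qed.

End ConstantTestFunction.

(** * The two bounds *)

Theorem proposition2p1 (R : realType) (disp : measure_display)
  (Omega : measurableType disp) (Pr : probability Omega R)
  (d : nat) (Z : 'I_d -> {RV Pr >-> R})
  (Sigma Sigma_half : 'M[R]_d)
  (h : R -> R) (g : 'cV[R]_d -> R)
  (alpha : R) (P1 P2 : 'cV[R]_d -> R) (beta gamma delta : nat -> R)
  (n : nat) (i : n.-tuple 'I_d) :
  let X := fun om : Omega => Sigma_half *m vecZ Z om in
  let Y := fun om : Omega => invmx Sigma_half *m vecZ Z om in
  let P := fun w => alpha + P1 w + P2 w in
  let f := stein_solution Pr X h g in
  std_normal_vector Z ->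
  is_sqrtmx Sigma_half Sigma ->
  (nonneg_definite Sigma -> (1 <= n)%N ->
   C_b n h -> C_P n P g -> class_F Pr X alpha P1 P2 beta gamma delta ->
   let B := fun w => ((h_const n h / n%:R)%:E *
     bound1 Pr X alpha P1 P2 (beta 2%N) (gamma 2%N) (delta 2%N) w)%E in
   forall w,
   [/\ (B w < +oo)%E -> forall s, (size s < n)%N -> has_pderiv s f w,
       (B w < +oo)%E ->
         (pos_definite Sigma \/ forall x, derivable (derive1n n.-1 h) x 1) ->
         has_pderiv i f w &
       has_pderiv i f w -> (`|pderiv i f w|%:E <= B w)%E])
  /\
  (pos_definite Sigma -> (2 <= n)%N ->
   C_b n.-1 h -> C_P n.-1 P g ->
   class_Fstar Z X alpha P1 P2 beta gamma delta ->
   let B := fun w => ((h_const n.-1 h)%:E *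
     \big[mine/+oo]_(j < n)
       bound2 Pr (fun om => Y om (tnth i j) 0%R) X alpha P1 P2
         (beta 2%N) (gamma 2%N) (delta 2%N) w)%E in
   forall w,
     ((B w < +oo)%E -> has_pderiv i f w) /\
     (has_pderiv i f w -> (`|pderiv i f w|%:E <= B w)%E)).
Proof.
move=> X Y P f HZ sqS; split.
  move=> _ n0 hn gn PF B w.
  have [alpha0 [P_ge0 _] _ [iP1 _]] := PF; have PG := class_F_growth PF.
  have P0 x : 0 <= P x by have [? ?] := P_ge0 x; rewrite !addr_ge0.
  set b1 := bound1 Pr X alpha P1 P2 (beta 2) (gamma 2) (delta 2) w.
  have b10 : (0 <= b1)%E.
    rewrite /b1 (bound1E PF); exact: (bound2_ge0 Z Sigma_half PG).
  have hc0 : 0 <= h_const n h by exact: h_const_ge0.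
  (* If the constant is 0, both sides vanish, the product with a possibly infinite bracket being 0
     by convention. *)
  have [hc|hcn] := eqVneq (h_const n h) 0.
    have fE : f = cst 0 by apply: stein_solution_cst; exact: (C_b_const hn n0 hc).
    rewrite /B hc mul0r mul0e fE; split=> [_ s _|_ _|_]; try by have [] := pderiv_cst0 s w.
      by have [] := pderiv_cst0 i w.
    by have [_ ->] := pderiv_cst0 i w; rewrite normr0.
  have hn0 : 0 < h_const n h / n%:R by rewrite divr_gt0 ?ltr0n// lt_neqAle eq_sym hcn.
  have [Boo|] := eqVneq (B w) +oo%E; first by rewrite Boo; split=> //; rewrite leey.
  rewrite -ltey => Boo.
  have b1oo : (b1 < +oo)%E.
    rewrite ltNge leye_eq; apply/negP => /eqP E.
    by move: Boo; rewrite /B -/b1 E gt0_muley.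
  have UE := integrable_envelope1 HZ PF b1oo.
  have fE : f = _ := stein_solutionE PF n0 hn gn UE.
  have hs s : (size s < n)%N -> forall x, has_pderiv s f x.
    move=> sn; rewrite fE.
    by have [] := pderiv_mehler P0 UE hn gn sn.
  case: i => -[|i0 s] /= si; first by rewrite -(eqP si) in n0.
  have sn : (size s).+1 = n by exact/eqP.
  have sn' : (size s < n)%N by rewrite -sn.
  split=> [_ s' s'n|_ htop|[_ df]]; first exact: hs.
    split; first exact: hs.
    rewrite fE; apply: (derivable_top_pderiv_mehler HZ P0 UE hn gn sn).
    case: htop => [PD|]; [left|by right].
    exists (invmx Sigma_half *m delta_mx i0 0).
    by rewrite mulKVmx// (sqrtmx_unit sqS PD).
  have b1E : b1 = (fine b1)%:E by rewrite fineK// ge0_fin_numE.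
  rewrite /B -/b1 b1E -EFinM lee_fin; rewrite fE in df *.
  apply: (norm_top_pderiv_mehler_le PG iP1 UE hn gn sn _ df).
  by rewrite -b1E /b1 (bound1E PF).
move=> PD n2 hn gn [PF _] B w.
have n0 : (0 < n.-1)%N by case: (n) n2 => [|[]].
have [alpha0 [P_ge0 _] _ [iP1 _]] := PF; have PG := class_F_growth PF.
have P0 x : 0 <= P x by have [? ?] := P_ge0 x; rewrite !addr_ge0.
have uS := sqrtmx_unit sqS PD.
pose m (l : 'I_d) : 'cV[R]_d := invmx Sigma_half *m delta_mx l 0.
have Sm l : Sigma_half *m m l = delta_mx l 0 by rewrite mulKVmx.
have YE l : (fun om => Y om l 0) = fun om => weight 0 (m l) (vecZ Z om).
  by apply/funext => om; exact: invmx_weight sqS.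
pose b2 l := bound2 Pr (fun om => weight 0 (m l) (vecZ Z om)) X alpha P1 P2
  (beta 2) (gamma 2) (delta 2) w.
have BE : B w = ((h_const n.-1 h)%:E * \big[mine/+oo]_(j < n) b2 (tnth i j))%E.
  by congr (_ * _)%E; apply: eq_bigr => j _; rewrite YE.
have b20 l : (0 <= b2 l)%E by exact: (bound2_ge0 Z Sigma_half PG).
have hc0 : 0 <= h_const n.-1 h by exact: h_const_ge0.
have [hc|hcn] := eqVneq (h_const n.-1 h) 0.
  have fE : f = cst 0 by apply: stein_solution_cst; exact: (C_b_const hn n0 hc).
  rewrite BE hc mul0e fE; have [h1 h2] := pderiv_cst0 i w.
  by split=> // _; rewrite h2 normr0.
have hn0 : 0 < h_const n.-1 h by rewrite lt_neqAle eq_sym hcn.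
have UEj j : (b2 (tnth i j) < +oo)%E ->
    integrable_envelope Z Sigma_half P (envelope Sigma_half alpha P1 P2).
  by move=> b2oo; apply: (integrable_envelope2 HZ PF _ b2oo); exact: dotv_invmx_gt0.
split=> [Boo|].
  (* A minimum below [+oo] requires one finite bracket, and one is enough to make the envelope
     integrable. *)
  have [j bj] : exists j, (b2 (tnth i j) < +oo)%E.
    apply: contrapT => /forallNP noj; move: Boo; rewrite BE.
    suff -> : \big[mine/+oo%E]_(j < n) b2 (tnth i j) = +oo%E by rewrite gt0_muley.
    apply: (big_ind (fun x => x = +oo%E)) => [//|x y -> ->|j _]; first exact: minxx.
    by apply/eqP; rewrite -leye_eq leNgt; apply/negP.
  have UE := UEj j bj; rewrite /f (stein_solutionE PF n0 hn gn UE).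
  clear BE UEj bj j B Boo.
  (* The second index is traded for a weight, then the outermost one as well, so only [n - 2]
     derivatives fall on [h \o g]. *)
  case: i => -[|i0 [|i1 s]] /= si; try by rewrite -(eqP si) in n2.
  have sn : (size s).+1 = n.-1 by rewrite -(eqP si).
  have sn' : (size ([::] ++ s) < n.-1)%N by rewrite -sn.
  have [hp _] := pderiv_mehler_shift HZ P0 UE hn gn sn' (Sm i1).
  split; first exact: hp.
  exact: (derivable_top_pderiv_mehler_shift (s1 := [::]) HZ P0 UE hn gn sn (Sm i1) (Sm i0)).
move=> hi; rewrite BE.
have key j : (`|pderiv i f w|%:E <= (h_const n.-1 h)%:E * b2 (tnth i j))%E.
  have [Boo|] := eqVneq (b2 (tnth i j)) +oo%E; first by rewrite Boo gt0_muley// leey.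
  rewrite -ltey => bj; have UE := UEj j bj.
  have bE : b2 (tnth i j) = (fine (b2 (tnth i j)))%:E by rewrite fineK// ge0_fin_numE.
  have fE : f = _ := stein_solutionE PF n0 hn gn UE.
  rewrite bE -EFinM lee_fin; move: hi bE; rewrite fE => {B BE UEj bj}.
  case: i j => -[|i0 t] /= st j hi bE; first by rewrite -(eqP st) in n2.
  (* At position 0 the weight belongs to the outermost index, which has to be exchanged with the
     next one. *)
  have [j0|j0] := posnP j.
    case: t st j hi j0 bE => [|i1 s] /= st j hi j0 bE; first by rewrite -(eqP st) in n2.
    have sn : (size s).+1 = n.-1 by rewrite -(eqP st).
    rewrite !(tnth_nth i0) /= j0 /= in bE *.
    exact: (norm_top_pderiv_mehler_swap_le HZ PG iP1 UE hn gn sn (Sm i0) (Sm i1) bE).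
  have jt : (j.-1 < size t)%N by rewrite -ltnS prednK// (eqP st).
  set l := tnth _ j in bE *.
  (* Position [j] of the whole list is position [j.-1] of its tail [t], which is split there. *)
  have tE : t = take j.-1 t ++ l :: drop j t.
    rewrite /l (tnth_nth i0) /= -[in nth _ _ _](prednK j0)/= -[in drop _ _](prednK j0).
    by rewrite -drop_nth// cat_take_drop.
  have sn : (size (take j.-1 t ++ drop j t)).+1 = n.-1.
    rewrite size_cat size_takel ?size_drop ?(ltnW jt)//.
    by rewrite -addSn prednK// subnKC -?(eqP st)// -ltnS (eqP st).
  move: hi => [_]; rewrite {1 2}tE => df.
  exact: (norm_top_pderiv_mehler_shift_le HZ PG iP1 UE hn gn sn (Sm _) bE df).
elim/big_ind: _ => [|x y hx hy|j _]; [by rewrite gt0_muley// leey| |exact: key].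
by rewrite minEle; case: ifP.
Qed.
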